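(* Let $\Omega\subset\mathbb{H}$ be a slice contractible circular domain. Then any never vanishing $g\in\mathcal{R}(\Omega)$ such that $g_v$ has no non-real isolated zeroes has a $*$-logarithm, i.e. there exists $f\in\mathcal{R}(\Omega)$ with $\exp_*(f)=g$.
   Context: $\mathbb{H}$ is the algebra of quaternions; $q=q_0+q_v$ with $q_0$ real and $q_v$ purely imaginary, $q^c=q_0-q_v$, $\mathbb{S}=\{I\in\mathbb{H}: I^2=-1\}$, $\mathbb{C}_I=\mathbb{R}+\mathbb{R}I$, $\mathbb{C}_I^+=\{\alpha+I\beta:\beta\ge0\}$, $\mathbb{S}_q=\{q_0+\|q_v\|J: J\in\mathbb{S}\}$, $\Omega_I=\Omega\cap\mathbb{C}_I$, $\Omega_I^+=\Omega\cap\mathbb{C}_I^+$. A domain (nonempty connected open set) $\Omega\subset\mathbb{H}$ is circular if $\mathbb{S}_q\subset\Omega$ for all $q\in\Omega$; it is a slice domain if $\Omega\cap\mathbb{R}\neq\emptyset$ and a product domain if $\Omega\cap\mathbb{R}=\emptyset$. It is slice contractible if, for some (equivalently any) $I\in\mathbb{S}$, $\Omega_I$ is a simply connected domain when $\Omega$ is slice, respectively $\Omega_I^+$ is a simply connected domain when $\Omega$ is product. A function $f:\Omega\to\mathbb{H}$ is slice regular if $f(\alpha+I\beta)=F_0(\alpha+\sqrt{-1}\beta)+I F_1(\alpha+\sqrt{-1}\beta)$ for all $I\in\mathbb{S}$ and $\alpha,\beta\in\mathbb{R}$ with $\alpha+I\beta\in\Omega$, where $F_0,F_1:\{\alpha+\sqrt{-1}\beta:\alpha+I\beta\in\Omega\}\to\mathbb{H}$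 are $C^1$, $F_0(\bar z)=F_0(z)$, $F_1(\bar z)=-F_1(z)$ and $\partial_\alpha F_0=\partial_\beta F_1$, $\partial_\beta F_0=-\partial_\alpha F_1$. $\mathcal{R}(\Omega)$ is the set of slice regular functions; $f\in\mathcal{R}(\Omega)$ is slice preserving if $f(\Omega_I)\subset\mathbb{C}_I$ for all $I\in\mathbb{S}$, and $\mathcal{R}_{\mathbb{R}}(\Omega)$ is the set of slice preserving functions. The $*$-product is $(f*g)(q)=0$ if $f(q)=0$, and $(f*g)(q)=f(q)\,g(f(q)^{-1}qf(q))$ otherwise; with pointwise sum it makes $\mathcal{R}(\Omega)$ an associative algebra. The slice conjugate $f^c$ is the function induced by $(F_0^c,F_1^c)$ (pointwise conjugates), and $f^s=f*f^c$. Every $f\in\mathcal{R}(\Omega)$ is uniquely $f=f_0+f_1i+f_2j+f_3k$ with $f_\ell\in\mathcal{R}_{\mathbb{R}}(\Omega)$; $f_0$ is its real part and $f_v=f-f_0$ its vector part. $\exp_*(f)=\sum_{n\ge0}f^{*n}/n!$, with $f^{*n}$ the $n$-th $*$-power. Non-real isolated zeroes: let $f\in\mathcal{R}(\Omega)$ with $f^s\not\equiv0$ and $q_0\in\Omega\setminus\mathbb{R}$. Write $f=\Delta^m\tilde f$ with $m\ge0$ the largest integer for which this is possible with $\tilde f\in\mathcal{R}(\Omega)$, where $\Delta(q)=q^2-2q\,\mathrm{Re}(q_0)+|q_0|^2$ (so $\tilde f\not\equiv0$ on $\mathbb{S}_{q_0}$). The point $q_0$ is a non-real isolated zero of $f$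 if $\tilde f(q_0)=0$. If $f^s\equiv0$, $f$ has no non-real isolated zeroes. *)

(* Defs.v *)
From HB Require Import structures.
From mathcomp Require Import all_boot all_order all_algebra.
From mathcomp Require Import ring lra.
From mathcomp Require Import all_classical all_reals all_analysis.

Set Implicit Arguments.
Unset Strict Implicit.
Unset Printing Implicit Defensive.

Import Order.TTheory GRing.Theory Num.Theory.
Import numFieldNormedType.Exports.

Local Open Scope classical_set_scope.
Local Open Scope ring_scope.

Record quat (R : realType) : Type := Quat { qre : R; qi : R; qj : R; qk : R }.

Section QuaternionAlgebra.
Context {R : realType}.
Implicit Types (p q r : quat R) (a : R).

Lemma quatP p q :
  qre p = qre q -> qi p = qi q -> qj p = qj q -> qk p = qk q -> p = q.
Proof. by case: p q => [a b c d] [a' b' c' d'] /= -> -> -> ->. Qed.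

Definition quat_tuple q : R * R * R * R := (qre q, qi q, qj q, qk q).
Definition tuple_quat (t : R * R * R * R) : quat R :=
  Quat t.1.1.1 t.1.1.2 t.1.2 t.2.

Fact quat_tupleK : cancel quat_tuple tuple_quat.
Proof. by case. Qed.

HB.instance Definition _ := Equality.copy (quat R) (can_type quat_tupleK).
HB.instance Definition _ := Choice.copy (quat R) (can_type quat_tupleK).

Definition qzero : quat R := Quat 0 0 0 0.
Definition qopp q : quat R := Quat (- qre q) (- qi q) (- qj q) (- qk q).
Definition qadd p q : quat R :=
  Quat (qre p + qre q) (qi p + qi q) (qj p + qj q) (qk p + qk q).
Definition qscale a q : quat R :=
  Quat (a * qre q) (a * qi q) (a * qj q) (a * qk q).
Definition qone : quat R := Quat 1 0 0 0.
Definition qmul p q : quat R :=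
  Quat (qre p * qre q - qi p * qi q - qj p * qj q - qk p * qk q)
       (qre p * qi q + qi p * qre q + qj p * qk q - qk p * qj q)
       (qre p * qj q - qi p * qk q + qj p * qre q + qk p * qi q)
       (qre p * qk q + qi p * qj q - qj p * qi q + qk p * qre q).

Fact qaddA : associative qadd.
Proof. by move=> p q r; apply: quatP => /=; ring. Qed.

Fact qaddC : commutative qadd.
Proof. by move=> p q; apply: quatP => /=; ring. Qed.

Fact qadd0q : left_id qzero qadd.
Proof. by move=> q; apply: quatP => /=; ring. Qed.

Fact qaddNq : left_inverse qzero qopp qadd.
Proof. by move=> q; apply: quatP => /=; ring. Qed.

HB.instance Definition _ :=
  GRing.isZmodule.Build (quat R) qaddA qaddC qadd0q qaddNq.

Fact qmulA : associative qmul.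
Proof. by move=> p q r; apply: quatP => /=; ring. Qed.

Fact qmul1q : left_id qone qmul.
Proof. by move=> q; apply: quatP => /=; ring. Qed.

Fact qmulq1 : right_id qone qmul.
Proof. by move=> q; apply: quatP => /=; ring. Qed.

Fact qmulDl : left_distributive qmul +%R.
Proof. by move=> p q r; apply: quatP => /=; ring. Qed.

Fact qmulDr : right_distributive qmul +%R.
Proof. by move=> p q r; apply: quatP => /=; ring. Qed.

Fact qone_neq0 : qone != 0.
Proof. by apply/eqP => /(congr1 (@qre R))/eqP; rewrite oner_eq0. Qed.

HB.instance Definition _ := GRing.Zmodule_isNzRing.Build (quat R)
  qmulA qmul1q qmulq1 qmulDl qmulDr qone_neq0.

Fact qscaleA a b q : qscale a (qscale b q) = qscale (a * b) q.
Proof. by apply: quatP => /=; ring. Qed.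

Fact qscale1 : left_id 1 qscale.
Proof. by move=> q; apply: quatP => /=; ring. Qed.

Fact qscaleDr : right_distributive qscale +%R.
Proof. by move=> a p q; apply: quatP => /=; ring. Qed.

Fact qscaleDl q : {morph qscale^~ q : a b / a + b}.
Proof. by move=> a b; apply: quatP => /=; ring. Qed.

HB.instance Definition _ := GRing.Zmodule_isLmodule.Build R (quat R)
  qscaleA qscale1 qscaleDr qscaleDl.

Fact qscaleAl a p q : a *: (p * q) = (a *: p) * q.
Proof. by apply: quatP => /=; ring. Qed.

HB.instance Definition _ :=
  GRing.Lmodule_isLalgebra.Build R (quat R) qscaleAl.

Fact qscaleAr a p q : a *: (p * q) = p * (a *: q).
Proof. by apply: quatP => /=; ring. Qed.

HB.instance Definition _ :=
  GRing.Lalgebra_isAlgebra.Build R (quat R) qscaleAr.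

Definition qconj q : quat R := Quat (qre q) (- qi q) (- qj q) (- qk q).

Definition qim q : quat R := Quat 0 (qi q) (qj q) (qk q).

Definition qnormsq q : R := qre q ^+ 2 + qi q ^+ 2 + qj q ^+ 2 + qk q ^+ 2.

Definition qnorm q : R := Num.sqrt (qnormsq q).

Lemma qnormsq_ge0 q : 0 <= qnormsq q.
Proof. by rewrite !addr_ge0 ?sqr_ge0. Qed.

Lemma qnorm_sqr q : qnorm q ^+ 2 = qnormsq q.
Proof. by rewrite sqr_sqrtr // qnormsq_ge0. Qed.

Lemma qnormsq_eq0 q : (qnormsq q == 0) = (q == 0).
Proof.
apply/eqP/eqP => [|->]; last by rewrite /qnormsq /= expr0n /= !addr0.
by rewrite /qnormsq => h; apply: quatP => /=; nra.
Qed.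

Fact qnormD p q : qnorm (p + q) <= qnorm p + qnorm q.
Proof.
rewrite -(@ler_pXn2r _ 2) ?nnegrE ?addr_ge0 ?sqrtr_ge0 //.
rewrite sqrrD !qnorm_sqr.
set d := qre p * qre q + qi p * qi q + qj p * qj q + qk p * qk q.
have -> : qnormsq (p + q) = qnormsq p + d *+ 2 + qnormsq q.
  by rewrite /qnormsq /d /=; ring.
rewrite lerD2r lerD2l lerMn2r /=; apply: le_trans (ler_norm _) _.
rewrite -(@ler_pXn2r _ 2) ?nnegrE ?mulr_ge0 ?sqrtr_ge0 //.
rewrite real_normK ?num_real // exprMn !qnorm_sqr -subr_ge0.
have -> : qnormsq p * qnormsq q - d ^+ 2 = qnormsq (qim (qconj p * q)).
  by rewrite /qnormsq /d /=; ring.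
exact: qnormsq_ge0.
Qed.

Fact qnormZ a q : qnorm (a *: q) = `|a| * qnorm q.
Proof.
rewrite /qnorm; have -> : qnormsq (a *: q) = a ^+ 2 * qnormsq q.
  by rewrite /qnormsq /=; ring.
by rewrite sqrtrM ?sqr_ge0 // sqrtr_sqr.
Qed.

Fact qnorm0_eq0 q : qnorm q = 0 -> q = 0.
Proof.
by move=> h; apply/eqP; rewrite -qnormsq_eq0 -qnorm_sqr h expr0n.
Qed.

HB.instance Definition _ :=
  Lmodule_isNormed.Build R (quat R) qnormD qnormZ qnorm0_eq0.

Definition qinv q : quat R := (`|q| ^+ 2)^-1 *: qconj q.

Lemma qconj_mul q : qconj q * q = (`|q| ^+ 2) *: 1.
Proof.
by rewrite /Num.norm /= qnorm_sqr /qnormsq; apply: quatP => /=; ring.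
Qed.

Lemma qmul_conj q : q * qconj q = (`|q| ^+ 2) *: 1.
Proof.
by rewrite /Num.norm /= qnorm_sqr /qnormsq; apply: quatP => /=; ring.
Qed.

Fact qmulVq : {in [pred q | q != 0], left_inverse 1 qinv *%R}.
Proof.
move=> q; rewrite inE => q0.
by rewrite -qscaleAl qconj_mul scalerA mulVf ?scale1r // sqrf_eq0 normr_eq0.
Qed.

Fact qmulqV : {in [pred q | q != 0], right_inverse 1 qinv *%R}.
Proof.
move=> q; rewrite inE => q0.
by rewrite -qscaleAr qmul_conj scalerA mulVf ?scale1r // sqrf_eq0 normr_eq0.
Qed.

Fact qunitP p q : q * p = 1 /\ p * q = 1 -> p \in [pred q | q != 0].
Proof.
move=> [qp _]; rewrite inE; apply/eqP => p0.
by move: qp; rewrite p0 mulr0 => /esym/eqP; rewrite oner_eq0.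
Qed.

Fact qinv_out : {in [predC [pred q | q != 0]], qinv =1 id}.
Proof.
move=> q; rewrite !inE negbK => /eqP ->.
by rewrite /qinv normr0; apply: quatP => /=; ring.
Qed.

HB.instance Definition _ := GRing.NzRing_hasMulInverse.Build (quat R)
  qmulVq qmulqV qunitP qinv_out.

Definition quatI : quat R := Quat 0 1 0 0.
Definition quatJ : quat R := Quat 0 0 1 0.
Definition quatK : quat R := Quat 0 0 0 1.

End QuaternionAlgebra.

Section SimplyConnected.
Context {R : realType} {T : topologicalType}.
Implicit Types (A C : set T).

Local Notation I01 := (`[0 : R, 1 : R]%classic).

(* A path is a total function, constrained on [0, 1] only. *)
Definition path_in A (c : R -> T) : Prop :=
  {within I01, continuous c} /\ (forall t, I01 t -> A (c t)).

Definition path_connected A : Prop :=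
  forall x y, A x -> A y -> exists c, [/\ path_in A c, c 0 = x & c 1 = y].

(* Homotopy to the constant loop, inside A and relative to the base point. *)
Definition null_homotopic_in A (c : R -> T) : Prop :=
  exists h : R * R -> T,
    [/\ {within I01 `*` I01, continuous h},
        forall s t, I01 s -> I01 t -> A (h (s, t)),
        forall t, I01 t -> h (0, t) = c t,
        forall t, I01 t -> h (1, t) = c 0 &
        forall s, I01 s -> h (s, 0) = c 0 /\ h (s, 1) = c 0].

Definition simply_connected A : Prop :=
  path_connected A /\
  forall c, path_in A c -> c 0 = c 1 -> null_homotopic_in A c.

Definition domain A : Prop := [/\ A !=set0, open A & connected A].

(* Domain of the subspace C. *)
Definition domain_in C A : Prop :=
  [/\ A !=set0, exists2 U, open U & A = U `&` C & connected A].

End SimplyConnected.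

Section SliceRegular.
Context {R : realType}.
Local Notation H := (quat R).
Implicit Types (Omega : set H) (f g : H -> H) (q I J : H).

Definition realq : set H := range (fun a : R => a%:A).

Definition imag_units : set H := [set I | I ^+ 2 = -1].

Definition slice_pt I (a b : R) : H := a%:A + b *: I.

Definition slice I : set H := [set slice_pt I a b | a in setT & b in setT].

Definition half_slice I : set H :=
  [set slice_pt I a b | a in setT & b in [set b : R | 0 <= b]].

Definition qsphere q : set H :=
  [set slice_pt J (qre q) `|qim q| | J in imag_units].

Definition circular Omega : Prop := forall q, Omega q -> qsphere q `<=` Omega.

Definition slice_domain Omega : Prop := Omega `&` realq !=set0.

Definition product_domain Omega : Prop := Omega `&` realq = set0.

Definition slice_contractible Omega : Prop :=
  (slice_domain Omega -> exists2 I, imag_units I &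
     domain_in (slice I) (Omega `&` slice I) /\
     simply_connected (R := R) (Omega `&` slice I)) /\
  (product_domain Omega -> exists2 I, imag_units I &
     domain_in (slice I) (Omega `&` half_slice I) /\
     simply_connected (R := R) (Omega `&` half_slice I)).

(* Functions on Omega are total functions of which only the values on Omega
   matter.  The complex plane carrying the stem functions is R * R. *)

Definition stem_dom Omega : set (R * R) :=
  [set z | exists2 I, imag_units I & Omega (slice_pt I z.1 z.2)].

Definition partial_re (F : R * R -> H) (z : R * R) : H := 'D_(1, 0) F z.
Definition partial_im (F : R * R -> H) (z : R * R) : H := 'D_(0, 1) F z.

Definition C1_on (D : set (R * R)) (F : R * R -> H) : Prop :=
  forall z, D z ->
    [/\ derivable F z (1, 0), derivable F z (0, 1),
        {for z, continuous (partial_re F)} &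
        {for z, continuous (partial_im F)}].

Definition holomorphic_stem Omega (F0 F1 : R * R -> H) : Prop :=
  [/\ C1_on (stem_dom Omega) F0, C1_on (stem_dom Omega) F1,
      forall a b, stem_dom Omega (a, b) ->
        F0 (a, - b) = F0 (a, b) /\ F1 (a, - b) = - F1 (a, b) &
      forall z, stem_dom Omega z ->
        partial_re F0 z = partial_im F1 z /\
        partial_im F0 z = - partial_re F1 z].

Definition induced_by Omega (F0 F1 : R * R -> H) f : Prop :=
  forall I a b, imag_units I -> Omega (slice_pt I a b) ->
    f (slice_pt I a b) = F0 (a, b) + I * F1 (a, b).

Definition slice_regular Omega f : Prop :=
  exists F0 F1, holomorphic_stem Omega F0 F1 /\ induced_by Omega F0 F1 f.

Definition slice_preserving Omega f : Prop :=
  slice_regular Omega f /\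
  forall I, imag_units I -> f @` (Omega `&` slice I) `<=` slice I.

Definition star_mul f g : H -> H := fun q =>
  if f q == 0 then 0 else f q * g ((f q)^-1 * q * f q).

Definition star_pow f (n : nat) : H -> H := iter n (star_mul f) (fun=> 1).

(* fc is the slice conjugate of f on Omega. *)
Definition slice_conj Omega f (fc : H -> H) : Prop :=
  exists F0 F1,
    [/\ holomorphic_stem Omega F0 F1, induced_by Omega F0 F1 f &
        induced_by Omega (qconj \o F0) (qconj \o F1) fc].

Definition symmetrization_neq0 Omega f : Prop :=
  exists2 fc, slice_conj Omega f fc &
    exists2 q, Omega q & star_mul f fc q != 0.

(* fv is the vector part of f on Omega. *)
Definition vector_part Omega f (fv : H -> H) : Prop :=
  exists f0 f1 f2 f3 : H -> H,
    [/\ slice_preserving Omega f0, slice_preserving Omega f1,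
        slice_preserving Omega f2, slice_preserving Omega f3 &
        forall q, Omega q ->
          f q = f0 q + f1 q * quatI + f2 q * quatJ + f3 q * quatK /\
          fv q = f q - f0 q].

Definition Delta (q0 q : H) : H :=
  q ^+ 2 - (2 * qre q0) *: q + (`|q0| ^+ 2)%:A.

(* Delta is slice preserving: its *-powers and its *-product with ft are
   pointwise. *)
Definition Delta_factor Omega f (q0 : H) (m : nat) (ft : H -> H) : Prop :=
  slice_regular Omega ft /\
  forall q, Omega q -> f q = Delta q0 q ^+ m * ft q.

Definition nonreal_isolated_zero Omega f (q0 : H) : Prop :=
  [/\ symmetrization_neq0 Omega f, Omega q0, ~ realq q0 &
      exists m ft,
        [/\ Delta_factor Omega f q0 m ft,
            forall m' ft', Delta_factor Omega f q0 m' ft' -> (m' <= m)%N &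
            ft q0 = 0]].

(* g is the (pointwise) sum on Omega of the series exp_*(f). *)
Definition is_star_exp Omega f g : Prop :=
  forall q, Omega q ->
    series (fun n : nat => (n`!%:R : R)^-1 *: star_pow f n q) @ \oo --> g q.

End SliceRegular.

(* Main.v *)
(** On a circular domain a slice regular function is the same as a holomorphic
    map [z |-> (c0 z, c z)] into the biquaternions [C * C ^ 3], symmetric under
    conjugation, and the star-product is the pointwise biquaternion product.  If
    [c z = T v] with [v . v = 1], then [v] generates a copy of [C * C] in which
    the exponential is that of the coordinates [c0 + i T] and [c0 - i T]; so a
    logarithm needs a holomorphic direction [v] for [c] and logarithms of
    [c0 + i T] and [c0 - i T], whose product [c0^2 + c . c] vanishes nowhere
    since [g] has no zero.  At a non-real point [c] can be divided by a power of
    the characteristic polynomial of the sphere so that the quotient is not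
    isotropic: an isotropic quotient would vanish somewhere on the sphere, at a
    non-real isolated zero of [g_v].  At a real point reality of [c] plays the
    same role.  Hence [v] exists locally, is unique up to sign, and by monodromy
    exists globally, as do the logarithms.  If [c . c] vanishes identically,
    [(log c0, c / c0)] is a logarithm.  Symmetry under conjugation is arranged
    at a real point of a slice domain, and by reflection on a product domain. *)

From HB Require Import structures.
From mathcomp Require Import all_boot all_order all_algebra.
From mathcomp Require Import ring lra.
From mathcomp Require Import all_classical all_reals all_analysis.
Require Import Defs.
Set Implicit Arguments.
Unset Strict Implicit.
Unset Printing Implicit Defensive.
Import Order.TTheory GRing.Theory Num.Theory.
Import numFieldNormedType.Exports.
Local Open Scope classical_set_scope.
Local Open Scope ring_scope.

(** The naive direction [c / sqrt (c . c)] may branch at the zeros of [c . c]. The direction is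
    therefore described by two closed conditions, [v . v = 1] and parallelism to [c], which survive
    passage to the limit at such a zero. It exists there as soon as [c] is a power of [w - z] times
    a vector that is not isotropic at [z]. The hypothesis on zeros enters because a biquaternion of
    norm zero evaluates to zero at some imaginary unit: an isotropic quotient produces a point of
    the sphere where it vanishes.

    Logarithms and directions are continued by one monodromy theorem, stated for germs of sections
    rather than for a covering map, so that no total space has to be built. The function theory
    needed for directions comes down to one local fact: near [z] a holomorphic function either
    vanishes or equals [(w - z) ^ m * U w] with [U z != 0]. It yields isolated zeros, the identity
    principle and the bound on the powers that can be divided out. *)

(** * The complex plane as a field *)

(* The norm inherited from [R * R] is the maximum norm, so it is only
   submultiplicative up to a factor 2; [nsq] is the squared Euclidean modulus. *)
Definition cplx (R : realType) : Type := (R * R)%type.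

Section CplxAlgebra.
Context {R : realType}.
Local Notation C := (cplx R).

HB.instance Definition _ := NormedModule.copy C (R * R)%type.

Implicit Types (z w : C).
Definition cmul z w : C := (z.1 * w.1 - z.2 * w.2, z.1 * w.2 + z.2 * w.1).
Definition nsq z : R := z.1 ^+ 2 + z.2 ^+ 2.
Definition cinv z : C := (z.1 / nsq z, - z.2 / nsq z).
Definition cone : C := (1, 0).

Lemma cplxP z w : z.1 = w.1 -> z.2 = w.2 -> z = w.
Proof. by case: z w => [a b] [c d] /= -> ->. Qed.

Fact cmulA : associative cmul.
Proof. by move=> x y z; apply: cplxP => /=; ring. Qed.
Fact cmulC : commutative cmul.
Proof. by move=> x y; apply: cplxP => /=; ring. Qed.
Fact cmul1z : left_id cone cmul.
Proof. by move=> x; apply: cplxP => /=; ring. Qed.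
Fact cmulDl : left_distributive cmul +%R.
Proof. by move=> x y z; apply: cplxP => /=; ring. Qed.
Fact cone_neq0 : cone != 0.
Proof. by apply/eqP => /(congr1 fst)/eqP; rewrite /= oner_eq0. Qed.

HB.instance Definition _ := GRing.Zmodule_isComNzRing.Build C
  cmulA cmulC cmul1z cmulDl cone_neq0.

Lemma nsq_eq0 z : (nsq z == 0) = (z == 0).
Proof.
apply/eqP/eqP => [|->]; last by rewrite /nsq /= expr0n /= addr0.
by rewrite /nsq => h; apply: cplxP => /=; nra.
Qed.

Fact cmulVz z : z != 0 -> cmul (cinv z) z = cone.
Proof.
rewrite -nsq_eq0 => z0; apply: cplxP => /=; rewrite /nsq; field; exact: z0.
Qed.
Fact cinv0 : cinv 0 = 0.
Proof. by apply: cplxP; rewrite /= ?oppr0 mul0r. Qed.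
HB.instance Definition _ := GRing.ComNzRing_isField.Build C cmulVz cinv0.

Lemma cmulE z w : z * w = (z.1 * w.1 - z.2 * w.2, z.1 * w.2 + z.2 * w.1) :> C.
Proof. by []. Qed.
Lemma cinvE z : z^-1 = (z.1 / nsq z, - z.2 / nsq z) :> C.
Proof. by []. Qed.
Lemma cscaleE (a : R) z : a *: z = (a * z.1, a * z.2) :> C.
Proof. by []. Qed.

Lemma nsqM z w : nsq (z * w) = nsq z * nsq w.
Proof. by rewrite /nsq cmulE /=; ring. Qed.
Lemma nsq_ge0 z : 0 <= nsq z.
Proof. by rewrite addr_ge0 ?sqr_ge0. Qed.

Definition conjC z : C := (z.1, - z.2).
Definition ofR (a : R) : C := (a, 0).
Definition iC : C := (0, 1).

Lemma conjCK : involutive conjC.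
Proof. by move=> z; apply: cplxP; rewrite //= opprK. Qed.
Lemma conjCD z w : conjC (z + w) = conjC z + conjC w.
Proof. by apply: cplxP => /=; ring. Qed.
Lemma conjCN z : conjC (- z) = - conjC z.
Proof. by apply: cplxP => /=; ring. Qed.
Lemma conjCM z w : conjC (z * w) = conjC z * conjC w.
Proof. by rewrite !cmulE; apply: cplxP => /=; ring. Qed.
Lemma conjCX z n : conjC (z ^+ n) = conjC z ^+ n.
Proof.
elim: n => [|n IH]; first by rewrite !expr0; apply: cplxP; rewrite //= oppr0.
by rewrite !exprS conjCM IH.
Qed.
Lemma conjC0 : conjC 0 = 0.
Proof. by apply: cplxP; rewrite /= ?oppr0. Qed.
Lemma conjC1 : conjC 1 = 1.
Proof. by apply: cplxP; rewrite /= ?oppr0. Qed.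
Lemma conjC_iC : conjC iC = - iC.
Proof. by apply: cplxP; rewrite //= oppr0. Qed.
Lemma iC_sqr : iC * iC = -1.
Proof. by rewrite cmulE; apply: cplxP => /=; ring. Qed.
Lemma ofRD a b : ofR (a + b) = ofR a + ofR b.
Proof. by apply: cplxP => /=; ring. Qed.
Lemma ofRM a b : ofR (a * b) = ofR a * ofR b.
Proof. by rewrite cmulE; apply: cplxP => /=; ring. Qed.
Lemma scale_ofR a z : a *: z = ofR a * z.
Proof. by rewrite cmulE cscaleE; apply: cplxP => /=; ring. Qed.
Lemma ofR_eq0 a : (ofR a == 0) = (a == 0).
Proof. by apply/eqP/eqP => [/(congr1 fst)//|->]. Qed.

Lemma fst_normle z : `|z.1| <= `|z|.
Proof. by rewrite prod_normE /= le_max lexx. Qed.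
Lemma snd_normle z : `|z.2| <= `|z|.
Proof. by rewrite prod_normE /= le_max lexx orbT. Qed.
Lemma cnorm_le z (e : R) : `|z.1| <= e -> `|z.2| <= e -> `|z| <= e.
Proof. by move=> h1 h2; rewrite prod_normE /= ge_max h1 h2. Qed.
Lemma cnormM z w : `|z * w| <= 2 * (`|z| * `|w|).
Proof.
have h1 := fst_normle z; have h2 := snd_normle z.
have h3 := fst_normle w; have h4 := snd_normle w.
have k (a b c d : R) : `|a| <= `|z| -> `|b| <= `|w| -> `|c| <= `|z| ->
   `|d| <= `|w| -> `|a * b + c * d| <= 2 * (`|z| * `|w|).
  move=> *; apply: le_trans (ler_normD _ _) _; rewrite !normrM.
  by rewrite mulr_natl mulr2n lerD // ler_pM.
rewrite cmulE; apply: cnorm_le => /=; last exact: k.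
by rewrite -mulNr; apply: k; rewrite ?normrN.
Qed.
Lemma nsq_norm z : `|z| ^+ 2 <= nsq z.
Proof.
rewrite prod_normE /= /nsq; case: (leP `|z.1| `|z.2|) => _;
 by rewrite real_normK ?num_real // ?lerDl ?lerDr sqr_ge0.
Qed.
End CplxAlgebra.
Arguments iC {R}.

Section CplxTopology.
Context {R : realType}.
Local Notation C := (cplx R).

Lemma cvg_cplx T (F : set_system T) {FF : Filter F} (f : T -> C) (l : C) :
  (fst \o f) @ F --> l.1 -> (snd \o f) @ F --> l.2 -> f @ F --> l.
Proof.
move=> h1 h2; suff <- : (fun x => ((f x).1, (f x).2)) = f.
  by case: l h1 h2 => l1 l2; exact: cvg_pair.
by apply/funext => x; case: (f x).
Qed.

Lemma cvg_re T (F : set_system T) {FF : Filter F} (f : T -> C) (l : C) :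
  f @ F --> l -> (fst \o f) @ F --> l.1.
Proof. by move=> h; apply: cvg_comp h _; exact: cvg_fst. Qed.
Lemma cvg_im T (F : set_system T) {FF : Filter F} (f : T -> C) (l : C) :
  f @ F --> l -> (snd \o f) @ F --> l.2.
Proof. by move=> h; apply: cvg_comp h _; exact: cvg_snd. Qed.

Lemma ccvgM T (F : set_system T) {FF : Filter F} (f g : T -> C) (k l : C) :
  f @ F --> k -> g @ F --> l -> (f x * g x) @[x --> F] --> k * l.
Proof.
move=> h1 h2; have a1 := @cvg_re _ _ FF _ _ h1; have a2 := @cvg_im _ _ FF _ _ h1.
have b1 := @cvg_re _ _ FF _ _ h2; have b2 := @cvg_im _ _ FF _ _ h2.
apply: cvg_cplx => /=.
  exact: cvgB (cvgM a1 b1) (cvgM a2 b2).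
exact: cvgD (cvgM a1 b2) (cvgM a2 b1).
Qed.

Lemma ccvgV T (F : set_system T) {FF : Filter F} (f : T -> C) (k : C) :
  k != 0 -> f @ F --> k -> (f x)^-1 @[x --> F] --> k^-1.
Proof.
move=> k0 h1; have a1 := @cvg_re _ _ FF _ _ h1; have a2 := @cvg_im _ _ FF _ _ h1.
have n0 : nsq k != 0 by rewrite nsq_eq0.
have an : (nsq (f x)) @[x --> F] --> nsq k.
  exact: cvgD (cvgM a1 a1) (cvgM a2 a2).
apply: cvg_cplx => /=; apply: cvgM => //.
- exact: cvgV.
- exact: cvgN.
- exact: cvgV.
Qed.

Lemma ccvgX T (F : set_system T) {FF : Filter F} (f : T -> C) (k : C) n :
  f @ F --> k -> (f x ^+ n) @[x --> F] --> k ^+ n.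
Proof.
move=> h; elim: n => [|n IH]; first by rewrite expr0; apply: cvg_cst.
rewrite exprS; under eq_fun do rewrite exprS.
exact: ccvgM.
Qed.

Lemma conjC_continuous : continuous (@conjC R).
Proof.
move=> z; apply: cvg_cplx => /=; first exact: cvg_fst.
have h : snd @ nbhs z --> z.2 by exact: cvg_snd.
by have := cvgN h; exact.
Qed.

Lemma nsq_cont (z : C) : {for z, continuous (@nsq R)}.
Proof.
have h : {for z, continuous (@fst R R)} by exact: cvg_fst.
have k : {for z, continuous (@snd R R)} by exact: cvg_snd.
by rewrite /nsq; apply: cvgD; apply: cvgM.
Qed.

End CplxTopology.

Lemma cont_cvg T (U V : topologicalType) (X : set_system T) (f : T -> U)
    (g : U -> V) l : {for l, continuous g} -> f @ X --> l ->
  g (f x) @[x --> X] --> g l.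
Proof. by move=> h k; exact: (cvg_comp f g k h). Qed.

Lemma cvg_pair_pt T (U V : topologicalType) (X : set_system T) {FX : Filter X}
    (f : T -> U) (g : T -> V) (a : U) (b : V) :
  f @ X --> a -> g @ X --> b -> (f x, g x) @[x --> X] --> (a, b).
Proof. by move=> h k; exact: cvg_pair. Qed.

(** * Strict complex differentiability and its calculus *)

Section StrictDiff.
Context {R : realType}.
Local Notation C := (cplx R).
Implicit Types (F G : C -> C) (z w d e : C).

(* Strict differentiability: the difference quotient extends continuously to the
   diagonal.  Unlike Frechet differentiability it needs no norm estimates, and it
   makes the derivative of a holomorphic function continuous for free. *)
Definition sdiff F z d : Prop :=
  exists2 Q : C * C -> C, Q @ nbhs (z, z) --> d &
    \forall p \near (z, z), F p.2 - F p.1 = (p.2 - p.1) * Q p.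

Lemma near_fst (P : C -> Prop) z :
  (\forall w \near z, P w) -> \forall p \near (z, z), P p.1.
Proof. by move=> h; apply: (@cvg_fst _ _ (nbhs z) (nbhs z)) h. Qed.
Lemma near_snd (P : C -> Prop) z :
  (\forall w \near z, P w) -> \forall p \near (z, z), P p.2.
Proof. by move=> h; apply: (@cvg_snd _ _ (nbhs z) (nbhs z)) h. Qed.

Lemma near_pairl (P : C * C -> Prop) z :
  (\forall p \near (z, z), P p) -> \forall w \near z, P (z, w).
Proof.
move=> h; have : (fun w => (z, w)) @ nbhs z --> (z, z).
  exact: (cvg_pair (cvg_cst z) cvg_id).
by apply.
Qed.

Lemma sdiff_eq F G z d : (\forall w \near z, F w = G w) -> sdiff F z d ->
  sdiff G z d.
Proof.
move=> h [Q Qd E]; exists Q => //.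
have h1 := near_fst h; have h2 := near_snd h.
by near=> p; rewrite -(near h1 p) // -(near h2 p) //; near: p.
Unshelve. all: by end_near. Qed.

Lemma sdiff_cst c z : sdiff (fun=> c) z 0.
Proof.
by exists (fun=> 0); [exact: cvg_cst|near=> p; rewrite subrr mulr0].
Unshelve. all: by end_near. Qed.

Lemma sdiff_id z : sdiff id z 1.
Proof.
by exists (fun=> 1); [exact: cvg_cst|near=> p; rewrite mulr1].
Unshelve. all: by end_near. Qed.

Lemma sdiff_cont F z d : sdiff F z d -> {for z, continuous F}.
Proof.
move=> [Q Qd E]; rewrite /prop_for.
have : (F z + (w - z) * Q (z, w)) @[w --> z] --> F z + (z - z) * d.
  apply: cvgD; first exact: cvg_cst.
  apply: ccvgM; first by apply: cvgB => //; exact: cvg_cst.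
  have h : (fun w => (z, w)) @ nbhs z --> (z, z).
    exact: (cvg_pair (cvg_cst z) cvg_id).
  exact: (cvg_comp _ Q h Qd).
rewrite subrr mul0r addr0; apply: cvg_trans; apply: near_eq_cvg.
have E' := near_pairl E.
by near=> w; rewrite -(near E' w) //= addrC subrK.
Unshelve. all: by end_near. Qed.

Lemma cont_pair1 F z : {for z, continuous F} -> F p.1 @[p --> (z, z)] --> F z.
Proof. by move=> h; apply: (cont_cvg h); exact: cvg_fst. Qed.
Lemma cont_pair2 F z : {for z, continuous F} -> F p.2 @[p --> (z, z)] --> F z.
Proof. by move=> h; apply: (cont_cvg h); exact: cvg_snd. Qed.

Lemma sdiffD F G z d e : sdiff F z d -> sdiff G z e ->
  sdiff (fun w => F w + G w) z (d + e).
Proof.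
move=> [Q Qd E] [P Pe E']; exists (fun p => Q p + P p); first exact: cvgD.
near=> p; rewrite mulrDr -(near E p) // -(near E' p) //; ring.
Unshelve. all: by end_near. Qed.

Lemma sdiffN F z d : sdiff F z d -> sdiff (fun w => - F w) z (- d).
Proof.
move=> [Q Qd E]; exists (fun p => - Q p); first exact: cvgN.
near=> p; rewrite mulrN -(near E p) //; ring.
Unshelve. all: by end_near. Qed.

Lemma sdiffB F G z d e : sdiff F z d -> sdiff G z e ->
  sdiff (fun w => F w - G w) z (d - e).
Proof. by move=> h1 h2; apply: sdiffD => //; apply: sdiffN. Qed.

Lemma sdiffM F G z d e : sdiff F z d -> sdiff G z e ->
  sdiff (fun w => F w * G w) z (d * G z + F z * e).
Proof.
move=> hF hG; have cF := sdiff_cont hF; have cG := sdiff_cont hG.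
case: hF => [Q Qd E]; case: hG => [P Pe E'].
exists (fun p => Q p * G p.2 + F p.1 * P p).
  by apply: cvgD; apply: ccvgM => //; [exact: cont_pair2|exact: cont_pair1].
near=> p.
transitivity ((F p.2 - F p.1) * G p.2 + F p.1 * (G p.2 - G p.1)); first by ring.
by rewrite (near E p) // (near E' p) //; ring.
Unshelve. all: by end_near. Qed.

Lemma sdiffV F z d : F z != 0 -> sdiff F z d ->
  sdiff (fun w => (F w)^-1) z (- d / F z ^+ 2).
Proof.
move=> F0 hF; have cF := sdiff_cont hF.
have n0 : \forall w \near z, F w != 0 by apply: (cvgr_neq0 _ cF).
have n1 := near_fst n0; have n2 := near_snd n0.
case: hF => [Q Qd E].
exists (fun p => - Q p * (F p.1 * F p.2)^-1).
  rewrite expr2; apply: ccvgM; first exact: cvgN.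
  apply: ccvgV; first by rewrite mulf_neq0.
  by apply: ccvgM; [exact: cont_pair1|exact: cont_pair2].
near=> p.
have f1 : F p.1 != 0 by near: p.
have f2 : F p.2 != 0 by near: p.
transitivity (- (F p.2 - F p.1) * (F p.1 * F p.2)^-1).
  by field; rewrite f1 f2.
by rewrite (near E p) //; ring.
Unshelve. all: by end_near. Qed.

Lemma sdiffX F z d n : sdiff F z d -> exists e, sdiff (fun w => F w ^+ n) z e.
Proof.
move=> h; elim: n => [|n [e IH]]; first by exists 0; exact: sdiff_cst.
eexists; under eq_fun do rewrite exprS; exact: (sdiffM h IH).
Qed.

Lemma sdiff_comp F G z d e : sdiff F z d -> sdiff G (F z) e ->
  sdiff (G \o F) z (e * d).
Proof.
move=> hF [P Pe E']; have cF := sdiff_cont hF; case: hF => [Q Qd E].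
have h : (fun p => (F p.1, F p.2)) @ (z, z) --> (F z, F z).
  by apply: cvg_pair_pt; [exact: cont_pair1|exact: cont_pair2].
exists (fun p => P (F p.1, F p.2) * Q p).
  by apply: ccvgM => //; exact: (cvg_comp _ P h Pe).
have E2 : \forall p \near (z, z),
    G (F p.2) - G (F p.1) = (F p.2 - F p.1) * P (F p.1, F p.2) := h _ E'.
near=> p.
have -> /= : (G \o F) p.2 - (G \o F) p.1 = (F p.2 - F p.1) * P (F p.1, F p.2).
  by near: p.
by rewrite (near E p) //; ring.
Unshelve. all: by end_near. Qed.

Lemma sdiff_conj F z d : sdiff F z d ->
  sdiff (@conjC R \o F \o @conjC R) (conjC z) (conjC d).
Proof.
move=> [Q Qd E].
have h : (fun p => (conjC p.1, conjC p.2)) @ (conjC z, conjC z) --> (z, z).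
  have k : conjC x @[x --> conjC z] --> z.
    by rewrite -[X in _ --> X]conjCK; exact: conjC_continuous.
  apply: cvg_pair_pt; first exact: (cvg_comp fst (@conjC R) cvg_fst k).
  exact: (cvg_comp snd (@conjC R) cvg_snd k).
exists (fun p => conjC (Q (conjC p.1, conjC p.2))).
  have h2 := cvg_comp _ Q h Qd.
  exact: (cont_cvg (@conjC_continuous R d) h2).
have E2 : \forall p \near (conjC z, conjC z), F (conjC p.2) - F (conjC p.1) =
    (conjC p.2 - conjC p.1) * Q (conjC p.1, conjC p.2) := h _ E.
near=> p; rewrite /= -conjCN -conjCD.
have -> : F (conjC p.2) - F (conjC p.1) = (conjC p.2 - conjC p.1) *
   Q (conjC p.1, conjC p.2) by near: p.
by rewrite conjCM -conjCN -conjCD !conjCK.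
Unshelve. all: by end_near. Qed.

Lemma cvg_scale_add (T : normedModType R) (t v : T) :
  (fun h : R => h *: v + t) @ 0^' --> t.
Proof.
have : (fun h : R => h *: v + t) @ 0^' --> (0 : R) *: v + t.
  apply: cvgD; last exact: cvg_cst.
  by apply: cvgZr_tmp; exact: nbhs_dnbhs.
by rewrite scale0r add0r.
Qed.

(** Chain rule with a merely directionally differentiable inner function. The increment of [F]
    factors through [Q (g t, g (h *: v + t))], so there is no division by the increment of [g],
    which may vanish. *)
Lemma sdiff_dir_cvg F (T : normedModType R) (g : T -> C) (t v : T) (e d : C) :
  is_derive t v g e -> {for t, continuous g} -> sdiff F (g t) d ->
  (fun h : R => h^-1 *: ((F \o g) (h *: v + t) - (F \o g) t)) @ 0^' --> e * d.
Proof.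
move=> [dg eg] cg [Q Qd E].
have k1 := @cvg_scale_add T t v.
have k2 : (fun h : R => (g t, g (h *: v + t))) @ 0^' --> (g t, g t).
  by apply: cvg_pair_pt; [exact: cvg_cst|exact: (cont_cvg cg k1)].
have k3 := cvg_comp _ Q k2 Qd.
have k4 : (fun h : R => h^-1 *: (g (h *: v + t) - g t)) @ 0^' --> e.
  by rewrite -eg; exact: dg.
apply: cvg_trans (ccvgM k4 k3); apply: near_eq_cvg.
have E2 : \forall h \near 0^', F (g (h *: v + t)) - F (g t) =
    (g (h *: v + t) - g t) * Q (g t, g (h *: v + t)) := k2 _ E.
near=> h => /=.
have -> : F (g (h *: v + t)) - F (g t) = (g (h *: v + t) - g t) *
   Q (g t, g (h *: v + t)) by near: h.
by rewrite !scale_ofR mulrA.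
Unshelve. all: by end_near. Qed.

Lemma sdiff_dir F (T : normedModType R) (g : T -> C) (t v : T) (e d : C) :
  is_derive t v g e -> {for t, continuous g} -> sdiff F (g t) d ->
  is_derive t v (F \o g) (e * d).
Proof.
move=> dg cg sF; have key := sdiff_dir_cvg dg cg sF.
by split; [apply/cvg_ex; exists (e * d)|exact: cvg_lim].
Qed.

End StrictDiff.

(** * Continuous partial derivatives and Cauchy-Riemann give strict differentiability *)

Section C1StrictDiff.
Context {R : realType}.
Local Notation C := (cplx R).

(** The mean value theorem for [f], with the fixed slope [l] subtracted. The endpoints come in
    either order because they are later two arbitrary points near a centre. *)
Lemma mean_value_strict (f df : R -> R) (x1 x2 l e : R) :
  (forall x, Num.min x1 x2 <= x <= Num.max x1 x2 ->
     is_derive x 1 f (df x) /\ `|df x - l| <= e) ->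
  `|f x2 - f x1 - l * (x2 - x1)| <= e * `|x2 - x1|.
Proof.
wlog x12 : x1 x2 / x1 <= x2.
  move=> h; case/orP: (le_total x1 x2) => [x12|x21] H; first exact: h.
  rewrite -normrN [`|x2 - x1|]distrC.
  have -> : - (f x2 - f x1 - l * (x2 - x1)) = f x1 - f x2 - l * (x1 - x2).
    by ring.
  by apply: (h _ _ x21) => x; rewrite minC maxC; exact: H.
rewrite (min_idPl x12) (max_idPr x12) => H.
have [c cI ->] : exists2 c, c \in `[x1, x2] & f x2 - f x1 = df c * (x2 - x1).
  apply: MVT_segment => //.
    move=> x; rewrite in_itv /= => /andP[a b].
    by have [] := H x _; rewrite ?(ltW a) ?(ltW b).
  apply: derivable_within_continuous => x; rewrite in_itv /= => a.
  by have [[]] := H x a.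
rewrite -mulrBl normrM ler_wpM2r //.
by have [] := H c _; rewrite in_itv /= in cI.
Qed.

(** The increment is split at the corner [(x1, y2)] into a horizontal and a vertical one. Balls for
    the maximum norm are squares, so both legs stay where the derivatives are controlled. *)
Lemma C1_strict_real (u p q : C -> R) (z : C) (e : R) : 0 < e ->
  (\forall w \near z, is_derive (w : C).1 (1 : R) (fun x => u (x, w.2)) (p w) /\
                      is_derive (w : C).2 (1 : R) (fun y => u (w.1, y)) (q w)) ->
  {for z, continuous p} -> {for z, continuous q} ->
  \forall P \near (z, z),
    `|u P.2 - u P.1 - (p z * (P.2.1 - P.1.1) + q z * (P.2.2 - P.1.2))|
      <= e * `|P.2 - P.1|.
Proof.
move=> e0 hd cp cq.
have hp : \forall w \near z, `|p z - p w| < e / 2.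
  by apply: (cvgr_dist_lt _ _ cp); rewrite divr_gt0.
have hq : \forall w \near z, `|q z - q w| < e / 2.
  by apply: (cvgr_dist_lt _ _ cq); rewrite divr_gt0.
have /nbhs_ballP[d /= d0 H] : \forall w \near z,
    [/\ is_derive (w : C).1 (1 : R) (fun x => u (x, w.2)) (p w),
        is_derive (w : C).2 (1 : R) (fun y => u (w.1, y)) (q w),
        `|p w - p z| <= e / 2 & `|q w - q z| <= e / 2].
  near=> w; have [h1 h2] : is_derive (w : C).1 (1 : R) (fun x => u (x, w.2)) (p w) /\
    is_derive (w : C).2 (1 : R) (fun y => u (w.1, y)) (q w) by near: w.
  by split => //; rewrite distrC ltW //; near: w.
have nb : \forall w \near z, ball z d w by exact: nbhsx_ballx.
have key : forall P : C * C, ball z d P.1 -> ball z d P.2 ->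
    `|u P.2 - u P.1 - (p z * (P.2.1 - P.1.1) + q z * (P.2.2 - P.1.2))|
      <= e * `|P.2 - P.1|; last first.
  have n1 := near_fst nb; have n2 := near_snd nb.
  by near=> P; apply: key; near: P.
move=> [[x1 y1] [x2 y2]] /= [a1 c1] [a2 c2].
have itv (m a b x : R) : ball m d a -> ball m d b ->
    Num.min a b <= x <= Num.max a b -> ball m d x.
  rewrite /ball /= !ltr_distlC => /andP[? ?] /andP[? ?] /andP[].
  rewrite ge_min le_max => /orP[?|?] /orP[?|?]; apply/andP; split; lra.
have k1 : `|u (x2, y2) - u (x1, y2) - p z * (x2 - x1)| <= e / 2 * `|x2 - x1|.
  apply: (@mean_value_strict (fun x => u (x, y2)) (fun x => p (x, y2))) => x xI.
  have := H (x, y2); case; first by split => //=; apply: itv xI.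
  by [].
have k2 : `|u (x1, y2) - u (x1, y1) - q z * (y2 - y1)| <= e / 2 * `|y2 - y1|.
  apply: (@mean_value_strict (fun y => u (x1, y)) (fun y => q (x1, y))) => y yI.
  have := H (x1, y); case; first by split => //=; apply: itv yI.
  by [].
set N := `|_ - _ : C|.
have l1 : `|x2 - x1| <= N by exact: (@fst_normle R ((x2, y2) - (x1, y1))).
have l2 : `|y2 - y1| <= N by exact: (@snd_normle R ((x2, y2) - (x1, y1))).
have -> : u (x2, y2) - u (x1, y1) - (p z * (x2 - x1) + q z * (y2 - y1)) =
  (u (x2, y2) - u (x1, y2) - p z * (x2 - x1)) +
  (u (x1, y2) - u (x1, y1) - q z * (y2 - y1)) by ring.
apply: le_trans (ler_normD _ _) _.
apply: le_trans (lerD k1 k2) _.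
have : e / 2 * `|x2 - x1| + e / 2 * `|y2 - y1| <= e / 2 * N + e / 2 * N.
  by rewrite lerD // ler_wpM2l // divr_ge0 // ltW.
lra.
Unshelve. all: by end_near. Qed.

(** The quotient [Q] is the difference quotient, completed by the value [d] on the diagonal. *)
Lemma sdiff_eps (F : C -> C) z d :
  (forall e, 0 < e -> \forall P \near (z, z),
     `|F P.2 - F P.1 - d * (P.2 - P.1)| <= e * `|P.2 - P.1|) -> sdiff F z d.
Proof.
move=> H; exists (fun P => if P.1 == P.2 then d else (F P.2 - F P.1) / (P.2 - P.1)).
  apply/cvgrPdist_le => e e0.
  (* Half of [e] absorbs the factor 2 of [cnormM]. *)
  have e20 : 0 < e / 2 by rewrite divr_gt0.
  near=> P; case: eqP => [_|/eqP ne]; first by rewrite subrr normr0 ltW.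
  have n0 : P.2 - P.1 != 0 by rewrite subr_eq0 eq_sym.
  have -> : d - (F P.2 - F P.1) / (P.2 - P.1) =
     - ((F P.2 - F P.1 - d * (P.2 - P.1)) * (P.2 - P.1)^-1) by field.
  rewrite normrN; apply: le_trans (cnormM _ _) _.
  have h : `|F P.2 - F P.1 - d * (P.2 - P.1)| <= e / 2 * `|P.2 - P.1|.
    by near: P; exact: H.
  have g0 : 0 < `|P.2 - P.1| by rewrite normr_gt0.
  have hV : `|(P.2 - P.1)^-1| <= `|P.2 - P.1|^-1.
    have nsq0 : 0 < nsq (P.2 - P.1).
      by apply: lt_le_trans (nsq_norm _); rewrite exprn_gt0.
    have -> : (P.2 - P.1)^-1 = (nsq (P.2 - P.1))^-1 *: conjC (P.2 - P.1).
      by rewrite cinvE cscaleE; apply: cplxP; rewrite /= mulrC.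
    rewrite normrZ gtr0_norm ?invr_gt0 //.
    have -> : `|conjC (P.2 - P.1)| = `|P.2 - P.1|.
      by rewrite !prod_normE /= normrN.
    rewrite mulrC ler_pdivrMr // mulrC ler_pdivlMr //.
    by rewrite -expr2; exact: nsq_norm.
  have := ler_pM (normr_ge0 _) (normr_ge0 _) h hV.
  by rewrite mulfK ?gt_eqF //; lra.
near=> P; case: eqP => [->|/eqP ne]; first by rewrite !subrr mul0r.
have n0 : P.2 - P.1 != 0 by rewrite subr_eq0 eq_sym.
by field.
Unshelve. all: by end_near. Qed.

(* [a] and [b] are the common values of the partial derivatives prescribed by
   the Cauchy-Riemann equations. *)
Lemma C1_sdiff (F : C -> C) (a b : C -> R) z :
  (\forall w \near z,
    [/\ is_derive (w : C).1 (1 : R) (fun x => (F (x, w.2)).1) (a w),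
        is_derive (w : C).2 (1 : R) (fun y => (F (w.1, y)).1) (- b w),
        is_derive (w : C).1 (1 : R) (fun x => (F (x, w.2)).2) (b w) &
        is_derive (w : C).2 (1 : R) (fun y => (F (w.1, y)).2) (a w)]) ->
  {for z, continuous a} -> {for z, continuous b} -> sdiff F z (a z, b z).
Proof.
move=> H ca cb; apply: sdiff_eps => e e0.
have cnb : {for z, continuous (fun w => - b w)} by exact: cvgN.
have k1 := @C1_strict_real (fun w => (F w).1) a (fun w => - b w) z e e0.
have k2 := @C1_strict_real (fun w => (F w).2) b a z e e0.
have {}k1 := k1 _ ca cnb; have {}k2 := k2 _ cb ca.
near=> P; apply: cnorm_le; rewrite cmulE /=.
- have -> : (F P.2).1 - (F P.1).1 -
     (a z * (P.2.1 - P.1.1) - b z * (P.2.2 - P.1.2)) = (F P.2).1 - (F P.1).1 -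
     (a z * (P.2.1 - P.1.1) + - b z * (P.2.2 - P.1.2)) by ring.
  by near: P; apply: k1; apply: filterS H => w [].
- have -> : (F P.2).2 - (F P.1).2 -
     (a z * (P.2.2 - P.1.2) + b z * (P.2.1 - P.1.1)) = (F P.2).2 - (F P.1).2 -
     (b z * (P.2.1 - P.1.1) + a z * (P.2.2 - P.1.2)) by ring.
  by near: P; apply: k2; apply: filterS H => w [].
Unshelve. all: by end_near. Qed.

End C1StrictDiff.

(** * Holomorphic functions *)

Section Holomorphic.
Context {R : realType}.
Local Notation C := (cplx R).
Implicit Types (F G : C -> C) (z w d e : C).

(** Differentiability is asked at all nearby points, so that holomorphy at [z] depends on the germ
    and is an open condition on [z]. *)
Definition hol F z : Prop := \forall w \near z, exists d, sdiff F w d.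
Definition cderiv F z : C := 'D_(1 : C) F z.

Lemma sdiff_derive F z d v : sdiff F z d -> is_derive z v F (v * d).
Proof. by move=> h; exact: (@sdiff_dir R F C id z v v d). Qed.

Lemma sdiff_val F z d : sdiff F z d -> cderiv F z = d.
Proof. by move=> h; have [_] := sdiff_derive 1 h; rewrite mul1r. Qed.

Lemma hol_sdiff F z : hol F z -> sdiff F z (cderiv F z).
Proof. by move=> /nbhs_singleton [d h]; rewrite (sdiff_val h). Qed.

Lemma hol_near F z : hol F z -> \forall w \near z, hol F w.
Proof. by move=> h; exact: (near_join h). Qed.

Lemma hol_cont F z : hol F z -> {for z, continuous F}.
Proof. by move=> /hol_sdiff/sdiff_cont. Qed.

Lemma hol_eq F G z : (\forall w \near z, F w = G w) -> hol F z -> hol G z.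
Proof.
move=> /near_join h hF; rewrite /hol; near=> w.
have [d k] : exists d, sdiff F w d by near: w.
by exists d; apply: sdiff_eq k; near: w.
Unshelve. all: by end_near. Qed.

(** Near the diagonal [Q] stays close to the derivative at [z], while the derivative at [w] is the
    limit of [Q (w, w + h)] for real [h]. *)
Lemma cderiv_cont F z : hol F z -> {for z, continuous (cderiv F)}.
Proof.
move=> hF; have [Q Qd E] := hol_sdiff hF.
apply/cvgrPdist_le => e e0.
have hQ : \forall p \near (z, z), `|cderiv F z - Q p| <= e / 2.
  by have /cvgrPdist_le := Qd; apply; rewrite divr_gt0.
have : \forall p \near (z, z), F p.2 - F p.1 = (p.2 - p.1) * Q p /\
    `|cderiv F z - Q p| <= e / 2.
  by near=> p; split; near: p.
case=> -[A B] /= [nA nB] AB.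
have nA' := near_join nA; have nB' := near_join nB.
rewrite /=; near=> w.
have [d hd] : exists d, sdiff F w d by near: w.
rewrite (sdiff_val hd) leNgt; apply/negP => lt.
have k1 := @sdiff_dir_cvg R F C id w 1 1 d (is_derive_id _ _) cvg_id hd.
rewrite mul1r /= in k1.
have k2 := @cvg_scale_add R C w 1.
have Bw : \forall y \near w, B y by near: w.
have Aw : A w by near: w.
have k3 : \forall h \near (0 : R)^', B (h *: (1 : C) + w) := k2 _ Bw.
have k4 : \forall h \near (0 : R)^', `|d - h^-1 *: (F (h *: (1 : C) + w) - F w)| < e / 2.
  by apply: (cvgr_dist_lt _ _ k1); rewrite divr_gt0.
have k5 : \forall h \near (0 : R)^', h != 0 by exact: nbhs_dnbhs_neq.
near (0 : R)^' => h.
have h0 : h != 0 by near: h.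
have Bh : B (h *: (1 : C) + w) by near: h.
have [q1 q2] := AB (w, h *: (1 : C) + w) (conj Aw Bh).
have q3 : `|d - h^-1 *: (F (h *: (1 : C) + w) - F w)| < e / 2 by near: h.
move: q3; rewrite q1 /= addrK scale_ofR mulrA -scale_ofR scalerA mulVf //.
rewrite scale1r mul1r => q3.
have := ler_distD (Q (w, h *: (1 : C) + w)) (cderiv F z) d.
rewrite [`|Q _ - d|]distrC.
lra.
Unshelve. all: by end_near. Qed.

Lemma hol_cst c z : hol (fun=> c) z.
Proof. by near=> w; exists 0; exact: sdiff_cst.
Unshelve. all: by end_near. Qed.

Lemma hol_id z : hol id z.
Proof. by near=> w; exists 1; exact: sdiff_id.
Unshelve. all: by end_near. Qed.

Lemma holD F G z : hol F z -> hol G z -> hol (fun w => F w + G w) z.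
Proof.
move=> hF hG; rewrite /hol; near=> w.
have [d k] : exists d, sdiff F w d by near: w.
have [e l] : exists d, sdiff G w d by near: w.
by eexists; exact: sdiffD k l.
Unshelve. all: by end_near. Qed.

Lemma holN F z : hol F z -> hol (fun w => - F w) z.
Proof. by apply: filterS => w [d h]; eexists; exact: sdiffN h. Qed.

Lemma holB F G z : hol F z -> hol G z -> hol (fun w => F w - G w) z.
Proof. by move=> h k; apply: holD => //; exact: holN. Qed.

Lemma holM F G z : hol F z -> hol G z -> hol (fun w => F w * G w) z.
Proof.
move=> hF hG; rewrite /hol; near=> w.
have [d k] : exists d, sdiff F w d by near: w.
have [e l] : exists d, sdiff G w d by near: w.
by eexists; exact: sdiffM k l.
Unshelve. all: by end_near. Qed.

Lemma holX F n z : hol F z -> hol (fun w => F w ^+ n) z.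
Proof. by apply: filterS => w [d h]; exact: sdiffX h. Qed.

Lemma holV F z : F z != 0 -> hol F z -> hol (fun w => (F w)^-1) z.
Proof.
move=> F0 hF; have n0 : \forall w \near z, F w != 0.
  by apply: (cvgr_neq0 _ (hol_cont hF)).
rewrite /hol; near=> w.
have [d k] : exists d, sdiff F w d by near: w.
by eexists; apply: sdiffV k; near: w.
Unshelve. all: by end_near. Qed.

Lemma hol_comp F G z : hol F z -> hol G (F z) -> hol (G \o F) z.
Proof.
move=> hF hG; have k := hol_cont hF.
have hG' : \forall w \near z, exists d, sdiff G (F w) d := k _ hG.
rewrite /hol; near=> w.
have [d l] : exists d, sdiff F w d by near: w.
have [e m] : exists d, sdiff G (F w) d by near: w.
by eexists; exact: sdiff_comp l m.
Unshelve. all: by end_near. Qed.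

Lemma hol_conj F z : hol F z -> hol (@conjC R \o F \o @conjC R) (conjC z).
Proof.
move=> hF.
have k : conjC x @[x --> conjC z] --> z.
  by rewrite -[X in _ --> X]conjCK; exact: conjC_continuous.
have k2 : \forall w \near conjC z, exists d, sdiff F (conjC w) d := k _ hF.
apply: filterS k2 => w [d h]; exists (conjC d).
by rewrite -[w]conjCK; exact: sdiff_conj.
Qed.

End Holomorphic.

(** * The complex exponential and the principal logarithm *)

Section ExpLog.
Context {R : realType}.
Local Notation C := (cplx R).
Implicit Types (z w : C).

Definition cexp z : C := (expR z.1 * cos z.2, expR z.1 * sin z.2).

Lemma cexpD z w : cexp (z + w) = cexp z * cexp w.
Proof.
by rewrite cmulE /cexp /= expRD cosD sinD; apply: cplxP => /=; ring.
Qed.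
Lemma cexp0 : cexp 0 = 1.
Proof. by rewrite /cexp /= expR0 cos0 sin0 mulr0 mulr1. Qed.
Lemma cexp_neq0 z : cexp z != 0.
Proof.
have h : cexp z * cexp (- z) = 1 by rewrite -cexpD subrr cexp0.
by apply/eqP => k; move/eqP: h; rewrite k mul0r eq_sym oner_eq0.
Qed.
Lemma cexpN z : cexp (- z) = (cexp z)^-1.
Proof.
have n := cexp_neq0 z.
by apply: (mulfI n); rewrite -cexpD subrr cexp0 divff.
Qed.
Lemma cexp_conj z : cexp (conjC z) = conjC (cexp z).
Proof. by rewrite /cexp /conjC /= cosN sinN mulrN. Qed.

Lemma expR_cos_cont z : {for z, continuous (fun w : C => expR w.1 * cos w.2)}.
Proof.
apply: cvgM.
  by apply: (cont_cvg (@continuous_expR R z.1)); exact: cvg_fst.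
by apply: (cont_cvg (@continuous_cos R z.2)); exact: cvg_snd.
Qed.
Lemma expR_sin_cont z : {for z, continuous (fun w : C => expR w.1 * sin w.2)}.
Proof.
apply: cvgM.
  by apply: (cont_cvg (@continuous_expR R z.1)); exact: cvg_fst.
by apply: (cont_cvg (@continuous_sin R z.2)); exact: cvg_snd.
Qed.

Lemma sdiff_cexp z : sdiff cexp z (cexp z).
Proof.
apply: (@C1_sdiff R cexp (fun w => expR w.1 * cos w.2)
  (fun w => expR w.1 * sin w.2)); [|exact: expR_cos_cont|exact: expR_sin_cont].
near=> w; split => /=.
- by apply: is_derive_eq; rewrite scaler0 add0r mulrC.
- have := is_deriveZ (expR w.1) (is_derive_cos w.2).
  by rewrite -[_ *: - _]/(_ * - _) mulrN.
- by apply: is_derive_eq; rewrite scaler0 add0r mulrC.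
- exact: (is_deriveZ (expR w.1) (is_derive_sin w.2)).
Unshelve. all: by end_near. Qed.

Lemma hol_cexp z : hol cexp z.
Proof. by near=> w; exists (cexp w); exact: sdiff_cexp.
Unshelve. all: by end_near. Qed.

End ExpLog.

Lemma is_derive_ext (R : numFieldType) (V W : normedModType R) (f g : V -> W)
    (x v : V) (d d' : W) :
  is_derive x v f d -> (forall y, f y = g y) -> d = d' -> is_derive x v g d'.
Proof. by move=> h /funext <- <-. Qed.

Section ComplexLog.
Context {R : realType}.
Local Notation C := (cplx R).
Implicit Types (z w : C).

(** Used on the right half-plane only, where [atan (y / x)] is the argument. Values elsewhere are
    first brought there by a rotation or by dividing by a nearby value. *)
Definition clog z : C := (ln (nsq z) / 2, atan (z.2 / z.1)).

Lemma nsq_gt0 z : z != 0 -> 0 < nsq z.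
Proof. by move=> z0; rewrite lt_neqAle nsq_ge0 eq_sym nsq_eq0 z0. Qed.

Lemma re_gt0_neq0 z : 0 < z.1 -> z != 0.
Proof. by apply: contraTneq => ->; rewrite ltxx. Qed.

Lemma cexp_clog z : 0 < z.1 -> cexp (clog z) = z.
Proof.
move=> z0; have N0 := nsq_gt0 (re_gt0_neq0 z0).
have z10 : z.1 != 0 by rewrite gt_eqF.
set t := z.2 / z.1.
have ct : expR (ln (nsq z) / 2) * cos (atan t) = z.1.
  have p1 : 0 < expR (ln (nsq z) / 2) * cos (atan t).
    rewrite mulr_gt0 ?expR_gt0 // cos_atan invr_gt0 sqrtr_gt0.
    by rewrite ltr_wpDr ?sqr_ge0.
  apply/eqP; rewrite -(@eqrXn2 _ 2) // ?(ltW p1) ?(ltW z0) //; apply/eqP.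
  rewrite exprMn cos_atan exprVn sqr_sqrtr ?addr_ge0 ?sqr_ge0 //.
  have -> : expR (ln (nsq z) / 2) ^+ 2 = nsq z.
    rewrite -expRM_natl (_ : 2%:R * (ln (nsq z) / 2) = ln (nsq z)); last by field.
    by rewrite lnK.
  rewrite /nsq /t.
  have tn : 1 + (z.2 / z.1) ^+ 2 != 0.
    by rewrite gt_eqF // ltr_wpDr ?sqr_ge0.
  field; rewrite z10 /=.
  by rewrite gt_eqF // addrC; exact: N0.
have cn : cos (atan t) != 0.
  by apply/eqP => k; move: z10; rewrite -ct k mulr0 eqxx.
rewrite /cexp /clog /= -/t; apply: cplxP => //=.
have -> : sin (atan t) = t * cos (atan t).
  by rewrite -[LHS](divfK cn); congr (_ * _); exact: atanK.
by rewrite mulrCA mulrC ct /t mulrC divfK.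
Qed.

Lemma sdiff_clog z : 0 < z.1 -> exists d, sdiff clog z d.
Proof.
move=> z0; have cN := @nsq_cont R z.
have N0 : nsq z != 0 by rewrite nsq_eq0 re_gt0_neq0.
(* The expected derivative is [z^-1], given by its real and imaginary parts. *)
eexists; apply: (@C1_sdiff R clog (fun w => w.1 / nsq w) (fun w => - w.2 / nsq w)).
- have z1 : \forall w \near z, 0 < w.1.
    by apply: (@cvgr_gt _ _ (nbhs z) _ fst z.1 cvg_fst).
  apply: filterS z1 => -[x y] /= x0; rewrite !mulNr opprK.
  have nx : x != 0 by rewrite gt_eqF.
  have n0 : 0 < x ^+ 2 + y ^+ 2 by rewrite ltr_wpDr ?sqr_ge0 ?exprn_gt0.
  have n1 : x ^+ 2 + y ^+ 2 != 0 by rewrite gt_eqF.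
  have dx : is_derive x 1 (fun x => x ^+ 2 + y ^+ 2) (2 * x).
    apply: is_derive_eq.
    by rewrite addr0 -![_ *: _]/(_ * _) mulr1; ring.
  have dy : is_derive y 1 (fun y => x ^+ 2 + y ^+ 2) (2 * y).
    apply: is_derive_eq.
    by rewrite add0r -![_ *: _]/(_ * _) mulr1; ring.
  have e2 : 1 + (y / x) ^+ 2 != 0 by rewrite gt_eqF // ltr_wpDr ?sqr_ge0.
  rewrite /nsq /=; split.
  + have dc := @is_derive1_comp R (@ln R) (fun x => x ^+ 2 + y ^+ 2) x _ _
        (is_derive1_ln n0) dx.
    apply: (is_derive_ext (is_deriveZ 2^-1 dc)).
      by move=> t /=; rewrite mulrC.
    by rewrite -[_ *: (_ * _)]/(_ * (_ * _)); field.
  + have dc := @is_derive1_comp R (@ln R) (fun y => x ^+ 2 + y ^+ 2) y _ _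
        (is_derive1_ln n0) dy.
    apply: (is_derive_ext (is_deriveZ 2^-1 dc)).
      by move=> t /=; rewrite mulrC.
    by rewrite -[_ *: (_ * _)]/(_ * (_ * _)); field.
  + have dV : is_derive x 1 (fun x => y / x) (- y / x ^+ 2).
      apply: (is_derive_ext (is_deriveZ y (is_deriveV nx (@is_derive_id R R x 1)))).
        by [].
      by rewrite -![_ *: _]/(_ * _) /= mulr1; field.
    apply: (is_derive_ext (@is_derive1_comp R (@atan R) (fun x => y / x) x _ _
      (is_derive1_atan _) dV)) => //.
    by field; rewrite nx n1.
  + have dV : is_derive y 1 (fun y => y / x) x^-1.
      apply: (is_derive_ext (is_deriveZ x^-1 (@is_derive_id R R y 1))).
        by move=> t; rewrite mulrC.
      by rewrite -![_ *: _]/(_ * _) /= mulr1.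
    apply: (is_derive_ext (@is_derive1_comp R (@atan R) (fun y => y / x) y _ _
      (is_derive1_atan _) dV)) => //.
    by field; rewrite nx n1.
- by apply: cvgM; [exact: cvg_fst|apply: cvgV].
- by apply: cvgM; [apply: cvgN; exact: cvg_snd|apply: cvgV].
Qed.

Lemma hol_clog z : 0 < z.1 -> hol clog z.
Proof.
move=> z0; have z1 : \forall w \near z, 0 < w.1.
  by apply: (@cvgr_gt _ _ (nbhs z) _ fst z.1 cvg_fst).
by apply: filterS z1 => w; exact: sdiff_clog.
Qed.

Lemma cexp_iC_pi2 : cexp ((0, pi / 2) : C) = iC.
Proof. by rewrite /cexp /= expR0 cos_pihalf sin_pihalf !mul1r. Qed.

(** At most three multiplications by [i], which is itself an exponential, bring [z] into the right
    half-plane; [i ^ 4 = 1] undoes them. *)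
Lemma cexp_surj z : z != 0 -> exists w, cexp w = z.
Proof.
have pos w : 0 < w.1 -> exists v, cexp v = w.
  by move=> h; exists (clog w); exact: cexp_clog.
have rot w : (exists v, cexp v = w) -> exists v, cexp v = iC * w.
  by move=> [v <-]; exists ((0, pi / 2) + v); rewrite cexpD cexp_iC_pi2.
have e2 : iC * (iC * (iC * (iC * z))) = z.
  by rewrite !mulrA iC_sqr mulN1r mulNr iC_sqr opprK mul1r.
move=> z0; case: (ltrgt0P z.1) => h1.
- exact: pos.
- rewrite -e2; apply/rot/rot/pos.
  by rewrite mulrA iC_sqr mulN1r /= oppr_gt0.
- case: (ltrgt0P z.2) => h2.
  + rewrite -e2; apply/rot/pos.
    by rewrite !mulrA iC_sqr mulN1r cmulE /= oppr0 !mul0r sub0r mulNr mul1r opprK.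
  + rewrite -e2; apply/rot/rot/rot/pos.
    by rewrite cmulE /= mul0r sub0r mul1r oppr_gt0.
  + by case/eqP: z0; apply: cplxP.
Qed.

(** The unit ball contains no nonzero period since [1 < pi]. This makes a logarithm locally
    determined by one value. *)
Lemma cexp_eq1 w : `|w| < 1 -> cexp w = 1 -> w = 0.
Proof.
move=> w1 E; have c1 := congr1 fst E; have c2 := congr1 snd E.
move: c1 c2; rewrite /= => c1 c2.
have y1 : `|w.2| < 1 by apply: le_lt_trans (snd_normle w) w1.
have pi2 := pi_ge2 R.
have s0 : sin w.2 = 0.
  by move/eqP: c2; rewrite mulf_eq0 gt_eqF ?expR_gt0 //= => /eqP.
have y0 : w.2 = 0.
  case: (ltrgt0P w.2) => // h.
    have : 0 < sin w.2 by apply: sin_gt0_pi; move: y1; rewrite ltr_norml; lra.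
    by rewrite s0 ltxx.
  have : 0 < sin (- w.2) by apply: sin_gt0_pi; move: y1; rewrite ltr_norml; lra.
  by rewrite sinN s0 oppr0 ltxx.
move: c1; rewrite y0 cos0 mulr1 => /eqP; rewrite -expR0 => /eqP/expR_inj h.
by apply: cplxP.
Qed.

End ComplexLog.

(** * Cauchy's formula and orders of zeros *)

Section MeanOverUnitInterval.
Context {R : realType}.
Local Notation C := (cplx R).
Local Notation mu := (@lebesgue_measure R).
Implicit Types (f g : R -> R).

Definition rint f : R := \int[mu]_(x in `[0, 1]) f x.

Lemma cont_int f : continuous f -> mu.-integrable `[0, 1] (EFin \o f).
Proof.
move=> cf; apply: continuous_compact_integrable; first exact: segment_compact.
exact: continuous_subspaceT.
Qed.

Lemma rintD f g : continuous f -> continuous g ->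
  rint (fun t => f t + g t) = rint f + rint g.
Proof. by move=> cf cg; rewrite /rint RintegralD //; exact: cont_int. Qed.
Lemma rintB f g : continuous f -> continuous g ->
  rint (fun t => f t - g t) = rint f - rint g.
Proof. by move=> cf cg; rewrite /rint RintegralB //; exact: cont_int. Qed.
Lemma rintZ a f : continuous f -> rint (fun t => a * f t) = a * rint f.
Proof. by move=> cf; rewrite /rint RintegralZl //; exact: cont_int. Qed.
Lemma rint_FTC (F f : R -> R) : continuous f ->
  (forall t, is_derive t (1 : R) F (f t)) -> rint f = F 1 - F 0.
Proof.
move=> cf dF; have cF t : {for t, continuous F}.
  by have [d _] := dF t; apply: differentiable_continuous; apply/derivable1_diffP.
rewrite /rint /Rintegral (continuous_FTC2 (F := F)) //.
- exact: continuous_subspaceT.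
- split; first by move=> t _; have [] := dF t.
  + by apply: cvg_at_right_filter; exact: cF.
  + by apply: cvg_at_left_filter; exact: cF.
- by move=> t _; rewrite derive1E; have [_ ->] := dF t.
Qed.

Lemma rint_cst a : rint (fun=> a) = a.
Proof.
have d (t : R) : is_derive t (1 : R) (fun t => a * t) a.
  by apply: (is_derive_ext (is_deriveZ a (@is_derive_id R R t 1))) => //;
    rewrite -[_ *: _]/(_ * _) mulr1.
rewrite (rint_FTC _ d); first by rewrite mulr1 mulr0 subr0.
by move=> t; exact: cvg_cst.
Qed.

Lemma rint_norm f M : continuous f -> (forall t, 0 <= t <= 1 -> `|f t| <= M) ->
  `|rint f| <= M.
Proof.
move=> cf H; apply: le_trans (le_normr_Rintegral _ (cont_int cf)) _ => //.
rewrite -[leRHS]rint_cst; apply: le_Rintegral => //.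
- by apply: cont_int => t; apply: cvg_norm; exact: cf.
- by apply: cont_int => t; exact: cvg_cst.
Qed.

Definition cint (f : R -> C) : C := (rint (fst \o f), rint (snd \o f)).

Lemma cont_fst (f : R -> C) : continuous f -> continuous (fst \o f).
Proof. by move=> cf t; apply: cvg_re; exact: cf. Qed.
Lemma cont_snd (f : R -> C) : continuous f -> continuous (snd \o f).
Proof. by move=> cf t; apply: cvg_im; exact: cf. Qed.

Lemma cintB (f g : R -> C) : continuous f -> continuous g ->
  cint (fun t => f t - g t) = cint f - cint g.
Proof.
move=> cf cg; have [f1 f2] := (cont_fst cf, cont_snd cf).
have [g1 g2] := (cont_fst cg, cont_snd cg).
by apply: cplxP; rewrite /= -rintB.
Qed.
Lemma cintD (f g : R -> C) : continuous f -> continuous g ->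
  cint (fun t => f t + g t) = cint f + cint g.
Proof.
move=> cf cg; have [f1 f2] := (cont_fst cf, cont_snd cf).
have [g1 g2] := (cont_fst cg, cont_snd cg).
by apply: cplxP; rewrite /= -rintD.
Qed.
Lemma cintZ (a : C) (f : R -> C) : continuous f ->
  cint (fun t => a * f t) = a * cint f.
Proof.
move=> cf; have [f1 f2] := (cont_fst cf, cont_snd cf).
have k (b : R) g : continuous g -> continuous (fun t => b * g t).
  by move=> cg t; apply: cvgM; [exact: cvg_cst|exact: cg].
rewrite cmulE; apply: cplxP => /=.
  rewrite -!rintZ // -rintB //; exact: k.
rewrite -!rintZ // -rintD //; exact: k.
Qed.
Lemma cint_cst (a : C) : cint (fun=> a) = a.
Proof. by apply: cplxP; rewrite /= rint_cst. Qed.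
Lemma cint_norm (f : R -> C) M : continuous f ->
  (forall t, 0 <= t <= 1 -> `|f t| <= M) -> `|cint f| <= M.
Proof.
move=> cf H; have [f1 f2] := (cont_fst cf, cont_snd cf).
apply: cnorm_le; apply: rint_norm => // t /H; apply: le_trans.
  exact: fst_normle.
exact: snd_normle.
Qed.

Lemma is_derive_re (F : R -> C) t v d : is_derive t v F d ->
  is_derive t v (fst \o F) d.1.
Proof.
move=> [dF <-].
have k : (fun h : R => h^-1 *: ((fst \o F) (h *: v + t) - (fst \o F) t)) @ 0^' -->
   ('D_v F t).1.
  by apply: cvg_trans (cvg_re dF); apply: near_eq_cvg; near=> h.
by split; [apply/cvg_ex; exists ('D_v F t).1|exact: cvg_lim].
Unshelve. all: by end_near. Qed.
Lemma is_derive_im (F : R -> C) t v d : is_derive t v F d ->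
  is_derive t v (snd \o F) d.2.
Proof.
move=> [dF <-].
have k : (fun h : R => h^-1 *: ((snd \o F) (h *: v + t) - (snd \o F) t)) @ 0^' -->
   ('D_v F t).2.
  by apply: cvg_trans (cvg_im dF); apply: near_eq_cvg; near=> h.
by split; [apply/cvg_ex; exists ('D_v F t).2|exact: cvg_lim].
Unshelve. all: by end_near. Qed.

Lemma cint_FTC (F f : R -> C) : continuous f ->
  (forall t, is_derive t (1 : R) F (f t)) -> cint f = F 1 - F 0.
Proof.
move=> cf dF; apply: cplxP => /=.
  by apply: (@rint_FTC (fst \o F) _ (cont_fst cf)) => t; exact: is_derive_re (dF t).
by apply: (@rint_FTC (snd \o F) _ (cont_snd cf)) => t; exact: is_derive_im (dF t).
Qed.

(** Compactness of the unit interval makes continuity at the points [(x, t)] uniform in [t]. *)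
Lemma unif_near (T : topologicalType) (phi : T -> R -> C) x e : 0 < e ->
  (forall t, 0 <= t <= 1 -> {for (x, t), continuous (fun p => phi p.1 p.2)}) ->
  \forall y \near x, forall t, 0 <= t <= 1 -> `|phi x t - phi y t| <= e.
Proof.
move=> e0 c2.
have K : \forall y \near x, `[0, 1]%classic `<=` (fun t => `|phi x t - phi y t| <= e).
  have /compact_near_coveringP := @segment_compact R 0 1.
  apply=> t; rewrite /= in_itv /= => t01.
  have n2 : \forall p \near (x, t), `|phi x t - phi p.1 p.2| < e / 2.
    by apply: (cvgr_dist_lt _ _ (c2 t t01)); rewrite divr_gt0.
  have n3 : \forall p \near (t, x), `|phi x t - phi p.2 p.1| < e / 2.
    have sw : (fun p : R * T => (p.2, p.1)) @ nbhs (t, x) --> (x, t).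
      by apply: cvg_pair_pt; [exact: cvg_snd|exact: cvg_fst].
    exact: sw _ n2.
  have n4 : \forall p \near (t, x), `|phi x t - phi x p.1| < e / 2.
    have f : (fun p : R * T => (x, p.1)) @ nbhs (t, x) --> (x, t).
      by apply: cvg_pair_pt; [exact: cvg_cst|exact: cvg_fst].
    exact: f _ n2.
  near=> p.
  have h1 : `|phi x t - phi p.2 p.1| < e / 2 by near: p.
  have h2 : `|phi x t - phi x p.1| < e / 2 by near: p.
  rewrite /= -(subrKA (phi x t)); apply: le_trans (ler_normD _ _) _.
  rewrite [`|_ - phi x t|]distrC; apply: ltW; move: h1 h2.
  set u := `|_|; set w := `|_|; lra.
apply: filterS K => y H t t01.
by have := H t; rewrite /= in_itv /=; exact.
Unshelve. all: by end_near. Qed.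

(** The parameter space is arbitrary because it is a pair of complex numbers in [sdiff_cauchy] and a
    real number in [cauchy_formula]. *)
Lemma cint_cont (T : topologicalType) (phi : T -> R -> C) x :
  (\forall y \near x, continuous (phi y)) ->
  (forall t, 0 <= t <= 1 -> {for (x, t), continuous (fun p => phi p.1 p.2)}) ->
  {for x, continuous (fun y => cint (phi y))}.
Proof.
move=> c1 c2; have cx := nbhs_singleton c1.
apply/cvgrPdist_le => e e0; have K := unif_near e0 c2.
near=> y.
have cy : continuous (phi y) by near: y.
rewrite -cintB //; apply: cint_norm.
  by move=> t; apply: cvgB; [exact: cx|exact: cy].
by near: y.
Unshelve. all: by end_near. Qed.

(** Differentiation under the integral. The mean value estimate, applied to each coordinate for each
    [t], has an error uniform in [t] by [unif_near], and it can be integrated. *)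
Lemma cint_diff (phi psi : R -> R -> C) x :
  (\forall y \near x, continuous (phi y)) -> continuous (psi x) ->
  (\forall y \near x, forall t, 0 <= t <= 1 ->
     is_derive y (1 : R) (phi^~ t) (psi y t)) ->
  (forall t, 0 <= t <= 1 -> {for (x, t), continuous (fun p => psi p.1 p.2)}) ->
  is_derive x (1 : R) (fun y => cint (phi y)) (cint (psi x)).
Proof.
move=> c1 cp dphi c2; have cx := nbhs_singleton c1.
have key e : 0 < e -> \forall y \near x,
    `|cint (phi y) - cint (phi x) - ofR (y - x) * cint (psi x)| <= e * `|y - x|.
  move=> e0; have K := unif_near e0 c2.
  have /nbhs_ballP[d /= d0 H] : \forall y \near x, forall t, 0 <= t <= 1 ->
      is_derive y (1 : R) (phi^~ t) (psi y t) /\ `|psi x t - psi y t| <= e.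
    near=> y.
    have h1 : forall t, 0 <= t <= 1 -> is_derive y (1 : R) (phi^~ t) (psi y t).
      by near: y.
    have h2 : forall t, 0 <= t <= 1 -> `|psi x t - psi y t| <= e by near: y.
    by move=> t t01; split; [exact: h1|exact: h2].
  have nb : \forall y \near x, ball x d y by exact: nbhsx_ballx.
  near=> y; have by0 : ball x d y by near: y.
  have cy : continuous (phi y) by near: y.
  have cz : continuous (fun t => ofR (y - x) * psi x t).
    by move=> t; apply: ccvgM; [exact: cvg_cst|exact: cp].
  have cd : continuous (fun t => phi y t - phi x t).
    by move=> t; apply: cvgB; [exact: cy|exact: cx].
  rewrite -cintB // -cintZ // -cintB //; apply: cint_norm.
    by move=> t; apply: cvgB; [exact: cd|exact: cz].
  move=> t t01.
  have B s : Num.min x y <= s <= Num.max x y -> ball x d s.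
    move: by0; rewrite /ball /= !ltr_distlC => /andP[? ?] /andP[].
    rewrite ge_min le_max => /orP[?|?] /orP[?|?]; apply/andP; split; lra.
  have -> : ofR (y - x) * psi x t = ((psi x t).1 * (y - x), (psi x t).2 * (y - x)).
    by rewrite cmulE; apply: cplxP => /=; ring.
  apply: cnorm_le => /=.
    apply: (@mean_value_strict _ (fun s => (phi s t).1) (fun s => (psi s t).1)).
    move=> s /B /H /(_ t t01) [h1 h2]; split; first exact: is_derive_re h1.
    by rewrite distrC; apply: le_trans (fst_normle (psi x t - psi s t)) h2.
  apply: (@mean_value_strict _ (fun s => (phi s t).2) (fun s => (psi s t).2)).
  move=> s /B /H /(_ t t01) [h1 h2]; split; first exact: is_derive_im h1.
  by rewrite distrC; apply: le_trans (snd_normle (psi x t - psi s t)) h2.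
have lim : (fun h : R => h^-1 *: (cint (phi (h *: (1 : R) + x)) - cint (phi x)))
    @ 0^' --> cint (psi x).
  apply/cvgrPdist_le => e e0.
  have k := @cvg_scale_add R R x 1.
  have k2 : \forall h \near 0^', `|cint (phi (h *: (1 : R) + x)) - cint (phi x) -
     ofR (h *: (1 : R) + x - x) * cint (psi x)| <= e * `|h *: (1 : R) + x - x|.
    exact: k _ (key e e0).
  have k5 : \forall h \near (0 : R)^', h != 0 by exact: nbhs_dnbhs_neq.
  near=> h; have h0 : h != 0 by near: h.
  have : `|cint (phi (h *: (1 : R) + x)) - cint (phi x) -
     ofR (h *: (1 : R) + x - x) * cint (psi x)| <= e * `|h *: (1 : R) + x - x|.
    by near: h.
  rewrite addrK -[h *: 1]/(h * 1) mulr1 => E.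
  have -> : cint (psi x) - h^-1 *: (cint (phi (h + x)) - cint (phi x)) =
    - (h^-1 *: (cint (phi (h + x)) - cint (phi x) - ofR h * cint (psi x))).
    set a := _ - cint (phi x).
    rewrite -scale_ofR [in RHS]scalerBr opprB; congr (_ - _).
    by rewrite scalerA mulVf // scale1r.
  rewrite normrN normrZ normfV mulrC ler_pdivrMr ?normr_gt0 //.
by split; [apply/cvg_ex; exists (cint (psi x))|exact: cvg_lim].
Unshelve. all: by end_near. Qed.

(** Derivatives are required in the open interval only: the contraction in [cauchy_formula] needs a
    division by its parameter, impossible at 0. *)
Lemma eq_ends_derive0 (F : R -> C) :
  (forall t : R, 0 < t < 1 -> is_derive t (1 : R) F 0) ->
  (forall t : R, 0 <= t <= 1 -> {for t, continuous F}) -> F 1 = F 0.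
Proof.
move=> dF cF.
have k (f : R -> R) : (forall t : R, 0 < t < 1 -> is_derive t (1 : R) f 0) ->
    (forall t : R, 0 <= t <= 1 -> {for t, continuous f}) -> f 1 = f 0.
  move=> df cf.
  have H1 (t : R) : t \in `]0, 1[%R -> is_derive t (1 : R) f 0.
    by rewrite in_itv; exact: df.
  have H2 : {within `[0, 1], continuous f}.
    by apply: continuous_in_subspaceT => t /set_mem; rewrite /= in_itv; exact: cf.
  have [c _] := @MVT R f (fun=> 0) 0 1 ltr01 H1 H2.
  by rewrite mul0r => /eqP; rewrite subr_eq0 => /eqP.
apply: cplxP; first apply: (k (fst \o F)); last apply: (k (snd \o F)).
- by move=> t /dF h; exact: is_derive_re h.
- by move=> t /cF h; apply: cvg_re.
- by move=> t /dF h; exact: is_derive_im h.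
- by move=> t /cF h; apply: cvg_im.
Qed.

End MeanOverUnitInterval.

(** * Cauchy integrals over circles *)

Section Cauchy.
Context {R : realType}.
Local Notation C := (cplx R).

Lemma ofR_cvg T (F : set_system T) {FF : Filter F} (f : T -> R) (a : R) :
  f @ F --> a -> ofR (f x) @[x --> F] --> ofR a.
Proof. by move=> h; apply: cvg_cplx => //=; exact: cvg_cst. Qed.

Lemma cexp_cont z : {for z, continuous (@cexp R)}.
Proof. exact: hol_cont (hol_cexp z). Qed.

Definition period : C := (0, 2 * pi).
Definition circ (r t : R) : C := ofR r * cexp (ofR t * period).

Lemma cexp_period t :
  cexp (ofR t * period) = (cos (t * (2 * pi)), sin (t * (2 * pi))).
Proof.
have -> : ofR t * period = (0, t * (2 * pi)).
  by rewrite cmulE; apply: cplxP => /=; ring.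
by rewrite /cexp /= expR0 !mul1r.
Qed.

Lemma circ_nsq r t : nsq (circ r t) = r ^+ 2.
Proof.
rewrite /circ nsqM cexp_period /nsq /= cos2Dsin2.
by rewrite expr0n /= addr0 mulr1.
Qed.

Lemma circ_norm r t : 0 <= r -> `|circ r t| <= r.
Proof.
move=> r0; rewrite -(@ler_pXn2r _ 2) ?nnegrE // -(circ_nsq r t).
exact: nsq_norm.
Qed.

Lemma circ_derive r t : is_derive t (1 : R) (circ r) (period * circ r t).
Proof.
have d : is_derive t (1 : R) (fun s => ofR s * period) period.
  have lim : (fun h : R => h^-1 *: (ofR (h *: (1 : R) + t) * period - ofR t * period))
      @ 0^' --> period.
    have cc : (fun _ : R => period) @ 0^' --> period by exact: cvg_cst.
    apply: cvg_trans cc; apply: near_eq_cvg; near=> s.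
    have s0 : s != 0 by near: s; exact: nbhs_dnbhs_neq.
    rewrite -mulrBl -[_ *: 1]/(_ * 1) mulr1 ofRD addrK -scale_ofR scalerA.
    by rewrite mulVf // scale1r.
  by split; [apply/cvg_ex; exists period|exact: cvg_lim].
have c : {for t, continuous (fun s => ofR s * period)}.
  by apply: ccvgM; [exact: ofR_cvg|exact: cvg_cst].
have h : sdiff (fun w => ofR r * cexp w) (ofR t * period)
    (0 * cexp (ofR t * period) + ofR r * cexp (ofR t * period)).
  by apply: sdiffM; [exact: sdiff_cst|exact: sdiff_cexp].
apply: (is_derive_ext (sdiff_dir d c h)) => //.
by rewrite mul0r add0r.
Unshelve. all: by end_near. Qed.

Lemma circ_cont r : continuous (circ r).
Proof.
move=> t; apply: ccvgM; first exact: cvg_cst.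
apply: (cont_cvg (@cexp_cont _)); apply: ccvgM; last exact: cvg_cst.
exact: ofR_cvg.
Qed.

Lemma circ_period r : circ r 1 = circ r 0.
Proof.
rewrite /circ !cexp_period mul1r mul0r -[2 * pi]add0r mulr_natl.
by rewrite cosD2pi sinD2pi.
Qed.

Lemma circ_neq r t (w : C) : nsq w < r ^+ 2 -> circ r t - w != 0.
Proof.
move=> wr; rewrite subr_eq0; apply/eqP => E.
by move: wr; rewrite -E circ_nsq ltxx.
Qed.

Lemma nsq_lt_near (w : C) r : nsq w < r -> \forall z \near w, nsq z < r.
Proof. by move=> h; apply: (@cvgr_lt _ _ (nbhs w) _ _ _ (@nsq_cont R w)). Qed.

(* With [kap t = G (circ r t) * circ r t] this is the Cauchy integral of [G]: the
   factor [2 pi i] in [dz] cancels the one in the denominator. *)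
Definition cauchy r (kap : R -> C) (w : C) : C :=
  cint (fun t => kap t / (circ r t - w)).

Lemma div_circ_cont r (kap : R -> C) (w : C) : continuous kap -> nsq w < r ^+ 2 ->
  continuous (fun t => kap t / (circ r t - w)).
Proof.
move=> ck wr t; apply: ccvgM; first exact: ck.
apply: ccvgV; first exact: circ_neq.
by apply: cvgB; [exact: circ_cont|exact: cvg_cst].
Qed.

(** The difference quotient of the kernel is explicit: [1 / (x - b) - 1 / (x - a)] equals
    [(b - a) / ((x - a) (x - b))]. Its integral [Q] is continuous up to the diagonal, which is
    strict differentiability. *)
Lemma sdiff_cauchy r (kap : R -> C) w : continuous kap -> nsq w < r ^+ 2 ->
  exists d, sdiff (cauchy r kap) w d.
Proof.
move=> ck wr.
pose Q (p : C * C) : C := cint (fun t => kap t / (circ r t - p.1) / (circ r t - p.2)).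
have nw := nsq_lt_near wr; have n1 := near_fst nw; have n2 := near_snd nw.
have cQ : {for (w, w), continuous Q}.
  apply: (@cint_cont R _ (fun (p : C * C) t =>
    kap t / (circ r t - p.1) / (circ r t - p.2))).
    near=> p => t; apply: ccvgM.
      by apply: div_circ_cont => //; near: p.
    apply: ccvgV; first by apply: circ_neq; near: p.
    by apply: cvgB; [exact: circ_cont|exact: cvg_cst].
  move=> t t01 /=.
  have c1 : (fun p : (C * C) * R => circ r p.2) @ nbhs ((w, w), t) --> circ r t.
    by apply: (cont_cvg (@circ_cont r t)); exact: cvg_snd.
  have c0 : (fun p : (C * C) * R => kap p.2) @ nbhs ((w, w), t) --> kap t.
    by apply: (cont_cvg (ck t)); exact: cvg_snd.
  have f0 : (fun p : (C * C) * R => p.1) @ nbhs ((w, w), t) --> (w, w).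
    exact: cvg_fst.
  have f1 : (fun p : (C * C) * R => p.1.1) @ nbhs ((w, w), t) --> w.
    by apply: (cvg_comp _ fst f0); exact: cvg_fst.
  have f2 : (fun p : (C * C) * R => p.1.2) @ nbhs ((w, w), t) --> w.
    by apply: (cvg_comp _ snd f0); exact: cvg_snd.
  apply: ccvgM; last by apply: ccvgV; [exact: circ_neq|exact: cvgB c1 f2].
  by apply: ccvgM => //; apply: ccvgV; [exact: circ_neq|exact: cvgB c1 f1].
exists (Q (w, w)); exists Q => //.
near=> p.
have p1 : nsq p.1 < r ^+ 2 by near: p.
have p2 : nsq p.2 < r ^+ 2 by near: p.
rewrite /cauchy -cintB; [|exact: div_circ_cont|exact: div_circ_cont].
rewrite /Q -cintZ.
  congr cint; apply/funext => t; field.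
  by rewrite !circ_neq.
move=> t; apply: ccvgM; first exact: div_circ_cont.
apply: ccvgV; first exact: circ_neq.
by apply: cvgB; [exact: circ_cont|exact: cvg_cst].
Unshelve. all: by end_near. Qed.

Lemma hol_cauchy r (kap : R -> C) w : continuous kap -> nsq w < r ^+ 2 ->
  hol (cauchy r kap) w.
Proof.
by move=> ck /nsq_lt_near; apply: filterS => z; exact: sdiff_cauchy.
Qed.

(** One step of the geometric series, [1 / (x - w) = 1 / x + w / (x (x - w))], under the
    integral. *)
Lemma cauchy_expand r (kap : R -> C) w : 0 < r -> continuous kap -> nsq w < r ^+ 2 ->
  cauchy r kap w = cauchy r kap 0 + w * cauchy r (fun t => kap t / circ r t) w.
Proof.
move=> r0 ck wr.
have z0 : nsq (0 : C) < r ^+ 2 by rewrite /nsq /= expr0n /= addr0 exprn_gt0.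
have cz t : circ r t != 0 by have := circ_neq t z0; rewrite subr0.
have ck2 : continuous (fun t => kap t / circ r t).
  have := div_circ_cont ck z0.
  by under eq_fun do rewrite subr0.
rewrite /cauchy -cintZ; last exact: div_circ_cont.
rewrite -cintD; [|exact: div_circ_cont|].
  congr cint; apply/funext => t; field.
  by rewrite ?subr0 ?cz ?circ_neq.
move=> t; apply: ccvgM; first exact: cvg_cst.
exact: (div_circ_cont ck2 wr).
Qed.

End Cauchy.

Section CauchyFormula.
Context {R : realType}.
Local Notation C := (cplx R).

Lemma ofR_derive (t : R) : is_derive t (1 : R) (@ofR R) 1.
Proof.
have lim : (fun h : R => h^-1 *: (ofR (h *: (1 : R) + t) - ofR t)) @ 0^' --> (1 : C).
  have cc : (fun _ : R => (1 : C)) @ 0^' --> (1 : C) by exact: cvg_cst.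
  apply: cvg_trans cc; apply: near_eq_cvg; near=> s.
  have s0 : s != 0 by near: s; exact: nbhs_dnbhs_neq.
  rewrite -[_ *: 1]/(_ * 1) mulr1 ofRD addrK scale_ofR -ofRM.
  by rewrite mulVf.
by split; [apply/cvg_ex; exists (1 : C)|exact: cvg_lim].
Unshelve. all: by end_near. Qed.

Lemma sdiff_real (F : C -> C) (s : R) d : sdiff F (ofR s) d ->
  is_derive s (1 : R) (F \o @ofR R) d.
Proof.
move=> h; have c : {for s, continuous (@ofR R)} by exact: ofR_cvg.
by have := sdiff_dir (ofR_derive s) c h; rewrite mul1r.
Qed.

Lemma sdiff_circ (F : C -> C) r t d : sdiff F (circ r t) d ->
  is_derive t (1 : R) (F \o circ r) (period * circ r t * d).
Proof. by move=> h; exact: sdiff_dir (circ_derive r t) (@circ_cont R r t) h. Qed.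

Lemma period_neq0 : period != 0 :> C.
Proof.
apply/eqP => /(congr1 snd) /= /eqP; rewrite mulf_eq0 pnatr_eq0 /=.
by rewrite gt_eqF ?pi_gt0.
Qed.

Lemma nsq_ofR s (w : C) : nsq (ofR s * w) = s ^+ 2 * nsq w.
Proof. by rewrite nsqM /nsq /= expr0n /= addr0. Qed.

(* The integral at [s w] has derivative zero in [s], the integrand of the
   derivative having a primitive on the circle. *)
Lemma cauchy_circ (r : R) (w : C) : nsq w < r ^+ 2 -> cauchy r (circ r) w = 1.
Proof.
move=> wr; have wr' s : 0 <= s <= 1 -> nsq (ofR s * w) < r ^+ 2.
  move=> /andP[s0 s1]; rewrite nsq_ofR; apply: le_lt_trans wr.
  by rewrite -[leRHS]mul1r ler_wpM2r ?nsq_ge0 // expr_le1.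
pose J (s : R) := cauchy r (circ r) (ofR s * w).
have cw (s t : R) : (fun p : R * R => circ r p.2 - ofR p.1 * w) @ nbhs (s, t) -->
    circ r t - ofR s * w.
  apply: cvgB.
    by apply: (cont_cvg (@circ_cont R r t)); exact: cvg_snd.
  by apply: ccvgM; [apply: ofR_cvg; exact: cvg_fst|exact: cvg_cst].
have cs (s : R) : {for s, continuous (fun s => ofR s * w)}.
  by apply: ccvgM; [exact: ofR_cvg|exact: cvg_cst].
have near_dom (s : R) : 0 <= s <= 1 ->
    \forall y \near s, nsq (ofR y * w) < r ^+ 2.
  by move=> /wr' /nsq_lt_near h; exact: cs s _ h.
have dJ (s : R) : 0 <= s <= 1 -> is_derive s (1 : R) J 0.
  move=> s01; have nd := near_dom s s01; have d0 := wr' s s01.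
  pose psi (y t : R) := circ r t * w / (circ r t - ofR y * w) ^+ 2.
  have cpsi (y : R) : nsq (ofR y * w) < r ^+ 2 -> continuous (psi y).
    move=> yd t; apply: ccvgM.
      by apply: ccvgM; [exact: circ_cont|exact: cvg_cst].
    apply: ccvgV; first by rewrite expf_neq0 // circ_neq.
    by apply: ccvgX; apply: cvgB; [exact: circ_cont|exact: cvg_cst].
  have -> : 0 = cint (psi s).
    (* Since [circ r] has derivative [period * circ r], dividing by [period] makes [psi s] the
       derivative of [F] along the circle. *)
    pose F (z : C) := - (w / period) * (z - ofR s * w)^-1.
    have dF t : is_derive t (1 : R) (F \o circ r) (psi s t).
      have n0 := circ_neq t d0.
      have d1 : sdiff F (circ r t) (0 * (circ r t - ofR s * w)^-1 +
          - (w / period) * (- (1 - 0) / (circ r t - ofR s * w) ^+ 2)).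
        apply: sdiffM; first exact: sdiff_cst.
        apply: sdiffV => //; apply: sdiffB; [exact: sdiff_id|exact: sdiff_cst].
      apply: (is_derive_ext (sdiff_circ d1)) => //.
      by rewrite /psi; field; rewrite n0 period_neq0.
    by rewrite (cint_FTC (cpsi s d0) dF) /= circ_period subrr.
  apply: (@cint_diff R (fun y t => circ r t / (circ r t - ofR y * w)) psi).
  - near=> y; apply: div_circ_cont; first exact: circ_cont.
    by near: y.
  - exact: cpsi.
  - near=> y => t t01.
    have yd : nsq (ofR y * w) < r ^+ 2 by near: y.
    have n0 := circ_neq t yd.
    have d1 : sdiff (fun z => circ r t * (circ r t - z * w)^-1) (ofR y)
       (0 * (circ r t - ofR y * w)^-1 +
       circ r t * (- (0 - (1 * w + ofR y * 0)) / (circ r t - ofR y * w) ^+ 2)).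
      apply: sdiffM; first exact: sdiff_cst.
      apply: sdiffV => //; apply: sdiffB; first exact: sdiff_cst.
      by apply: sdiffM; [exact: sdiff_id|exact: sdiff_cst].
    apply: (is_derive_ext (sdiff_real d1)) => //.
    by rewrite /psi; field.
  - move=> t t01; apply: ccvgM.
      apply: ccvgM; last exact: cvg_cst.
      by apply: (cont_cvg (@circ_cont R r t)); exact: cvg_snd.
    apply: ccvgV; first by rewrite expf_neq0 // circ_neq.
    by apply: ccvgX; exact: cw.
have : J 1 = J 0.
  apply: eq_ends_derive0 => s.
    by move=> /andP[/ltW a /ltW b]; apply: dJ; rewrite a b.
  move=> s01; have [d _] := dJ s s01.
  by apply: differentiable_continuous; apply/derivable1_diffP.
rewrite /J -/(1 : C) -[ofR 1]/(1 : C) mul1r => ->.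
rewrite -[ofR 0]/(0 : C) mul0r /cauchy.
rewrite -[RHS]cint_cst; congr cint; apply/funext => t.
rewrite subr0 divff //; have := @circ_neq R r t 0; rewrite subr0; apply.
by rewrite /nsq /= expr0n /= addr0; apply: le_lt_trans wr; exact: nsq_ge0.
Unshelve. all: by end_near. Qed.

End CauchyFormula.

(** * Cauchy's formula and factorization at a zero *)

Section Order.
Context {R : realType}.
Local Notation C := (cplx R).

(* The circle is contracted linearly to [w]; the derivative of the integral in
   the contraction parameter is again the integral of an exact form, so no
   general Cauchy theorem is needed. *)
Lemma cauchy_formula (G : C -> C) (r rho : R) (w : C) :
  (forall z, `|z| < rho -> hol G z) -> 0 < r -> r < rho -> nsq w < r ^+ 2 ->
  G w = cauchy r (fun t => G (circ r t) * circ r t) w.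
Proof.
move=> hG r0 rr wr.
have nw : `|w| <= r.
  rewrite -(@ler_pXn2r _ 2) ?nnegrE ?(ltW r0) //.
  exact: le_trans (nsq_norm _) (ltW wr).
pose z (s t : R) : C := w + ofR s * (circ r t - w).
(* This bound on the modulus of [z s t] still allows [s] slightly outside the unit interval, giving
   full neighbourhoods of the endpoints. *)
pose dom (s : R) := (`|1 - s| + `|s|) * r < rho.
have dom01 (s : R) : 0 <= s <= 1 -> dom s.
  move=> /andP[s0 s1]; rewrite /dom (ger0_norm s0) ger0_norm ?subr_ge0 //.
  by rewrite subrK mul1r.
have zdom s t : dom s -> `|z s t| < rho.
  apply: le_lt_trans; rewrite /z.
  have -> : w + ofR s * (circ r t - w) = (1 - s) *: w + s *: circ r t.
    by rewrite !scale_ofR; have -> : ofR (1 - s) = 1 - ofR s; [apply: cplxP => /=; ring|ring].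
  apply: le_trans (ler_normD _ _) _; rewrite !normrZ mulrDl lerD //.
    by rewrite ler_wpM2l.
  by rewrite ler_wpM2l // circ_norm // ltW.
have near_dom (s : R) : dom s -> \forall y \near s, dom y.
  move=> ds; have c : {for s, continuous (fun s : R => (`|1 - s| + `|s|) * r)}.
    apply: cvgM; last exact: cvg_cst.
    apply: cvgD; apply: cvg_norm => //.
    by apply: cvgB => //; exact: cvg_cst.
  exact: (@cvgr_lt _ _ (nbhs s) _ _ _ c).
have hz s t : dom s -> hol G (z s t) by move=> /zdom h; exact: hG.
have cz (s t : R) : (fun p : R * R => z p.1 p.2) @ nbhs (s, t) --> z s t.
  apply: cvgD; first exact: cvg_cst.
  apply: ccvgM; first by apply: ofR_cvg; exact: cvg_fst.
  apply: cvgB; last exact: cvg_cst.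
  by apply: (cont_cvg (@circ_cont R r t)); exact: cvg_snd.
have cz2 (s t : R) : z s @ nbhs t --> z s t.
  apply: cvgD; first exact: cvg_cst.
  apply: ccvgM; first exact: cvg_cst.
  by apply: cvgB; [exact: circ_cont|exact: cvg_cst].
pose phi (s t : R) : C := G (z s t) * circ r t / (circ r t - w).
pose psi (s t : R) : C := cderiv G (z s t) * circ r t.
have cphi s : dom s -> continuous (phi s).
  move=> ds; apply: div_circ_cont => // t; apply: ccvgM; last exact: circ_cont.
  by apply: (cont_cvg (hol_cont (hz s t ds))); exact: cz2.
have cpsi s : dom s -> continuous (psi s).
  move=> ds t; apply: ccvgM; last exact: circ_cont.
  by apply: (cont_cvg (cderiv_cont (hz s t ds))); exact: cz2.
pose J (s : R) := cint (phi s).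
have cJ (s : R) : 0 <= s <= 1 -> {for s, continuous J}.
  move=> /dom01 ds; apply: cint_cont.
    by have := near_dom s ds; apply: filterS => y; exact: cphi.
  move=> t t01; apply: ccvgM; first apply: ccvgM.
  - by apply: (cont_cvg (hol_cont (hz s t ds))); exact: cz.
  - by apply: (cont_cvg (@circ_cont R r t)); exact: cvg_snd.
  apply: ccvgV; first exact: circ_neq.
  apply: cvgB; last exact: cvg_cst.
  by apply: (cont_cvg (@circ_cont R r t)); exact: cvg_snd.
have dJ (s : R) : 0 < s < 1 -> is_derive s (1 : R) J 0.
  move=> /andP[s0 s1]; have ds : dom s by apply: dom01; rewrite !ltW.
  have -> : 0 = cint (psi s).
    (* Multiplied by [s * period], the integrand [psi s] becomes the derivative along the circle of
       [G (w + s (y - w))], which takes the same value at both ends. Removing the factor uses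
       [s != 0]. *)
    have nz : ofR s * period != 0 by rewrite mulf_neq0 ?period_neq0 ?ofR_eq0 ?gt_eqF.
    apply: (mulfI nz); rewrite mulr0 -cintZ; last exact: cpsi.
    pose F (y : C) := G (w + ofR s * (y - w)).
    have dF t : is_derive t (1 : R) (F \o circ r) (ofR s * period * psi s t).
      have d1 : sdiff (fun y => w + ofR s * (y - w)) (circ r t)
          (0 + (0 * (circ r t - w) + ofR s * (1 - 0))).
        apply: sdiffD; first exact: sdiff_cst.
        apply: sdiffM; first exact: sdiff_cst.
        by apply: sdiffB; [exact: sdiff_id|exact: sdiff_cst].
      have d2 := sdiff_comp d1 (hol_sdiff (hz s t ds)).
      apply: (is_derive_ext (sdiff_circ d2)) => //.
      by rewrite /psi; ring.
    rewrite (cint_FTC _ dF) /= ?circ_period ?subrr //.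
    by move=> t; apply: ccvgM; [exact: cvg_cst|exact: cpsi].
  apply: (@cint_diff R phi psi).
  - by have := near_dom s ds; apply: filterS => y; exact: cphi.
  - exact: cpsi.
  - have := near_dom s ds; apply: filterS => y dy t t01.
    have n0 := circ_neq t wr.
    have d1 : sdiff (fun x => w + x * (circ r t - w)) (ofR y)
        (0 + (1 * (circ r t - w) + ofR y * 0)).
      apply: sdiffD; first exact: sdiff_cst.
      by apply: sdiffM; [exact: sdiff_id|exact: sdiff_cst].
    have d2 := sdiff_comp d1 (hol_sdiff (hz y t dy)).
    have d3 := sdiffM d2 (sdiff_cst (circ r t / (circ r t - w)) (ofR y)).
    apply: (is_derive_ext (sdiff_real d3)); first by move=> x; rewrite /phi /z /= mulrA.
    by rewrite /psi; field.
  - move=> t t01; apply: ccvgM.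
      by apply: (cont_cvg (cderiv_cont (hz s t ds))); exact: cz.
    by apply: (cont_cvg (@circ_cont R r t)); exact: cvg_snd.
have J1 : J 1 = cauchy r (fun t => G (circ r t) * circ r t) w.
  rewrite /J /cauchy; congr cint; apply/funext => t; rewrite /phi /z.
  by rewrite -[ofR 1]/(1 : C) mul1r addrC subrK.
have J0 : J 0 = G w.
  have -> : J 0 = cint (fun t => G w * (circ r t / (circ r t - w))).
    congr cint; apply/funext => t; rewrite /phi /z.
    by rewrite -[ofR 0]/(0 : C) mul0r addr0 mulrA.
  rewrite cintZ; last by apply: div_circ_cont => //; exact: circ_cont.
  by rewrite -/(cauchy r (circ r) w) cauchy_circ // mulr1.
by rewrite -J1 -J0; exact/esym/eq_ends_derive0.
Qed.

(* Iterating [cauchy_expand] yields the Taylor coefficients [U m 0]; if they all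
   vanish, [G w] is a multiple of [(w / circ r t) ^+ m] under the integral for
   every [m]. *)
Lemma hol_order0 (G : C -> C) : hol G 0 ->
  (\forall w \near (0 : C), G w = 0) \/
  exists m U, [/\ hol U 0, U 0 != 0 & \forall w \near (0 : C), G w = w ^+ m * U w].
Proof.
move=> /hol_near /nbhs_ballP [rho /= rho0 H].
have hG z : `|z| < rho -> hol G z.
  by move=> zr; apply: H; rewrite -ball_normE /= sub0r normrN.
pose r := rho / 2; have r0 : 0 < r by rewrite divr_gt0.
have rr : r < rho by rewrite /r; lra.
pose kap (m : nat) (t : R) : C := G (circ r t) * circ r t / circ r t ^+ m.
have z0r : nsq (0 : C) < r ^+ 2 by rewrite /nsq /= expr0n /= addr0 exprn_gt0.
have cn0 t : circ r t != 0 by have := circ_neq t z0r; rewrite subr0.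
have ck m : continuous (kap m).
  move=> t; apply: ccvgM.
    apply: ccvgM; last exact: circ_cont.
    apply: (cont_cvg (hol_cont (hG _ _))); last exact: circ_cont.
    by apply: le_lt_trans rr; apply: circ_norm; exact: ltW.
  by apply: ccvgV; [rewrite expf_neq0|apply: ccvgX; exact: circ_cont].
pose U m := cauchy r (kap m).
have nr : \forall w \near (0 : C), nsq w < r ^+ 2 by exact: nsq_lt_near.
have U0 w : nsq w < r ^+ 2 -> G w = U 0%N w.
  move=> wr; rewrite (cauchy_formula hG r0 rr wr) /U.
  suff -> : (fun t => G (circ r t) * circ r t) = kap 0%N by [].
  by apply/funext => t; rewrite /kap expr0 divr1.
have US m w : nsq w < r ^+ 2 -> U m w = U m 0 + w * U m.+1 w.
  move=> wr; rewrite /U (cauchy_expand r0 (ck m) wr).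
  suff -> : (fun t => kap m t / circ r t) = kap m.+1 by [].
  by apply/funext => t; rewrite /kap exprS; field; rewrite cn0 expf_neq0.
have exp m : (forall k, (k < m)%N -> U k 0 = 0) ->
    forall w, nsq w < r ^+ 2 -> G w = w ^+ m * U m w.
  elim: m => [|m IH] Hk w wr; first by rewrite expr0 mul1r U0.
  rewrite IH // => [|k km]; last by apply: Hk; apply: ltnW.
  by rewrite US // Hk // add0r mulrA -exprSr.
case: (pselect (exists m, U m 0 != 0)) => [ex|nex].
  right; case: (ex_minnP ex) => m m0 mmin; exists m, (U m); split => //.
    exact: hol_cauchy.
  apply: filterS nr; apply: exp => k km; apply/eqP; apply: contraTT km => k0.
  by rewrite -leqNgt; exact: mmin.
left; apply: filterS nr => w wr.
have allz m : U m 0 = 0 by apply/eqP/negPn/negP => h; apply: nex; exists m.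
have Gm m : G w = cint (fun t => G (circ r t) * circ r t / (circ r t - w) *
    (w / circ r t) ^+ m).
  rewrite (exp m) // /U /cauchy -cintZ; last exact: div_circ_cont.
  apply: (congr1 cint); apply/funext => t; rewrite /kap expr_div_n; field.
  by rewrite expf_neq0 // circ_neq.
pose k0 t := G (circ r t) * circ r t / (circ r t - w).
have ck0 : continuous k0.
  apply: div_circ_cont => //; have := ck 0%N.
  by rewrite /kap; under eq_fun do rewrite expr0 divr1.
have [c c01 cmax] : exists2 c, c \in `[0, 1]%R &
    forall t, t \in `[0, 1]%R -> `|k0 t| <= `|k0 c|.
  apply: (@EVT_max R (fun t => `|k0 t|)) => //.
  by apply: continuous_subspaceT => t; apply: cvg_norm; exact: ck0.
set M := `|k0 c| in cmax.
(* [q] is the squared ratio of Euclidean moduli, so [sqrt (q ^ m)] bounds the norm of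
   [(w / circ r t) ^ m] and tends to 0. *)
pose q := nsq w / r ^+ 2.
have q0 : 0 <= q by rewrite divr_ge0 ?nsq_ge0 ?sqr_ge0.
have q1 : `|q| < 1 by rewrite ger0_norm // ltr_pdivrMr ?exprn_gt0 // mul1r.
have bound m : `|G w| <= 2 * (M * Num.sqrt (q ^+ m)).
  rewrite (Gm m); apply: cint_norm.
    move=> t; apply: ccvgM; first exact: ck0.
    apply: ccvgX; apply: ccvgM; first exact: cvg_cst.
    by apply: ccvgV => //; exact: circ_cont.
  move=> t t01; apply: le_trans (cnormM _ _) _.
  rewrite ler_pM2l // ler_pM //; first by apply: cmax; rewrite in_itv.
  rewrite -(@ler_pXn2r _ 2) ?nnegrE ?sqrtr_ge0 //; apply: le_trans (nsq_norm _) _.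
  rewrite sqr_sqrtr ?exprn_ge0 //.
  have nX (x : C) n : nsq (x ^+ n) = nsq x ^+ n.
    elim: n => [|n IH]; first by rewrite !expr0 /nsq /= expr1n expr0n /= addr0.
    by rewrite !exprS nsqM IH.
  have nV (x : C) : x != 0 -> nsq x^-1 = (nsq x)^-1.
    move=> x0; have n0 : nsq x != 0 by rewrite nsq_eq0.
    apply: (mulfI n0); rewrite -nsqM !divff //.
    by rewrite /nsq /= expr1n expr0n /= addr0.
  by rewrite nX nsqM nV // circ_nsq.
have lim : (fun m => 2 * (M * Num.sqrt (q ^+ m))) @ \oo --> 2 * (M * Num.sqrt 0).
  apply: cvgM; first exact: cvg_cst.
  apply: cvgM; first exact: cvg_cst.
  apply: (cont_cvg (@sqrt_continuous R 0)).
  exact: cvg_expr.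
have : `|G w| <= 0.
  rewrite sqrtr0 !mulr0 in lim.
  by apply: (@ler_cvg_to _ _ _ _ (fun=> `|G w|) _ _ _ (cvg_cst _) lim);
    apply: nearW.
by rewrite normr_le0 => /eqP.
Qed.

Lemma hol_shift (F : C -> C) (z a : C) : hol F (z + a) -> hol (fun w => F (w + a)) z.
Proof.
move=> h; apply: (@hol_comp R (fun w => w + a) F) => //.
by apply: holD; [exact: hol_id|exact: hol_cst].
Qed.

Lemma near_shift (P : C -> Prop) (z a : C) : (\forall w \near z, P (w + a)) ->
  \forall w \near z + a, P w.
Proof.
move=> h; have k : (fun w => w - a) @ nbhs (z + a) --> z.
  rewrite -[X in _ --> X](addrK a); apply: cvgB => //; exact: cvg_cst.
have k2 : \forall w \near z + a, P (w - a + a) := k _ h.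
by apply: filterS k2 => w; rewrite subrK.
Qed.

Lemma hol_order (F : C -> C) z : hol F z ->
  (\forall w \near z, F w = 0) \/
  exists m U, [/\ hol U z, U z != 0 & \forall w \near z, F w = (w - z) ^+ m * U w].
Proof.
move=> hF; have h0 : hol (fun w => F (w + z)) 0.
  by apply: hol_shift; rewrite add0r.
case: (hol_order0 h0) => [h|[m [U [hU U0 E]]]].
  by left; rewrite -[z]add0r; exact: near_shift.
right; exists m, (fun w => U (w - z)); split.
- by apply: hol_shift; rewrite subrr.
- by rewrite subrr.
- have key : \forall w \near 0 + z, F w = (w - z) ^+ m * U (w - z).
    by apply: near_shift; apply: filterS E => w; rewrite addrK.
  by rewrite add0r in key.
Qed.

End Order.

(** * Monodromy *)

Section ContOn.
Context {P X : topologicalType}.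
Implicit Types (K : set P) (f g : P -> X).

Definition cont_on K f := forall k, K k -> f @ within K (nbhs k) --> f k.

Lemma cont_onP K f : {within K, continuous f} <-> cont_on K f.
Proof. exact: subspace_continuousP. Qed.

Lemma within_near K (k : P) (A : set P) :
  within K (nbhs k) A -> \forall y \near k, K y -> A y.
Proof. by []. Qed.

Lemma nbhsS (k : P) (A B : set P) : nbhs k A -> (forall y, A y -> B y) -> nbhs k B.
Proof. by move=> nA AB; exact: filterS nA. Qed.

Lemma nbhsI (k : P) (A B : set P) :
  nbhs k A -> nbhs k B -> nbhs k (fun y => A y /\ B y).
Proof. by move=> nA nB; exact: filterI. Qed.

Lemma cont_onS K K' f : K' `<=` K -> cont_on K f -> cont_on K' f.
Proof.
move=> s c k Kk A nA.
have n : \forall y \near k, K y -> A (f y) := c k (s _ Kk) A nA.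
by apply: filterS n => y H Ky; apply: H; exact: s.
Qed.

Lemma cont_on_eq K f g : (forall k, K k -> f k = g k) -> cont_on K f -> cont_on K g.
Proof.
move=> e c k Kk A; rewrite -e // => nA.
have n : \forall y \near k, K y -> A (f y) := c k Kk A nA.
by apply: filterS n => y H Ky; change (A (g y)); rewrite -e //; exact: H.
Qed.

Lemma cont_on_glue K1 K2 f : closed K1 -> closed K2 -> cont_on K1 f ->
  cont_on K2 f -> cont_on (K1 `|` K2) f.
Proof.
move=> c1 c2 /cont_onP h1 /cont_onP h2. apply/cont_onP.
exact: withinU_continuous.
Qed.

End ContOn.

Lemma cont_on_comp (P Q X : topologicalType) (K : set P) (K' : set Q)
    (f : P -> X) (j : Q -> P) :
  cont_on K f -> cont_on K' j -> (forall k, K' k -> K (j k)) ->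
  cont_on K' (f \o j).
Proof.
move=> cf cj h k Kk A nA.
have n : \forall y \near k, K' y -> K (j y) -> A (f (j y)).
  exact: cj k Kk _ (cf _ (h _ Kk) A nA).
by apply: filterS n => y H Ky; apply: H => //; exact: h.
Qed.

Lemma cont_on_cont (P X : topologicalType) (K : set P) (f : P -> X) :
  (forall k, K k -> {for k, continuous f}) -> cont_on K f.
Proof. by move=> c k Kk; apply: cvg_within_filter; exact: c. Qed.

(* [Sec x s] says that the germ of [s] at [x] is a section of a covering space
   of [D], presented as its sheaf of local sections. *)
Record covering (R : realType) (X : normedModType R) (V : Type) (D : set X)
    (Sec : X -> (X -> V) -> Prop) : Prop := Covering {
  cov_eq : forall x s s', Sec x s -> (\forall y \near x, s y = s' y) -> Sec x s';
  cov_agree : forall x s s', Sec x s -> Sec x s' -> s x = s' x ->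
    \forall y \near x, s y = s' y;
  cov_differ : forall x s s', Sec x s -> Sec x s' -> s x <> s' x ->
    \forall y \near x, s y <> s' y;
  cov_extend : forall x, D x -> exists2 N, nbhs x N &
    forall y s0, N y -> Sec y s0 -> exists2 s, s y = s0 y & forall z, N z -> Sec z s
}.

Section Lifts.
Context {R : realType} {X : normedModType R} {V : Type}.
Variables (D : set X) (Sec : X -> (X -> V) -> Prop).
Hypothesis cov : covering D Sec.

(** [V] carries no topology: continuity of the lift [u] is expressed by local agreement with a
    section composed with [phi]. *)
Definition lift_on (P : topologicalType) (K : set P) (phi : P -> X) (u : P -> V) :=
  forall k, K k -> exists2 s, Sec (phi k) s &
    \forall k' \near within K (nbhs k), u k' = s (phi k').

Section OneParameterSpace.
Context {P : topologicalType}.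
Implicit Types (K : set P) (phi : P -> X) (u : P -> V).

Lemma lift_at K phi u k : lift_on K phi u -> K k ->
  exists s, [/\ Sec (phi k) s, u k = s (phi k) &
    \forall k' \near within K (nbhs k), u k' = s (phi k')].
Proof.
move=> L Kk; have [s h1 h2] := L k Kk; exists s; split => //.
by have := nbhs_singleton h2; apply.
Qed.

Lemma lift_onS K K' phi u : K' `<=` K -> lift_on K phi u -> lift_on K' phi u.
Proof.
move=> sK L k Kk; have [s h1 h2] := L k (sK _ Kk); exists s => //.
by apply: (nbhsS (within_near h2)) => y H /sK.
Qed.

(** The set where the two lifts agree is open in [K] by [cov_agree] and closed in [K] by
    [cov_differ]. *)
Lemma lift_unique K phi u u' k0 : connected K -> cont_on K phi ->
  lift_on K phi u -> lift_on K phi u' -> K k0 -> u k0 = u' k0 ->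
  forall k, K k -> u k = u' k.
Proof.
move=> cK cphi L L' Kk0 e0.
suff <- : [set k | K k /\ u k = u' k] = K by move=> k [].
apply: cK.
- by exists k0.
- exists (interior [set k | K k -> u k = u' k]); first exact: open_interior.
  apply/seteqP; split=> [k [Kk e]|k [Kk /interior_subset /(_ Kk)]] //; split=> //.
  have [s [h1 h2 h3]] := lift_at L Kk; have [s' [h1' h2' h3']] := lift_at L' Kk.
  have a : s (phi k) = s' (phi k) by rewrite -h2 -h2'.
  have n := cphi k Kk _ (cov_agree cov h1 h1' a).
  have nn := nbhsI (nbhsI (within_near h3) (within_near h3')) (within_near n).
  apply: (nbhsS (B := [set k | K k -> u k = u' k]) nn) => y H Ky.
  by have [[H1 H2] H3] := H; rewrite H1 // H2 //; exact: H3.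
- exists (~` interior [set k | K k -> u k <> u' k]).
    by apply: open_closedC; exact: open_interior.
  apply/seteqP; split=> [k [Kk e]|k [Kk h]]; split=> //.
    by move=> /interior_subset /(_ Kk).
  apply: contrapT => ne; apply: h.
  have [s [h1 h2 h3]] := lift_at L Kk; have [s' [h1' h2' h3']] := lift_at L' Kk.
  have a : s (phi k) <> s' (phi k) by rewrite -h2 -h2'.
  have n := cphi k Kk _ (cov_differ cov h1 h1' a).
  have nn := nbhsI (nbhsI (within_near h3) (within_near h3')) (within_near n).
  apply: (nbhsS (B := [set k | K k -> u k <> u' k]) nn) => y H Ky.
  by have [[H1 H2] H3] := H; rewrite H1 // H2 //; exact: H3.
Qed.

(** At a common point the two local sections have the same value, hence the same germ. At any other
    point the second closed set stays away from a neighbourhood. *)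
Lemma lift_glue K1 K2 phi u1 u2 : closed K1 -> closed K2 ->
  cont_on (K1 `|` K2) phi -> lift_on K1 phi u1 -> lift_on K2 phi u2 ->
  (forall k, K1 k -> K2 k -> u1 k = u2 k) ->
  lift_on (K1 `|` K2) phi (fun k => if pselect (K1 k) then u1 k else u2 k).
Proof.
move=> c1 c2 cphi L1 L2 e k Kk.
have far K : closed K -> ~ K k -> \forall k' \near k, ~ K k'.
  by move=> cK nK; apply: open_nbhs_nbhs; split => //; exact: closed_openC.
case: (pselect (K1 k)) => k1.
  have [s [h1 h2 h3]] := lift_at L1 k1; exists s => //.
  case: (pselect (K2 k)) => k2.
    have [s' [h1' h2' h3']] := lift_at L2 k2.
    have a : s (phi k) = s' (phi k) by rewrite -h2 -h2' e.
    have n := cphi k Kk _ (cov_agree cov h1 h1' a).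
    have nn := nbhsI (nbhsI (within_near h3) (within_near h3')) (within_near n).
    apply: (nbhsS nn) => y [[H1 H2] H3] Ky.
    case: pselect => [/H1 //|ny]; case: Ky (H3 Ky) => // Ky /= ->.
    exact: H2.
  have nn := nbhsI (within_near h3) (far _ c2 k2).
  apply: (nbhsS nn) => y [H1 H2] Ky.
  by case: pselect => [/H1 //|ny]; case: Ky.
case: Kk => // k2; have [s [h1 h2 h3]] := lift_at L2 k2; exists s => //.
have nn := nbhsI (within_near h3) (far _ c1 k1).
apply: (nbhsS nn) => y [H1 H2] Ky.
by case: pselect => // ny; case: Ky => // /H1.
Qed.

(** A constant function is a lift of a constant map, and lifts over a connected set are unique. *)
Lemma lift_const K phi u x : connected K -> (forall k, K k -> phi k = x) ->
  lift_on K phi u -> forall k k', K k -> K k' -> u k = u k'.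
Proof.
move=> cK px L k k' Kk Kk'.
have cphi : cont_on K phi.
  apply: (@cont_on_eq _ _ _ (fun=> x)) => [y /px //|].
  by move=> y Ky; exact: cvg_cst.
apply/esym; apply: (@lift_unique K phi u (fun=> u k) k) => // y Ky.
have [s [h1 h2 h3]] := lift_at L Kk; rewrite px // in h1; rewrite px // in h2.
exists s; first by rewrite px.
by apply: (@filterS _ (nbhs y) _ setT); [move=> z _ Kz; rewrite px|exact: filterT].
Qed.

Lemma lift_eq K phi phi' u : (forall k, K k -> phi k = phi' k) ->
  lift_on K phi u -> lift_on K phi' u.
Proof.
move=> e L k Kk; have [s [h1 h2 h3]] := lift_at L Kk.
exists s; first by rewrite -e.
by apply: (nbhsS (within_near h3)) => y H Ky; rewrite -e //; exact: H.
Qed.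

End OneParameterSpace.

Lemma lift_comp (P Q : topologicalType) (K : set P) (K' : set Q) phi u (j : Q -> P) :
  lift_on K phi u -> cont_on K' j -> (forall k, K' k -> K (j k)) ->
  lift_on K' (phi \o j) (u \o j).
Proof.
move=> L cj h k Kk; have [s h1 h2] := L _ (h _ Kk); exists s => //.
have nn := within_near (cj k Kk _ h2).
by apply: (nbhsS nn) => y H Ky; apply: H => //; exact: h.
Qed.

End Lifts.

(** * Convex sets and rectangles *)

Section Convex.
Context {R : realType} {W : normedModType R}.

Definition seg_convex (K : set W) := forall x y (t : R), K x -> K y ->
  0 <= t <= 1 -> K (x + t *: (y - x)).

Lemma seg_cont (x y : W) (t : R) : {for t, continuous (fun t : R => x + t *: (y - x))}.
Proof.
apply: cvgD; first exact: cvg_cst.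
by apply: cvgZr_tmp.
Qed.

Lemma convex_connected (K : set W) : seg_convex K -> connected K.
Proof.
move=> cK; case: (pselect (K !=set0)) => [[x Kx]|K0]; last first.
  suff -> : K = set0 by exact: connected0.
  by apply/seteqP; split => // y Ky; apply: K0; exists y.
pose S y := (fun t : R => x + t *: (y - x)) @` `[0, 1]%classic.
have -> : K = \bigcup_(y in K) S y.
  apply/seteqP; split=> [y Ky|_ [y Ky [t t01 <-]]].
    exists y => //; exists 1; first by rewrite /= in_itv /= ler01 lexx.
    by rewrite scale1r addrC subrK.
  by apply: cK => //; move: t01; rewrite /= in_itv.
apply: bigcup_connected.
  exists x => y Ky; exists 0; first by rewrite /= in_itv /= ler01 lexx.
  by rewrite scale0r addr0.
move=> y Ky; apply: connected_continuous_connected; first exact: segment_connected.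
by apply: continuous_subspaceT => t; exact: seg_cont.
Qed.

Lemma ball_convex (x : W) (r : R) : seg_convex (ball x r).
Proof.
move=> y z t; rewrite -!ball_normE /= => xy xz /andP[t0 t1].
have -> : x - (y + t *: (z - y)) = (1 - t) *: (x - y) + t *: (x - z).
  have -> : t *: (x - z) = t *: (x - y) - t *: (z - y).
    by rewrite -scalerBr opprB addrA subrK.
  by rewrite scalerBl scale1r addrA subrK opprD addrA.
have t2 : 0 <= 1 - t by rewrite subr_ge0.
apply: le_lt_trans (ler_normD _ _) _; rewrite !normrZ !ger0_norm //.
have a1 : (1 - t) * `|x - y| <= (1 - t) * Num.max `|x - y| `|x - z|.
  by rewrite ler_wpM2l // le_max lexx.
have a2 : t * `|x - z| <= t * Num.max `|x - y| `|x - z|.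
  by rewrite ler_wpM2l // le_max lexx orbT.
apply: le_lt_trans (lerD a1 a2) _; rewrite -mulrDl subrK mul1r.
by rewrite gt_max xy.
Qed.
End Convex.

Section Rectangles.
Context {R : realType}.

Definition rect (a b c d : R) : set (R * R) :=
  [set p | a <= p.1 <= b /\ c <= p.2 <= d].

Lemma rect_setX a b c d : rect a b c d = `[a, b]%classic `*` `[c, d]%classic.
Proof.
by apply/seteqP; split => -[x y]; rewrite /rect /= !in_itv.
Qed.

Lemma rect_compact a b c d : compact (rect a b c d).
Proof. by rewrite rect_setX; apply: compact_setX; exact: segment_compact. Qed.

Lemma rect_closed a b c d : closed (rect a b c d).
Proof.
by apply: (compact_closed (@norm_hausdorff R (R * R)%type)); exact: rect_compact.
Qed.

Lemma rect_connected a b c d : connected (rect a b c d).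
Proof.
apply: convex_connected => -[x y] [x' y'] t [/= /andP[h1 h2] /andP[h3 h4]].
move=> [/= /andP[h5 h6] /andP[h7 h8]] /andP[t0 t1].
have k (m n u v : R) : m <= u -> u <= n -> m <= v -> v <= n ->
    m <= u + t * (v - u) <= n.
  move=> *; apply/andP; split; nra.
by split; apply: k.
Qed.

End Rectangles.

(** * Lifting maps defined on the unit square *)

Section Monodromy.
Context {R : realType} {X : normedModType R} {V : Type}.
Variables (D : set X) (Sec : X -> (X -> V) -> Prop).
Hypothesis cov : covering D Sec.

(** The prescribed germ may sit over any point of [K], so that a lift known on one piece can be
    continued from any point shared with the next. *)
Definition liftable (P : topologicalType) (K : set P) (phi : P -> X) :=
  forall k0 s0, K k0 -> Sec (phi k0) s0 ->
    exists2 u, lift_on Sec K phi u & u k0 = s0 (phi k0).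

(** Lift over the piece containing the prescribed point, transport the germ at a common point to the
    other piece, and use uniqueness on the connected intersection to glue. *)
Lemma liftableU (P : topologicalType) (K1 K2 : set P) (phi : P -> X) :
  closed K1 -> closed K2 -> connected (K1 `&` K2) -> K1 `&` K2 !=set0 ->
  cont_on (K1 `|` K2) phi -> liftable K1 phi -> liftable K2 phi ->
  liftable (K1 `|` K2) phi.
Proof.
move=> c1 c2 c12 [k [k1 k2]] cphi L1 L2.
have main (K K' : set P) k0 s0 : closed K -> closed K' -> connected (K `&` K') ->
    K k -> K' k -> cont_on (K `|` K') phi -> liftable K phi -> liftable K' phi ->
    K k0 -> Sec (phi k0) s0 ->
    exists2 u, lift_on Sec (K `|` K') phi u & u k0 = s0 (phi k0).
  move=> {}c1 {}c2 {}c12 {}k1 {}k2 {}cphi {}L1 {}L2 Kk0 Ss0.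
  have [u1 l1 e1] := L1 k0 s0 Kk0 Ss0.
  have [s [hs es _]] := lift_at l1 k1.
  have [u2 l2 e2] := L2 k s k2 hs.
  have agree x : K x -> K' x -> u1 x = u2 x.
    move=> Kx K'x.
    apply: (@lift_unique R X V D Sec cov P (K `&` K') phi u1 u2 k) => //.
    - by apply: cont_onS cphi => y []; left.
    - exact: lift_onS l1.
    - exact: lift_onS l2.
    - by rewrite es e2.
  exists (fun x => if pselect (K x) then u1 x else u2 x).
    exact: (lift_glue cov).
  by case: pselect.
move=> k0 s0 [Kk0|Kk0] Ss0; first exact: main.
by rewrite setUC; apply: main => //; rewrite setIC || rewrite setUC.
Qed.

Lemma liftable_small (P : topologicalType) (K : set P) (phi : P -> X) x N :
  D x -> cont_on K phi -> (forall k, K k -> N (phi k)) ->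
  (forall y s0, N y -> Sec y s0 -> exists2 s, s y = s0 y & forall z, N z -> Sec z s) ->
  liftable K phi.
Proof.
move=> Dx cphi KN H k0 s0 Kk0 S0; have [s e Ss] := H _ _ (KN _ Kk0) S0.
exists (s \o phi) => // k Kk; exists s; first exact/Ss/KN.
by apply: (nbhsS (filterT : nbhs k setT)).
Qed.

(** A Lebesgue number of the square: rectangles with sides at most [d] are mapped into a single
    evenly covered neighbourhood. *)
Lemma lebesgue_rect (phi : R * R -> X) : cont_on (rect 0 1 0 1) phi ->
  (forall p, rect 0 1 0 1 p -> D (phi p)) ->
  exists2 d : R, 0 < d & forall a b c e, b - a <= d -> e - c <= d ->
    rect a b c e `<=` rect 0 1 0 1 -> liftable (rect a b c e) phi.
Proof.
move=> cphi Dphi.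
pose Pr (d : R) (p : R * R) := forall a b c e : R,
    rect a b c e p -> b - a <= d -> e - c <= d -> rect a b c e `<=` rect 0 1 0 1 ->
    liftable (rect a b c e) phi.
have K : \forall d \near (0 : R), rect 0 1 0 1 `<=` Pr d.
  have /compact_near_coveringP nc := @rect_compact R 0 1 0 1.
  apply: (nc R (nbhs (0 : R)) Pr _).
  move=> p Qp; have [N nN HN] := cov_extend cov (Dphi _ Qp).
  have /nbhs_ballP [r /= r0 H] := within_near (cphi p Qp _ nN).
  have nb : \forall p' \near p, ball p (r / 2) p'.
    by apply: nbhsx_ballx; rewrite divr_gt0.
  have n0 : \forall d \near (0 : R), d < r / 2.
    by apply: (@cvgr_lt _ _ (nbhs (0 : R)) _ id 0 cvg_id); rewrite divr_gt0.
  exists (ball p (r / 2), [set d | d < r / 2]); first by split.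
  move=> [[x y] d] /= [[b1 b2] dr] a b c e [/= /andP[x1 x2] /andP[y1 y2]] ba ec sub.
  apply: (@liftable_small _ _ _ (phi p) N) => //; first exact: Dphi.
    exact: cont_onS cphi.
  move=> [x' y'] Rk; apply: H => //; last exact: sub.
  case: Rk => /= /andP[x3 x4] /andP[y3 y4].
  move: b1 b2; rewrite /ball /= !ltr_distlC => /andP[? ?] /andP[? ?].
  by split; rewrite /ball /= ltr_distlC; apply/andP; split; lra.
have /nbhs_ballP [d /= d0 H] := K.
exists (d / 2); first by rewrite divr_gt0.
move=> a b c e ba ec sub k0 s0 Rk0.
have bd : ball (0 : R) d (d / 2) by rewrite /ball /= sub0r normrN ger0_norm; lra.
exact: (H _ bd _ (sub _ Rk0) a b c e).
Qed.

(** Small rectangles are assembled by bisection, first in width and then in height, so that two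
    pieces always meet in one segment, which is connected. Each bisection doubles the size
    allowed. *)
Lemma liftable_square (phi : R * R -> X) : cont_on (rect 0 1 0 1) phi ->
  (forall p, rect 0 1 0 1 p -> D (phi p)) -> liftable (rect 0 1 0 1) phi.
Proof.
move=> cphi Dphi; have [d d0 small] := lebesgue_rect cphi Dphi.
have step1 n : forall a b c e, b - a <= d * 2 ^+ n -> e - c <= d ->
    rect a b c e `<=` rect 0 1 0 1 -> liftable (rect a b c e) phi.
  elim: n => [|n IH] a b c e ba ec sub; first by apply: small; rewrite ?expr0 ?mulr1 in ba *.
  case: (pselect (rect a b c e !=set0)) => [[[x0 y0] [/= /andP[a0 b0] /andP[c0 e0]]]|ne];
    last by move=> k0 s0 Rk0; case: ne; exists k0.
  pose m := (a + b) / 2.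
  have E : rect a b c e = rect a m c e `|` rect m b c e.
    apply/seteqP; split=> [[x y] [/= /andP[x1 x2] y1]|[x y] [|] [/= /andP[x1 x2] y1]].
    - case: (leP x m) => xm; [left|right]; split=> //=; apply/andP; split=> //.
      exact: ltW.
    - by split=> //=; rewrite x1 /=; rewrite /m in x2; lra.
    - by split=> //=; rewrite x2 andbT; rewrite /m in x1; lra.
  have I : rect a m c e `&` rect m b c e = rect m m c e.
    apply/seteqP; split=> [[x y] [[/= /andP[x1 x2] y1] [/= /andP[x3 x4] _]]|].
      by split=> //=; rewrite x3.
    move=> [x y] [/= /andP[x1 x2] y1]; rewrite /m in x1 x2.
    by split; split=> //=; rewrite /m; apply/andP; split; lra.
  rewrite exprS in ba; rewrite E in sub *; apply: liftableU.
  - exact: rect_closed.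
  - exact: rect_closed.
  - by rewrite I; exact: rect_connected.
  - by rewrite I; exists (m, c); split=> /=; rewrite !lexx //= ; lra.
  - exact: cont_onS cphi.
  - by apply: IH => //; [rewrite /m; lra|move=> p h; apply: sub; left].
  - by apply: IH => //; [rewrite /m; lra|move=> p h; apply: sub; right].
have step2 n m : forall a b c e, b - a <= d * 2 ^+ n -> e - c <= d * 2 ^+ m ->
    rect a b c e `<=` rect 0 1 0 1 -> liftable (rect a b c e) phi.
  elim: m => [|m IH] a b c e ba ec sub.
    by apply: (step1 n) => //; rewrite expr0 mulr1 in ec.
  case: (pselect (rect a b c e !=set0)) => [[[x0 y0] [/= /andP[a0 b0] /andP[c0 e0]]]|ne];
    last by move=> k0 s0 Rk0; case: ne; exists k0.
  pose l := (c + e) / 2.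
  have E : rect a b c e = rect a b c l `|` rect a b l e.
    apply/seteqP; split=> [[x y] [/= x1 /andP[y1 y2]]|[x y] [|] [/= x1 /andP[y1 y2]]].
    - case: (leP y l) => xm; [left|right]; split=> //=; apply/andP; split=> //.
      exact: ltW.
    - by split=> //=; rewrite y1 /=; rewrite /l in y2; lra.
    - by split=> //=; rewrite y2 andbT; rewrite /l in y1; lra.
  have I : rect a b c l `&` rect a b l e = rect a b l l.
    apply/seteqP; split=> [[x y] [[/= x1 /andP[y1 y2]] [/= _ /andP[y3 y4]]]|].
      by split=> //=; rewrite y3.
    move=> [x y] [/= x1 /andP[y1 y2]]; rewrite /l in y1 y2.
    by split; split=> //=; rewrite /l; apply/andP; split; lra.
  rewrite exprS in ec; rewrite E in sub *; apply: liftableU.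
  - exact: rect_closed.
  - exact: rect_closed.
  - by rewrite I; exact: rect_connected.
  - by rewrite I; exists (a, l); split=> /=; rewrite !lexx //= ?andbT; lra.
  - exact: cont_onS cphi.
  - by apply: IH => //; [rewrite /l; lra|move=> p h; apply: sub; left].
  - by apply: IH => //; [rewrite /l; lra|move=> p h; apply: sub; right].
have [n dn] : exists n, 1 <= d * 2 ^+ n.
  have [n hn] : exists n : nat, d^-1 < n%:R.
    by exists (Num.truncn d^-1).+1; exact: truncnS_gt.
  exists n; rewrite mulrC -ler_pdivrMr // div1r; apply: le_trans (ltW hn) _.
  by rewrite -natrX ler_nat; apply: ltnW; exact: ltn_expl.
by apply: (step2 n n) => //; rewrite subr0.
Qed.

End Monodromy.

(** * Continuation along paths and the monodromy theorem *)

Section MonodromyTheorem.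
Context {R : realType} {X : normedModType R} {V : Type}.
Variables (D : set X) (Sec : X -> (X -> V) -> Prop).
Hypothesis cov : covering D Sec.

Local Notation I01 := (`[0 : R, 1 : R]%classic).

Lemma I01P (t : R) : I01 t <-> 0 <= t <= 1.
Proof. by rewrite /= in_itv. Qed.

Lemma zero_I01 : I01 0. Proof. by apply/I01P; rewrite lexx ler01. Qed.
Lemma one_I01 : I01 1. Proof. by apply/I01P; rewrite lexx ler01. Qed.

(** A path is treated as a map of the square that ignores the first coordinate. *)
Lemma path_lift (c : R -> X) s0 : path_in D c -> Sec (c 0) s0 ->
  exists2 u, lift_on Sec I01 c u & u 0 = s0 (c 0).
Proof.
move=> [/cont_onP cc Dc] S0; pose phi (p : R * R) := c p.2.
have cphi : cont_on (rect 0 1 0 1) phi.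
  apply: (@cont_on_comp _ _ _ I01) => //.
    by apply: cont_on_cont => p _; exact: cvg_snd.
  by move=> p [_ h]; apply/I01P.
have Dphi p : rect 0 1 0 1 p -> D (phi p) by move=> [_ h]; apply/Dc/I01P.
have R0 : rect 0 1 0 1 ((0 : R), (0 : R)) by split; rewrite /= lexx ler01.
have [u L e] := liftable_square cov cphi Dphi R0 S0.
exists (fun t => u (0, t)) => //.
apply: (@lift_comp _ _ _ _ _ _ (rect 0 1 0 1) I01 phi u (fun t => (0, t))) => //.
  by apply: cont_on_cont => t _; apply: cvg_pair_pt; [exact: cvg_cst|exact: cvg_id].
by move=> t /I01P h; split; rewrite //= lexx ler01.
Qed.

Lemma path_lift_unique (c : R -> X) u u' t0 : path_in D c ->
  lift_on Sec I01 c u -> lift_on Sec I01 c u' -> I01 t0 -> u t0 = u' t0 ->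
  forall t, I01 t -> u t = u' t.
Proof.
move=> [/cont_onP cc Dc] L L' It0 e; apply: (lift_unique cov _ cc L L' It0 e).
exact: segment_connected.
Qed.

(** Lift the homotopy to the square. On three sides it is constant, hence so is its lift; these
    sides join the two ends of the fourth, over which the lift is [u]. *)
Lemma closed_path_lift (c : R -> X) u : path_in D c -> null_homotopic_in D c ->
  c 0 = c 1 -> lift_on Sec I01 c u -> u 0 = u 1.
Proof.
move=> pc [h [ch Dh h0 h1 hs]] c01 L.
have Q0 : rect 0 1 0 1 ((0 : R), (0 : R)) by split; rewrite /= lexx ler01.
have [s0 [S0 e0 _]] := lift_at L zero_I01.
have cphi : cont_on (rect 0 1 0 1) h by rewrite rect_setX; exact/cont_onP.
have Dphi p : rect 0 1 0 1 p -> D (h p).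
  by case: p => s t [a b]; apply: Dh; apply/I01P.
have h00 : h (0, 0) = c 0 by apply: h0; exact: zero_I01.
have S0' : Sec (h (0, 0)) s0 by rewrite h00.
have [w Lw ew] := liftable_square cov cphi Dphi Q0 S0'.
have left_edge t : I01 t -> w (0, t) = u t.
  have L' : lift_on Sec I01 c (fun t => w (0, t)).
    apply: (@lift_eq _ _ _ _ _ _ (fun t => h (0, t))) => //.
    apply: (@lift_comp _ _ _ _ _ _ (rect 0 1 0 1) I01 h w (fun t => (0, t))) => //.
      by apply: cont_on_cont => k _; apply: cvg_pair_pt; [exact: cvg_cst|exact: cvg_id].
    by move=> k /I01P hk; split; rewrite //= lexx ler01.
  apply: (path_lift_unique pc L' L zero_I01).
  by rewrite ew h00 e0.
have const_edge (j : R -> R * R) : (forall t, I01 t -> rect 0 1 0 1 (j t)) ->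
    continuous j -> (forall t, I01 t -> h (j t) = c 0) -> w (j 0) = w (j 1).
  move=> jQ cj hj.
  have L' : lift_on Sec I01 (h \o j) (w \o j).
    by apply: (lift_comp Lw) => //; apply: cont_on_cont => k _; exact: cj.
  apply: (lift_const cov _ hj L'); [exact: segment_connected| |].
    exact: zero_I01.
  exact: one_I01.
have E1 : w (0, 0) = w (1, 0).
  apply: (const_edge (fun t => (t, 0))).
  - by move=> t /I01P ht; split; rewrite //= lexx ler01.
  - by move=> t; apply: cvg_pair_pt; [exact: cvg_id|exact: cvg_cst].
  - by move=> t /hs [].
have E2 : w (1, 0) = w (1, 1).
  apply: (const_edge (fun t => (1, t))).
  - by move=> t /I01P ht; split; rewrite //= lexx ler01.
  - by move=> t; apply: cvg_pair_pt; [exact: cvg_cst|exact: cvg_id].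
  - by move=> t /h1.
have E3 : w (0, 1) = w (1, 1).
  apply: (const_edge (fun t => (t, 1))).
  - by move=> t /I01P ht; split; rewrite //= lexx ler01.
  - by move=> t; apply: cvg_pair_pt; [exact: cvg_id|exact: cvg_cst].
  - by move=> t /hs [].
rewrite -left_edge; last exact: zero_I01.
rewrite -left_edge; last exact: one_I01.
by rewrite E1 E2 E3.
Qed.

Local Notation Ha := (`[0 : R, 1 / 2 : R]%classic : set R).
Local Notation Hb := (`[1 / 2 : R, 1 : R]%classic : set R).

Definition paste (T : Type) (f g : R -> T) (t : R) : T :=
  if t <= 1 / 2 then f (2 * t) else g (2 * t - 1).

Lemma I01_halves : I01 = Ha `|` Hb.
Proof.
apply/seteqP; split=> [t|t [|]]; rewrite /= !in_itv /= => /andP[a b].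
- by case: (leP t (1 / 2)) => h; [left|right]; rewrite ?a ?b ?h ?(ltW h).
- by rewrite a /=; lra.
- by rewrite b andbT; lra.
Qed.

Lemma half1 (t : R) : Ha t -> I01 (2 * t).
Proof. by rewrite /= !in_itv /=; lra. Qed.
Lemma half2 (t : R) : Hb t -> I01 (2 * t - 1).
Proof. by rewrite /= !in_itv /=; lra. Qed.

Lemma paste_left T (f g : R -> T) t : Ha t -> paste f g t = f (2 * t).
Proof. by rewrite /= in_itv /paste /= => /andP[_ ->]. Qed.
Lemma paste_right T (f g : R -> T) t : f 1 = g 0 -> Hb t ->
  paste f g t = g (2 * t - 1).
Proof.
move=> e; rewrite /= in_itv /paste /= => /andP[h _]; case: (leP t (1 / 2)) => // h'.
have -> : t = 1 / 2 by apply/eqP; rewrite eq_le h h'.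
by have -> : 2 * (1 / 2) = 1 :> R by [field]; rewrite subrr.
Qed.

Lemma double_cont : continuous (fun t : R => 2 * t).
Proof. by move=> t; apply: cvgM => //; exact: cvg_cst. Qed.
Lemma double_cont1 : continuous (fun t : R => 2 * t - 1).
Proof. by move=> t; apply: cvgB; [exact: double_cont|exact: cvg_cst]. Qed.

Lemma paste_cont (f g : R -> X) : f 1 = g 0 -> cont_on I01 f -> cont_on I01 g ->
  cont_on I01 (paste f g).
Proof.
move=> e cf cg; rewrite I01_halves; apply: cont_on_glue; try exact: interval_closed.
  apply: (@cont_on_eq _ _ _ (f \o (fun t => 2 * t))).
    by move=> t h; rewrite paste_left.
  apply: (cont_on_comp cf); last exact: half1.
  by apply: cont_on_cont => t _; exact: double_cont.
apply: (@cont_on_eq _ _ _ (g \o (fun t => 2 * t - 1))).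
  by move=> t h; rewrite paste_right.
apply: (cont_on_comp cg); last exact: half2.
by apply: cont_on_cont => t _; exact: double_cont1.
Qed.

Lemma paste_in (f g : R -> X) : (forall t, I01 t -> D (f t)) ->
  (forall t, I01 t -> D (g t)) -> f 1 = g 0 -> forall t, I01 t -> D (paste f g t).
Proof.
move=> Df Dg e t; rewrite I01_halves => -[h|h].
  by rewrite paste_left //; apply/Df/half1.
by rewrite paste_right //; apply/Dg/half2.
Qed.

Lemma paste_lift (f g : R -> X) u v : f 1 = g 0 -> cont_on I01 f -> cont_on I01 g ->
  lift_on Sec I01 f u -> lift_on Sec I01 g v -> u 1 = v 0 ->
  lift_on Sec I01 (paste f g) (paste u v).
Proof.
move=> e cf cg Lf Lg euv; have cp := paste_cont e cf cg.
rewrite I01_halves in cp *.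
have L1 : lift_on Sec Ha (paste f g) (fun t => u (2 * t)).
  apply: (@lift_eq _ _ _ _ _ _ (f \o (fun t => 2 * t))).
    by move=> t h; rewrite paste_left.
  apply: (lift_comp Lf); last exact: half1.
  by apply: cont_on_cont => t _; exact: double_cont.
have L2 : lift_on Sec Hb (paste f g) (fun t => v (2 * t - 1)).
  apply: (@lift_eq _ _ _ _ _ _ (g \o (fun t => 2 * t - 1))).
    by move=> t h; rewrite paste_right.
  apply: (lift_comp Lg); last exact: half2.
  by apply: cont_on_cont => t _; exact: double_cont1.
have agree t : Ha t -> Hb t ->
    u (2 * t) = v (2 * t - 1).
  by move=> h h'; rewrite -(paste_left u v h) paste_right.
have := lift_glue cov _ _ cp L1 L2 agree.
move=> G k Kk; have [||s h1 h2] := G _ _ k Kk; try exact: interval_closed.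
exists s => //; apply: (nbhsS (within_near h2)) => t H Kt; rewrite -H //.
case: pselect => [h|nh]; first by rewrite paste_left.
by case: Kt => // h; rewrite paste_right.
Qed.

Lemma rev_path (c : R -> X) : path_in D c -> path_in D (fun t => c (1 - t)).
Proof.
move=> [/cont_onP cc Dc]; have h (t : R) : I01 t -> I01 (1 - t).
  by move=> /I01P ?; apply/I01P; lra.
split; last by move=> t /h /Dc.
apply/cont_onP; apply: (cont_on_comp cc _ h).
by apply: cont_on_cont => t _; apply: cvgB => //; exact: cvg_cst.
Qed.

Definition continues (x0 : X) (v0 : V) (x : X) (v : V) : Prop :=
  exists c u, [/\ path_in D c, c 0 = x0, c 1 = x, lift_on Sec I01 c u &
    u 0 = v0 /\ u 1 = v].

(** The first path followed by the reverse of the second is a loop, whose lift closes up. The two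
    continuations then meet at the midpoint of that lift. *)
Lemma continues_unique x0 v0 x v v' : simply_connected (R := R) D ->
  continues x0 v0 x v -> continues x0 v0 x v' -> v = v'.
Proof.
move=> [_ sc] [c1 [u1 [p1 a1 b1 L1 [e1 f1]]]] [c2 [u2 [p2 a2 b2 L2 [e2 f2]]]].
have p2' := rev_path p2; pose c2' t := c2 (1 - t).
have [/cont_onP k1 D1] := p1; have [/cont_onP k2 D2] := p2'.
have e : c1 1 = c2' 0 by rewrite /c2' subr0 b1 b2.
pose c := paste c1 c2'.
have half0 : Ha 0 by rewrite /= in_itv /=; lra.
have halfa : Ha (1 / 2) by rewrite /= in_itv /=; lra.
have halfb : Hb (1 / 2) by rewrite /= in_itv /=; lra.
have halfc : Hb 1 by rewrite /= in_itv /=; lra.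
have pc : path_in D c.
  by split; [apply/cont_onP; exact: paste_cont|exact: paste_in].
have c0 : c 0 = x0 by rewrite /c paste_left // mulr0.
have c1' : c 1 = x0 by rewrite /c paste_right // /c2'; rewrite (_ : 1 - _ = 0) //; lra.
have [s0 [S0 es0 _]] := lift_at L1 zero_I01.
have S0' : Sec (c 0) s0 by rewrite c0 -a1.
have [u Lu eu] := path_lift pc S0'.
have u0 : u 0 = v0 by rewrite eu c0 -a1 -es0.
have u01 : u 0 = u 1.
  by apply: (closed_path_lift pc _ _ Lu); rewrite ?c0 ?c1' //; apply: sc; rewrite ?c0 ?c1'.
(* The two halves of the lift are compared with [u1] and [u2]; the second half is read backwards
   from [u 1 = u 0 = v0]. *)
have U1 t : I01 t -> u (1 / 2 * t) = u1 t.
  have h (s : R) : I01 s -> Ha (1 / 2 * s).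
    by move=> /I01P; rewrite /= in_itv /=; lra.
  have L : lift_on Sec I01 c1 (fun t => u (1 / 2 * t)).
    apply: (@lift_eq _ _ _ _ _ _ (c \o (fun t => 1 / 2 * t))).
      move=> s /h hs; rewrite /c /= paste_left //; congr c1.
      by field.
    apply: (lift_comp Lu).
      by apply: cont_on_cont => s _; apply: cvgM => //; exact: cvg_cst.
    by move=> s /h; rewrite I01_halves; left.
  by apply: (path_lift_unique p1 L L1 zero_I01); rewrite mulr0 u0 e1.
have U2 t : I01 t -> u (1 - 1 / 2 * t) = u2 t.
  have h (s : R) : I01 s -> Hb (1 - 1 / 2 * s).
    by move=> /I01P; rewrite /= in_itv /=; lra.
  have L : lift_on Sec I01 c2 (fun t => u (1 - 1 / 2 * t)).
    apply: (@lift_eq _ _ _ _ _ _ (c \o (fun t => 1 - 1 / 2 * t))).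
      move=> s /h hs; rewrite /c /= paste_right // /c2'; congr c2.
      by field.
    apply: (lift_comp Lu).
      apply: cont_on_cont => s _; apply: cvgB; first exact: cvg_cst.
      by apply: cvgM => //; exact: cvg_cst.
    by move=> s /h; rewrite I01_halves; right.
  by apply: (path_lift_unique p2 L L2 zero_I01); rewrite mulr0 subr0 -u01 u0 e2.
rewrite -f1 -f2 -(U1 1 one_I01) -(U2 1 one_I01); congr u; lra.
Qed.

(** A path ending at [x] is prolonged by the segment to [y], along which the values of [s] form a
    lift. *)
Lemma continues_section x0 v0 x v s N : continues x0 v0 x v -> Sec x s -> s x = v ->
  seg_convex N -> N `<=` D -> N x -> (forall z, N z -> Sec z s) ->
  forall y, N y -> continues x0 v0 y (s y).
Proof.
move=> [c [u [pc c0 c1 L [u0 u1]]]] Sx sx cN ND Nx HN y Ny.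
pose l (t : R) := x + t *: (y - x).
have lN t : I01 t -> N (l t) by move=> /I01P h; exact: cN.
have cl : cont_on I01 l by apply: cont_on_cont => t _; exact: seg_cont.
have l0 : l 0 = x by rewrite /l scale0r addr0.
have l1 : l 1 = y by rewrite /l scale1r addrC subrK.
have Ll : lift_on Sec I01 l (s \o l).
  move=> t It; exists s; first exact/HN/lN.
  by apply: (nbhsS (filterT : nbhs t setT)).
have e : c 1 = l 0 by rewrite l0.
have half0 : Ha 0 by rewrite /= in_itv /=; lra.
have halfc : Hb 1 by rewrite /= in_itv /=; lra.
have [/cont_onP cc Dc] := pc.
have two1 : 2 * 1 - 1 = 1 :> R by lra.
exists (paste c l), (paste u (s \o l)); split.
- split; first by apply/cont_onP; exact: paste_cont.
  by apply: paste_in => // t /lN /ND.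
- by rewrite paste_left // mulr0.
- by rewrite paste_right // two1.
- by apply: paste_lift => //; rewrite u1 /= l0.
- split; first by rewrite paste_left // mulr0.
  by rewrite paste_right //= ?two1 ?l1 // l0 u1.
Qed.

Lemma monodromy x0 s0 : open D -> simply_connected (R := R) D -> D x0 ->
  Sec x0 s0 -> exists2 T, T x0 = s0 x0 & forall x, D x -> Sec x T.
Proof.
move=> oD sc Dx0 S0; have [pcD _] := sc.
have ex x : D x -> exists v, continues x0 (s0 x0) x v.
  move=> Dx; have [c [pc c0 c1]] := pcD x0 x Dx0 Dx.
  have S0' : Sec (c 0) s0 by rewrite c0.
  have [u L u0] := path_lift pc S0'.
  by exists (u 1), c, u; split => //; rewrite u0 c0.
(* [T x] is the value obtained by continuation to [x]; outside [D] it is a mere default. *)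
pose T x := if pselect (D x) is left Dx then sval (cid (ex x Dx)) else s0 x0.
have TP x : D x -> continues x0 (s0 x0) x (T x).
  by move=> Dx; rewrite /T; case: pselect => // Dx'; case: cid.
exists T.
  apply: (continues_unique sc (TP x0 Dx0)).
  exists (fun=> x0), (fun=> s0 x0); split => //.
    by split => //; apply: continuous_subspaceT => t; exact: cvg_cst.
  move=> t It; exists s0 => //.
  by apply: (nbhsS (filterT : nbhs t setT)).
move=> x Dx; have [N nN HN] := cov_extend cov Dx.
have [c [u [pc c0 c1 L [u0 u1]]]] := TP x Dx.
have [s' [S' es' _]] := lift_at L one_I01; rewrite c1 in S' es'.
have [s es Ss] := HN x s' (nbhs_singleton nN) S'.
have nD : nbhs x D by apply: open_nbhs_nbhs.
(* The evenly covered neighbourhood is shrunk to a ball inside [D]. Prolonging the path to [x] by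
   radii shows that [T] equals the section [s] on the ball. *)
have /nbhs_ballP [r /= r0 H] := nbhsI nN nD.
have Bx : ball x r x by exact: ballxx.
have Sx : Sec x s by apply: Ss; case: (H x Bx).
apply: (cov_eq cov Sx).
have nb : nbhs x (ball x r) by exact: nbhsx_ballx.
apply: (nbhsS nb) => y By.
apply: (@continues_unique x0 (s0 x0) y) => //; last by apply: TP; case: (H y By).
apply: (@continues_section _ _ x (T x) s (ball x r)) => //.
- exact: TP.
- by rewrite es -es' u1.
- exact: ball_convex.
- by move=> z /H [].
- by move=> z /H [] /Ss.
Qed.

Lemma section_unique T T' x0 : path_connected (R := R) D ->
  (forall x, D x -> Sec x T) -> (forall x, D x -> Sec x T') ->
  D x0 -> T x0 = T' x0 -> forall x, D x -> T x = T' x.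
Proof.
move=> pcD ST ST' Dx0 e x Dx; have [c [pc c0 c1]] := pcD x0 x Dx0 Dx.
have [_ Dc] := pc.
have L S : (forall x, D x -> Sec x S) -> lift_on Sec I01 c (S \o c).
  move=> HS t It; exists S; first exact/HS/Dc.
  by apply: (nbhsS (filterT : nbhs t setT)).
have := path_lift_unique pc (L _ ST) (L _ ST') zero_I01.
rewrite /= c0 => /(_ e 1 one_I01).
by rewrite c1.
Qed.

End MonodromyTheorem.

(** * Logarithms and directions on simply connected domains *)

Lemma near_re_gt0 (R : realType) (f : cplx R -> cplx R) y :
  {for y, continuous f} -> 0 < (f y).1 -> \forall z \near y, 0 < (f z).1.
Proof.
move=> c p; have k : (fst \o f) @ nbhs y --> (f y).1 by apply: cvg_re.
by apply: (cvgr_gt _ k).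
Qed.

Section LogCovering.
Context {R : realType}.
Local Notation C := (cplx R).
Variables (D : set C) (h : C -> C).
Hypothesis oD : open D.
Hypothesis hh : forall x, D x -> hol h x.
Hypothesis h0 : forall x, D x -> h x != 0.

Definition log_germ (x : C) (A : C -> C) : Prop :=
  [/\ D x, hol A x & \forall y \near x, cexp (A y) = h y].

Lemma near_domain x : D x -> \forall y \near x, D y.
Proof. by move=> Dx; apply: open_nbhs_nbhs. Qed.

(** Two logarithms of [h] differ by a continuous function with values in the periods, so a
    difference vanishing at [x] vanishes nearby. *)
Lemma log_covering : covering D log_germ.
Proof.
split.
- move=> x s s' [Dx hs es] e; split => //; first exact: hol_eq e hs.
  by near=> y; rewrite -(near e y) //; near: y.
- move=> x s s' [Dx hs es] [_ hs' es'] e.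
  have c : {for x, continuous (fun y => s y - s' y)}.
    by apply: cvgB; exact: hol_cont.
  have n : \forall y \near x, `|s y - s' y| < 1.
    have n : \forall y \near x, `|s x - s' x - (s y - s' y)| < 1.
      exact: (cvgr_dist_lt _ _ c _ ltr01).
    by apply: filterS n => y; rewrite e subrr sub0r normrN.
  near=> y; apply/eqP; rewrite -subr_eq0; apply/eqP/cexp_eq1; first by near: y.
  rewrite cexpD cexpN (near es y) // (near es' y) // divff //.
  by rewrite -(near es y) // cexp_neq0.
- move=> x s s' [Dx hs es] [_ hs' es'] e.
  have c : {for x, continuous (fun y => s y - s' y)}.
    by apply: cvgB; exact: hol_cont.
  have n0 : s x - s' x != 0 by rewrite subr_eq0; apply/eqP.
  have n : \forall y \near x, s y - s' y != 0 by exact: (cvgr_neq0 _ c n0).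
  by apply: filterS n => y; rewrite subr_eq0 => /eqP.
- move=> x Dx; pose N := [set y | D y /\ 0 < (h y / h x).1].
  have nN y : N y -> nbhs y N.
    move=> [Dy py]; have c : {for y, continuous (fun z => h z / h x)}.
      by apply: ccvgM; [exact/hol_cont/hh|exact: cvg_cst].
    have n := near_re_gt0 c py.
    exact: nbhsI (near_domain Dy) n.
  have Nx : N x by split => //; rewrite divff ?h0 //= ltr01.
  exists N; first exact: nN.
  move=> y s0 Ny [Dy hs0 es0].
  (* For [y] and [z] in [N] the quotient [h z / h y] may leave the right half-plane, so the passage
     from [y] to [z] goes through [h x]. *)
  exists (fun z => s0 y - clog (h y / h x) + clog (h z / h x)); first by rewrite subrK.
  move=> z Nz; have [Dz pz] := Nz; split => //.
    apply: holD; first exact: hol_cst.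
    apply: (@hol_comp R (fun z => h z / h x) clog); last exact: hol_clog.
    by apply: holM; [exact: hh|exact: hol_cst].
  have := nN z Nz; apply: filterS => z' [Dz' pz']; have [_ py] := Ny.
  rewrite !cexpD cexpN !cexp_clog // (nbhs_singleton es0).
  by field; rewrite !h0.
Unshelve. all: by end_near. Qed.

Lemma hol_log : simply_connected (R := R) D -> D !=set0 ->
  exists A, forall x, D x -> hol A x /\ cexp (A x) = h x.
Proof.
move=> sc [x0 Dx0]; have [N nN HN] := cov_extend log_covering Dx0.
have [a ea] := cexp_surj (h0 Dx0).
pose s0 z := a + clog (h z / h x0).
have S0 : log_germ x0 s0.
  have c : {for x0, continuous (fun z => h z / h x0)}.
    by apply: ccvgM; [exact/hol_cont/hh|exact: cvg_cst].
  have p1 : 0 < (h x0 / h x0).1 by rewrite divff ?h0 //= ltr01.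
  split => //.
    apply: holD; first exact: hol_cst.
    apply: (@hol_comp R (fun z => h z / h x0) clog); last exact: hol_clog.
    by apply: holM; [exact: hh|exact: hol_cst].
  have n := near_re_gt0 c p1.
  apply: filterS n => z pz; rewrite /s0 cexpD cexp_clog // ea.
  by field; rewrite h0.
have [A _ HA] := monodromy log_covering oD sc Dx0 S0.
by exists A => x /HA [_ hA /nbhs_singleton].
Qed.

End LogCovering.

(** * Directions of a holomorphic vector *)

Section Directions.
Context {R : realType}.
Local Notation C := (cplx R).
Local Notation C3 := (C * C * C)%type.
Implicit Types (u v w : C3).

Definition dot3 u v : C := u.1.1 * v.1.1 + u.1.2 * v.1.2 + u.2 * v.2.
(** Vanishing of the cross product. Unlike proportionality this is visibly a closed condition, and
    it is meaningful where [c] vanishes. *)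
Definition par3 u v : Prop :=
  [/\ u.1.1 * v.1.2 = u.1.2 * v.1.1, u.1.1 * v.2 = u.2 * v.1.1 &
      u.1.2 * v.2 = u.2 * v.1.2].
Definition scale3 (a : C) u : C3 := (a * u.1.1, a * u.1.2, a * u.2).
Definition opp3 u : C3 := (- u.1.1, - u.1.2, - u.2).

Lemma triple_eq u v : u.1.1 = v.1.1 -> u.1.2 = v.1.2 -> u.2 = v.2 -> u = v.
Proof. by case: u v => [[a b] c] [[a' b'] c'] /= -> -> ->. Qed.

Lemma par3C u v : par3 u v -> par3 v u.
Proof. by move=> [a b c]; split; [move: a|move: b|move: c] => h;
  rewrite mulrC -h mulrC. Qed.

(** Expansion of the double cross product of [c], [u] and [c], which is zero. *)
Lemma par3_dot u c : par3 u c -> scale3 (dot3 c c) u = scale3 (dot3 u c) c.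
Proof.
move=> [a1 a2 a3]; apply: triple_eq => /=; rewrite /dot3.
- transitivity (u.1.1 * c.1.1 * c.1.1 + (u.1.1 * c.1.2) * c.1.2 +
    (u.1.1 * c.2) * c.2); first by ring.
  by rewrite a1 a2; ring.
- transitivity ((u.1.2 * c.1.1) * c.1.1 + u.1.2 * c.1.2 * c.1.2 +
    (u.1.2 * c.2) * c.2); first by ring.
  by rewrite -a1 a3; ring.
- transitivity ((u.2 * c.1.1) * c.1.1 + (u.2 * c.1.2) * c.1.2 +
    u.2 * c.2 * c.2); first by ring.
  by rewrite -a2 -a3; ring.
Qed.

(** Dividing by [dot3 c c] turns both vectors into multiples of [c]. *)
Lemma par3_trans u v c : dot3 c c != 0 -> par3 u c -> par3 v c -> par3 u v.
Proof.
move=> c0 /par3_dot hu /par3_dot hv; set d := dot3 c c in c0 hu hv.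
have scaleI x y : scale3 d x = y -> x = scale3 d^-1 y.
  by move=> <-; apply: triple_eq => /=; rewrite mulrA mulVf // mul1r.
by rewrite (scaleI _ _ hu) (scaleI _ _ hv); split => /=; ring.
Qed.

Lemma par3_unit u v : dot3 u u = 1 -> dot3 v v = 1 -> par3 u v ->
  u = v \/ u = opp3 v.
Proof.
move=> u1 v1 /par3_dot h; rewrite v1 in h.
have {h} e : u = scale3 (dot3 u v) v.
  by rewrite -h; apply: triple_eq; rewrite /= mul1r.
have d2 : dot3 u v ^+ 2 = 1.
  rewrite -u1 {2 3}e; set a := dot3 u v.
  have -> : dot3 (scale3 a v) (scale3 a v) = a ^+ 2 * dot3 v v.
    by rewrite /dot3 /=; ring.
  by rewrite v1 mulr1.
move/eqP: d2; rewrite sqrf_eq1 => /orP[|] /eqP d; rewrite d in e; [left|right].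
  by rewrite e; apply: triple_eq; rewrite /= mul1r.
by rewrite e; apply: triple_eq; rewrite /= mulN1r.
Qed.

Definition hol3 (w : C -> C3) (z : C) : Prop :=
  [/\ hol (fun x => (w x).1.1) z, hol (fun x => (w x).1.2) z &
      hol (fun x => (w x).2) z].

Lemma hol3_dot (u v : C -> C3) z : hol3 u z -> hol3 v z ->
  hol (fun x => dot3 (u x) (v x)) z.
Proof.
move=> [a b c] [a' b' c']; rewrite /dot3.
by apply: holD; [apply: holD|]; apply: holM.
Qed.

Lemma hol3_scale (a : C -> C) (u : C -> C3) z : hol a z -> hol3 u z ->
  hol3 (fun x => scale3 (a x) (u x)) z.
Proof. by move=> h [a1 b c]; split => /=; apply: holM. Qed.

Lemma hol3_opp (u : C -> C3) z : hol3 u z -> hol3 (fun x => opp3 (u x)) z.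
Proof. by move=> [a1 b c]; split => /=; apply: holN. Qed.

Lemma hol3_eq (u v : C -> C3) z : (\forall x \near z, u x = v x) -> hol3 u z ->
  hol3 v z.
Proof.
move=> e [a b c]; split; [apply: hol_eq a|apply: hol_eq b|apply: hol_eq c];
  by apply: filterS e => x ->.
Qed.

Lemma hol3_near (u : C -> C3) z : hol3 u z -> \forall x \near z, hol3 u x.
Proof.
move=> [/hol_near a /hol_near b /hol_near c].
by near=> x; split; near: x.
Unshelve. all: by end_near. Qed.

Lemma cvg_real_line (z : C) : (fun s : R => z + ofR s) @ 0^' --> z.
Proof.
have : (fun s : R => z + ofR s) @ 0^' --> z + ofR 0.
  apply: cvgD; first exact: cvg_cst.
  by apply: ofR_cvg; exact: (@nbhs_dnbhs R 0).
by rewrite -[ofR 0]/(0 : C) addr0.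
Qed.

(** The real line through [x] supplies points other than [x] arbitrarily close to it. *)
Lemma punctured_eq0 (f : C -> C) x : {for x, continuous f} ->
  (\forall y \near x, y != x -> f y = 0) -> f x = 0.
Proof.
move=> cf H; apply/eqP/negPn/negP => n0.
have n : \forall y \near x, f y != 0 by exact: (cvgr_neq0 _ cf n0).
have k := @cvg_real_line x.
have k1 : \forall s \near (0 : R)^', f (x + ofR s) != 0 := k _ n.
have k2 : \forall s \near (0 : R)^', x + ofR s != x -> f (x + ofR s) = 0 := k _ H.
have k5 : \forall s \near (0 : R)^', s != 0 by exact: nbhs_dnbhs_neq.
near (0 : R)^' => s.
have a1 : f (x + ofR s) != 0 by near: s.
have a2 : x + ofR s != x -> f (x + ofR s) = 0 by near: s.
have a3 : s != 0 by near: s.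
move: a1; rewrite a2 ?eqxx // -subr_eq0 addrC addKr.
by rewrite ofR_eq0.
Unshelve. all: by end_near. Qed.

Section DirectionCovering.
Variables (D : set C) (c : C -> C3).
Hypothesis oD : open D.
Hypothesis isolated : forall x, D x ->
  \forall y \near x, y != x -> dot3 (c y) (c y) != 0.

Definition direction_germ (x : C) (w : C -> C3) : Prop :=
  [/\ D x, hol3 w x &
      \forall y \near x, dot3 (w y) (w y) = 1 /\ par3 (w y) (c y)].

Hypothesis local_direction : forall x, D x -> exists w : C -> C3, direction_germ x w.

Lemma direction_germ_near x (w : C -> C3) : direction_germ x w ->
  \forall y \near x, direction_germ y w.
Proof.
move=> [Dx /hol3_near hw /near_join e]; have := near_domain oD Dx => nD.
by near=> y; split; near: y.
Unshelve. all: by end_near. Qed.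

(** Away from [x] both germs are parallel to the non-isotropic vector [c y], hence to each other; at
    [x], where [c] may vanish, the relation follows by continuity. *)
Lemma direction_germ_par x (u v : C -> C3) : direction_germ x u -> direction_germ x v ->
  par3 (u x) (v x).
Proof.
move=> [Dx [u1 u2 u3] eu] [_ [v1 v2 v3] ev].
have H : \forall y \near x, y != x -> par3 (u y) (v y).
  have I := isolated Dx.
  near=> y => yx; apply: (@par3_trans _ _ (c y)).
  - by move: yx; near: y.
  - by have [] : dot3 (u y) (u y) = 1 /\ par3 (u y) (c y) by near: y.
  - by have [] : dot3 (v y) (v y) = 1 /\ par3 (v y) (c y) by near: y.
split; apply/eqP; rewrite -subr_eq0; apply/eqP.
- apply: (@punctured_eq0 (fun y => (u y).1.1 * (v y).1.2 - (u y).1.2 * (v y).1.1)).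
    by apply: cvgB; apply: ccvgM; exact: hol_cont.
  by apply: filterS H => y h /h [-> _ _]; rewrite subrr.
- apply: (@punctured_eq0 (fun y => (u y).1.1 * (v y).2 - (u y).2 * (v y).1.1)).
    by apply: cvgB; apply: ccvgM; exact: hol_cont.
  by apply: filterS H => y h /h [_ -> _]; rewrite subrr.
- apply: (@punctured_eq0 (fun y => (u y).1.2 * (v y).2 - (u y).2 * (v y).1.2)).
    by apply: cvgB; apply: ccvgM; exact: hol_cont.
  by apply: filterS H => y h /h [_ _ ->]; rewrite subrr.
Unshelve. all: by end_near. Qed.

Lemma direction_germ_pm x (u v : C -> C3) : direction_germ x u -> direction_germ x v ->
  u x = v x \/ u x = opp3 (v x).
Proof.
move=> hu hv; have p := direction_germ_par hu hv.
case: hu => [_ _ /nbhs_singleton [u1 _]]; case: hv => [_ _ /nbhs_singleton [v1 _]].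
exact: par3_unit.
Qed.

(** A covering with two sheets: over each point the values are opposite to each other. *)
Lemma direction_covering : covering D direction_germ.
Proof.
split.
- move=> x s s' [Dx hs es] e; split => //; first exact: hol3_eq e hs.
  by near=> y; rewrite -(near e y) //; near: y.
- move=> x s s' hs hs' e.
  have cd : {for x, continuous (fun y => dot3 (s y) (s' y))}.
    by case: hs hs' => [_ h _] [_ h' _]; exact/hol_cont/hol3_dot.
  have d1 : dot3 (s x) (s' x) = 1.
    by rewrite -e; case: hs => [_ _ /nbhs_singleton []].
  (* Two directions have dot product 1 or -1. It is 1 at [x], so -1 is excluded nearby by
     continuity. *)
  have nd : \forall y \near x, dot3 (s y) (s' y) + 1 != 0.
    have c1 : (dot3 (s y) (s' y) + 1) @[y --> x] --> (1 + 1 : C).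
      by apply: cvgD; [rewrite -d1; exact: cd|exact: cvg_cst].
    apply: (cvgr_neq0 _ c1); apply/eqP => /(congr1 fst) /= /eqP.
    by rewrite -[1 + 1]/(2%:R : R) pnatr_eq0.
  have gs := direction_germ_near hs; have gs' := direction_germ_near hs'.
  near=> y; have h : direction_germ y s by near: y.
  have h' : direction_germ y s' by near: y.
  case: (direction_germ_pm h h') => // E.
  have : dot3 (s y) (s' y) + 1 != 0 by near: y.
  have -> : dot3 (s y) (s' y) = - dot3 (s' y) (s' y).
    by rewrite E /dot3 /=; ring.
  by case: h' => [_ _ /nbhs_singleton [-> _]]; rewrite addNr eqxx.
- move=> x s s' [_ [s1 s2 s3] _] [_ [s1' s2' s3'] _] e.
  have key (f g : C -> C) : hol f x -> hol g x -> f x <> g x ->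
      \forall y \near x, f y <> g y.
    move=> hf hg fg; have cc : {for x, continuous (fun y => f y - g y)}.
      by apply: cvgB; exact: hol_cont.
    have n0 : f x - g x != 0 by rewrite subr_eq0; apply/eqP.
    have n : \forall y \near x, f y - g y != 0 by exact: (cvgr_neq0 _ cc n0).
    by apply: filterS n => y; rewrite subr_eq0 => /eqP.
  case: (pselect ((s x).1.1 = (s' x).1.1)) => e1; last first.
    by apply: filterS (key _ _ s1 s1' e1) => y h E; apply: h; rewrite E.
  case: (pselect ((s x).1.2 = (s' x).1.2)) => e2; last first.
    by apply: filterS (key _ _ s2 s2' e2) => y h E; apply: h; rewrite E.
  case: (pselect ((s x).2 = (s' x).2)) => e3; last first.
    by apply: filterS (key _ _ s3 s3' e3) => y h E; apply: h; rewrite E.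
  by case: e; exact: triple_eq.
(* The local direction [w] and its opposite are the two sheets over its domain. *)
- move=> x Dx; have [w hw] := local_direction Dx.
  exists [set y | direction_germ y w]; first exact: direction_germ_near.
  move=> y s0 hy hs0; case: (direction_germ_pm hs0 hy) => e.
    by exists w.
  exists (fun z => opp3 (w z)) => // z [Dz hz ez]; split => //; first exact: hol3_opp.
  apply: filterS ez => t [d1 [p1 p2 p3]]; split.
    by rewrite -d1 /dot3 /=; ring.
  by split => /=; rewrite !mulNr ?p1 ?p2 ?p3.
Unshelve. all: by end_near. Qed.

Lemma hol_direction : simply_connected (R := R) D -> D !=set0 ->
  exists w : C -> C3, forall x, D x -> direction_germ x w.
Proof.
move=> sc [x0 Dx0]; have [s0 S0] := local_direction Dx0.
by have [w _ Hw] := monodromy direction_covering oD sc Dx0 S0; exists w.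
Qed.

End DirectionCovering.

(** [t] is multiplied by [exp (- log (t . t) / 2)]. A branch of the logarithm exists near [x]: [b]
    is its value there, and [clog] of the quotient by the value at [x] supplies the variation. *)
Lemma normalize_direction (t : C -> C3) (c : C -> C3) (x : C) : hol3 t x ->
  dot3 (t x) (t x) != 0 -> (\forall y \near x, par3 (t y) (c y)) ->
  exists w : C -> C3, [/\ hol3 w x, exists a, w x = scale3 a (t x) &
    \forall y \near x, dot3 (w y) (w y) = 1 /\ par3 (w y) (c y)].
Proof.
move=> ht n0 p; have [b eb] := cexp_surj n0.
pose N y := dot3 (t y) (t y); have hN : hol N x by exact: hol3_dot.
pose q y := N y / N x.
have hq : hol q x by apply: holM => //; exact: hol_cst.
have q1 : 0 < (q x).1 by rewrite /q divff //= ltr01.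
pose half : C := ofR (1 / 2).
have half2 : half + half = 1.
  by rewrite /half -ofRD; congr ofR; field.
pose a y := cexp (- (half * (b + clog (q y)))).
have ha : hol a x.
  apply: (@hol_comp R (fun y => - (half * (b + clog (q y)))) (@cexp R)); last exact: hol_cexp.
  apply: holN; apply: holM; first exact: hol_cst.
  apply: holD; first exact: hol_cst.
  by apply: (@hol_comp R q clog) => //; exact: hol_clog.
exists (fun y => scale3 (a y) (t y)); split.
- exact: hol3_scale.
- by exists (a x).
have nq : \forall y \near x, 0 < (q y).1.
  exact: near_re_gt0 (hol_cont hq) q1.
near=> y; have qy : 0 < (q y).1 by near: y.
split.
  have -> : dot3 (scale3 (a y) (t y)) (scale3 (a y) (t y)) = a y * a y * N y.
    by rewrite /N /dot3 /=; ring.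
  rewrite /a -cexpD -opprD -mulrDl half2 mul1r cexpN cexpD cexp_clog // eb /q -/(N x).
  have Ny : N y != 0.
    by apply: contraTneq qy => E; rewrite /q E mul0r ltxx.
  have Nx : N x != 0 by exact: n0.
  by field; rewrite Ny Nx.
have [p1 p2 p3] : par3 (t y) (c y) by near: y.
by split => /=; rewrite -!mulrA ?p1 ?p2 ?p3.
Unshelve. all: by end_near. Qed.

End Directions.

(** * Biquaternions and the star-exponential *)

Section ExpSeries.
Context {R : realType}.
Local Notation C := (cplx R).

Lemma near_all (P : C -> Prop) (z : C) : (forall w, P w) -> \forall w \near z, P w.
Proof. by move=> h; near=> w. Unshelve. all: by end_near. Qed.

Definition exp_sum (n : nat) (z : C) : C := \sum_(k < n) ofR (k`!%:R^-1) * z ^+ k.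

Lemma exp_sumS n z : exp_sum n.+1 z = exp_sum n z + ofR (n`!%:R^-1) * z ^+ n.
Proof. by rewrite /exp_sum big_ord_recr. Qed.

Lemma exp_sum0 n : exp_sum n.+1 0 = 1.
Proof.
elim: n => [|n IH]; first by rewrite exp_sumS /exp_sum big_ord0 add0r expr0 mulr1 invr1.
by rewrite exp_sumS IH expr0n /= mulr0 addr0.
Qed.

Lemma sdiff_Xn n (z : C) : sdiff (fun w => w ^+ n) z (n%:R * z ^+ n.-1).
Proof.
elim: n => [|n IH]; first by rewrite mul0r; exact: sdiff_cst.
under eq_fun do rewrite exprS.
have := sdiffM (sdiff_id z) IH; congr (sdiff _ _ _).
case: n IH => [|n] _; first by rewrite !expr0 /=; ring.
by rewrite /= -[n.+2]addn1 natrD exprS; ring.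
Qed.

Lemma sdiff_exp_sum n (z : C) : sdiff (exp_sum n.+1) z (exp_sum n z).
Proof.
elim: n => [|n IH].
  rewrite /exp_sum big_ord0; apply: sdiff_eq (sdiff_cst 1 z).
  by apply: near_all => w; rewrite big_ord_recl big_ord0 expr0 addr0 /= invr1 mulr1.
have h := sdiffD IH (sdiffM (sdiff_cst (ofR (n.+1`!%:R^-1)) z) (sdiff_Xn n.+1 z)).
have := sdiff_eq (G := exp_sum n.+2) _ h; rewrite [exp_sum n.+1 z]exp_sumS.
have -> : exp_sum n z + (0 * z ^+ n.+1 + ofR n.+1`!%:R^-1 * (n.+1%:R * z ^+ n.+1.-1)) =
    exp_sum n z + ofR n`!%:R^-1 * z ^+ n.
  congr (_ + _); rewrite mul0r add0r mulrA /=; congr (_ * _).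
  have -> : (n.+1%:R : C) = ofR n.+1%:R.
    by elim: (n.+1) => [//|m IH']; rewrite -!natr1 ofRD IH'.
  have n0 : (n.+1%:R : R) != 0 by rewrite pnatr_eq0.
  rewrite -ofRM factS natrM; apply: (congr1 (@ofR R)).
  by rewrite invfM [X in X * _]mulrC -mulrA mulVf // mulr1.
by apply; apply: near_all => w; rewrite [RHS]exp_sumS.
Qed.

Lemma cnormX (z : C) n : `|z ^+ n.+1| <= (2 * `|z|) ^+ n.+1.
Proof.
elim: n => [|n IH]; first by rewrite !expr1 mulr_natl mulr2n lerDl.
rewrite exprS [leRHS]exprS; apply: le_trans (cnormM _ _) _.
by rewrite mulrA ler_pM // mulr_ge0.
Qed.

(* [exp (- w) * exp_sum n w - 1] is the integral of its derivative, which has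
   only one term. *)
Lemma exp_sum_cvg (z : C) : (fun n => exp_sum n z) @ \oo --> cexp z.
Proof.
pose H n (w : C) := cexp (- w) * exp_sum n.+1 w.
have dH n w : sdiff (H n) w (- cexp (- w) * (ofR n`!%:R^-1 * w ^+ n)).
  have h1 := sdiff_comp (sdiffN (sdiff_id w)) (sdiff_cexp (- w)).
  have := sdiffM h1 (sdiff_exp_sum n w); congr (sdiff _ _ _).
  by rewrite exp_sumS /=; ring.
have cHd n : continuous (fun t : R => z * (- cexp (- (ofR t * z)) *
    (ofR n`!%:R^-1 * (ofR t * z) ^+ n))).
  have ct (t : R) : (fun t => ofR t * z) @ t --> ofR t * z.
    by apply: ccvgM; [exact: ofR_cvg|exact: cvg_cst].
  move=> t; apply: ccvgM; first exact: cvg_cst.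
  apply: ccvgM.
    by apply: cvgN; apply: (cont_cvg (@cexp_cont R _)); apply: cvgN; exact: ct.
  apply: ccvgM; first exact: cvg_cst.
  by apply: ccvgX; exact: ct.
have FTC n : cint (fun t : R => z * (- cexp (- (ofR t * z)) *
    (ofR n`!%:R^-1 * (ofR t * z) ^+ n))) = H n z - 1.
  have d t : is_derive t (1 : R) (fun t => H n (ofR t * z)) (z * (- cexp (- (ofR t * z)) *
      (ofR n`!%:R^-1 * (ofR t * z) ^+ n))).
    have h1 := sdiffM (sdiff_id (ofR t)) (sdiff_cst z (ofR t)).
    apply: (is_derive_ext (sdiff_real (sdiff_comp h1 (dH n _)))) => //.
    by ring.
  rewrite (cint_FTC (cHd n) d) -[ofR 1]/(1 : C) mul1r -[ofR 0]/(0 : C) mul0r.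
  by rewrite /H exp_sum0 oppr0 cexp0 mulr1.
pose g t := `|cexp (- (ofR t * z))|.
have cg : continuous g.
  move=> t; apply: cvg_norm; apply: (cont_cvg (@cexp_cont R _)); apply: cvgN.
  by apply: ccvgM; [exact: ofR_cvg|exact: cvg_cst].
have [c _ cmax] : exists2 c, c \in `[0, 1]%R & forall t, t \in `[0, 1]%R -> g t <= g c.
  by apply: (@EVT_max R g) => //; exact: continuous_subspaceT.
pose y := 2 * `|z|; have y0 : 0 <= y by rewrite mulr_ge0.
(* The two nested products cost a factor 4, and the powers of [z] cost the factor 2 contained in
   [y]. *)
have bound n : `|H n.+1 z - 1| <= 4 * `|z| * (g c * (y ^+ n.+1 / n.+1`!%:R)).
  rewrite -FTC; apply: cint_norm; first exact: cHd.
  move=> t t01; apply: le_trans (cnormM _ _) _.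
  have -> : 4 * `|z| * (g c * (y ^+ n.+1 / n.+1`!%:R)) =
     2 * (`|z| * (2 * (g c * (y ^+ n.+1 / n.+1`!%:R)))) by ring.
  rewrite ler_pM2l // ler_wpM2l //; apply: le_trans (cnormM _ _) _.
  rewrite ler_pM2l // normrN ler_pM //; first by apply: cmax; rewrite in_itv.
  rewrite -scale_ofR normrZ mulrC ger0_norm ?invr_ge0 // ler_wpM2r ?invr_ge0 //.
  apply: le_trans (cnormX _ _) _; rewrite lerXn2r ?nnegrE ?mulr_ge0 //.
  rewrite /y ler_pM2l // -scale_ofR normrZ; case/andP: t01 => t0 t1.
  by rewrite ger0_norm // -[leRHS]mul1r ler_wpM2r.
have lim0 : (fun n => 4 * `|z| * (g c * (y ^+ n.+1 / n.+1`!%:R))) @ \oo --> (0 : R).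
  rewrite -[X in _ --> X](mulr0 (4 * `|z|)); apply: cvgM; first exact: cvg_cst.
  rewrite -[X in _ --> X](mulr0 (g c)); apply: cvgM; first exact: cvg_cst.
  have := cvg_series_cvg_0 (is_cvg_series_exp_coeff y).
  by rewrite -(cvg_shiftS (exp_coeff y) (nbhs (0 : R))).
have H1 : (fun n => H n.+1 z) @ \oo --> (1 : C).
  apply/cvgrPdist_le => e e0.
  have ne : \forall n \near \oo, 4 * `|z| * (g c * (y ^+ n.+1 / n.+1`!%:R)) < e.
    by apply: (cvgr_lt _ lim0).
  near=> n; rewrite distrC; apply: le_trans (bound n) (ltW _).
  by near: n.
have H2 : (fun n => cexp z * H n.+1 z) @ \oo --> cexp z * 1.
  by apply: ccvgM => //; exact: cvg_cst.
rewrite mulr1 in H2.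
(* The shift by 2 combines the index [n.+1] of the bound with [H n] being built from
   [exp_sum n.+1]. *)
have E : (fun n => cexp z * H n.+1 z) = (fun n => exp_sum (n + 2) z).
  by apply/funext => n; rewrite /H cexpN mulrA divff ?cexp_neq0 // mul1r addn2.
by rewrite E (cvg_shiftn 2 (fun n => exp_sum n z) (nbhs (cexp z))) in H2.
Unshelve. all: by end_near. Qed.

End ExpSeries.

(** * Biquaternions and their evaluation on slices *)

Section Biquaternions.
Context {R : realType}.
Local Notation C := (cplx R).
Local Notation C3 := (C * C * C)%type.
Local Notation H := (quat R).
Local Notation Bq := (C * C3)%type.
Implicit Types (a b : Bq) (I J : H) (z : C).

Definition reB b : H := Quat b.1.1 b.2.1.1.1 b.2.1.2.1 b.2.2.1.
Definition imB b : H := Quat b.1.2 b.2.1.1.2 b.2.1.2.2 b.2.2.2.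
(* A biquaternion [p + i q], with [p] and [q] real quaternions, is evaluated on
   the slice of [I] by sending [i] to left multiplication by [I]. *)
Definition ev I b : H := reB b + I * imB b.

Definition cross3 (u v : C3) : C3 :=
  (u.1.2 * v.2 - u.2 * v.1.2, u.2 * v.1.1 - u.1.1 * v.2, u.1.1 * v.1.2 - u.1.2 * v.1.1).
Definition add3 (u v : C3) : C3 := (u.1.1 + v.1.1, u.1.2 + v.1.2, u.2 + v.2).
(** Hamilton's product in scalar and vector parts, extended bilinearly to complex coefficients. *)
Definition bqmul a b : Bq :=
  (a.1 * b.1 - dot3 a.2 b.2,
   add3 (add3 (scale3 a.1 b.2) (scale3 b.1 a.2)) (cross3 a.2 b.2)).
Definition bqone : Bq := (1, (0, 0, 0)).
Definition bqpow a n : Bq := iter n (bqmul a) bqone.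
Definition conj3 (u : C3) : C3 := (conjC u.1.1, conjC u.1.2, conjC u.2).
Definition conjB b : Bq := (conjC b.1, conj3 b.2).

(** If the real part were nonzero, the vector part would vanish and a real square would be -1. *)
Lemma imag_unitsP I : imag_units I <->
  qre I = 0 /\ qi I ^+ 2 + qj I ^+ 2 + qk I ^+ 2 = 1.
Proof.
rewrite /imag_units /= expr2; case: I => a b c d /=; split.
  move=> E; have h0 := congr1 (@qre R) E; have h1 := congr1 (@qi R) E.
  have h2 := congr1 (@qj R) E; have h3 := congr1 (@qk R) E.
  move: h0 h1 h2 h3; rewrite /= oppr0 => h0 h1 h2 h3.
  have a0 : a = 0.
    apply/eqP/negPn/negP => an.
    have k x : a * x = 0 -> x = 0.
      by move=> /eqP; rewrite mulf_eq0 (negbTE an) => /eqP.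
    have b0 : b = 0 by apply: k; lra.
    have c0 : c = 0 by apply: k; lra.
    have d0 : d = 0 by apply: k; lra.
    by move: h0; rewrite b0 c0 d0; nra.
  by split => //; rewrite a0 in h0; rewrite !expr2; lra.
move=> [-> E]; rewrite !expr2 in E; apply: quatP => /=; rewrite ?oppr0; lra.
Qed.

Lemma quatI_unit : imag_units (@quatI R).
Proof. by apply/imag_unitsP; rewrite /= expr1n expr0n /= !addr0. Qed.
Lemma quatJ_unit : imag_units (@quatJ R).
Proof. by apply/imag_unitsP; rewrite /= expr1n expr0n /= addr0 add0r. Qed.

Lemma imag_unitsN I : imag_units I -> imag_units (- I).
Proof. by move=> h; rewrite /imag_units /= sqrrN. Qed.

Lemma slice_ptN I x y : slice_pt (- I) x y = slice_pt I x (- y).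
Proof. by rewrite /slice_pt scalerN scaleNr. Qed.

Lemma evN I b : ev (- I) b = ev I (conjB b).
Proof. by apply: quatP => /=; ring. Qed.

(** [ev I] is not multiplicative, as [I] does not commute with [ev I a]. For [p = ev I a] invertible
    the right-hand side is [p * ev J b] with [J = p^-1 * I * p], which is the twist in the
    star-product. *)
Lemma ev_bqmul I a b : imag_units I ->
  ev I (bqmul a b) = ev I a * reB b + I * ev I a * imB b.
Proof.
move=> h; have II : I * I = -1 by rewrite -expr2.
have -> : ev I a * reB b + I * ev I a * imB b =
  (reB a * reB b - imB a * imB b) + I * (reB a * imB b + imB a * reB b).
  rewrite /ev !(mulrDl, mulrDr, mulrA) II !mulN1r !mulNr.
  set x := reB a * reB b; set y := I * imB a * reB b; set w := I * reB a * imB b.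
  set v := imB a * imB b.
  by rewrite addrACA addrA [LHS]addrAC -!addrA; congr (_ + _); rewrite addrCA addrA.
rewrite /ev; congr (_ + _ * _); apply: quatP => /=; ring.
Qed.

(** Two opposite units suffice: their sum isolates [reB], and then [imB] is recovered by cancelling
    the unit. *)
Lemma ev_inj a b : (forall I, imag_units I -> ev I a = ev I b) -> a = b.
Proof.
move=> h; have h1 := h _ quatI_unit; have h2 := h _ (imag_unitsN quatI_unit).
have r : reB a = reB b.
  have k c : ev quatI c + ev (- quatI) c = reB c + reB c.
    by rewrite /ev mulNr addrACA subrr addr0.
  have := k a; rewrite h1 h2 k => E; apply: quatP.
  - by have := congr1 (@qre R) E => /=; lra.
  - by have := congr1 (@qi R) E => /=; lra.
  - by have := congr1 (@qj R) E => /=; lra.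
  - by have := congr1 (@qk R) E => /=; lra.
have i : imB a = imB b.
  move: h1; rewrite /ev r => /addrI /(congr1 (fun q => - quatI * q)).
  by rewrite !mulrA mulNr -expr2 quatI_unit opprK !mul1r.
case: a b r i {h h1 h2} => [[a1 a2] [[[b1 b2] [c1 c2]] [d1 d2]]].
move=> [[a1' a2'] [[[b1' b2'] [c1' c2']] [d1' d2']]].
by move=> [/= -> -> -> ->] [-> -> -> ->].
Qed.

Lemma qconjugate_slice (p I : H) x y : p != 0 ->
  p^-1 * slice_pt I x y * p = slice_pt (p^-1 * I * p) x y.
Proof.
move=> p0; rewrite /slice_pt mulrDr mulrDl; congr (_ + _).
  by rewrite -scalerAr mulr1 -scalerAl mulVr ?unitfE //; exact: p0.
by rewrite -scalerAr -scalerAl.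
Qed.

Lemma qconjugate_unit (p I : H) : p != 0 -> imag_units I -> imag_units (p^-1 * I * p).
Proof.
move=> p0 hI; have pu : p \is a GRing.unit by exact: p0.
rewrite /imag_units /= expr2 !mulrA -[p^-1 * I * p * p^-1]mulrA divrr // mulr1.
by rewrite -[p^-1 * I * I]mulrA -expr2 hI mulrN1 mulNr mulVr.
Qed.

End Biquaternions.

Section QuatTopology.
Context {R : realType}.
Local Notation H := (quat R).
Local Notation C := (cplx R).

Lemma quat_decomp (q : H) :
  q = qre q *: 1 + qi q *: quatI + qj q *: quatJ + qk q *: quatK.
Proof. by apply: quatP => /=; ring. Qed.

Lemma cvg_quat T (F : set_system T) {FF : Filter F} (f : T -> H) (l : H) :
  (fun x => qre (f x)) @ F --> qre l -> (fun x => qi (f x)) @ F --> qi l ->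
  (fun x => qj (f x)) @ F --> qj l -> (fun x => qk (f x)) @ F --> qk l ->
  f @ F --> l.
Proof.
move=> h1 h2 h3 h4; rewrite [l]quat_decomp.
have -> : f = fun x => qre (f x) *: 1 + qi (f x) *: quatI + qj (f x) *: quatJ +
    qk (f x) *: quatK by apply/funext => x; exact: quat_decomp.
by apply: cvgD; [apply: cvgD; [apply: cvgD|]|]; apply: cvgZr_tmp.
Qed.

Lemma qcomp_norm (q : H) :
  [/\ `|qre q| <= `|q|, `|qi q| <= `|q|, `|qj q| <= `|q| & `|qk q| <= `|q|].
Proof.
have s1 := sqr_ge0 (qre q); have s2 := sqr_ge0 (qi q).
have s3 := sqr_ge0 (qj q); have s4 := sqr_ge0 (qk q).
have k (a : R) : a ^+ 2 <= qnormsq q -> `|a| <= `|q|.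
  move=> h; rewrite -(@ler_pXn2r _ 2) ?nnegrE // real_normK ?num_real //.
  by rewrite [`|q|]/(qnorm q) qnorm_sqr.
by split; apply: k; rewrite /qnormsq; lra.
Qed.

Lemma real_functional_cont (c : H -> R) : (forall p q, c (p - q) = c p - c q) ->
  (forall q, `|c q| <= `|q|) -> continuous c.
Proof.
move=> cB cN q; apply/(@cvgrPdist_le _ _ _ _ (nbhs_filter q)) => e e0.
have B : nbhs q (ball q e) by exact: nbhsx_ballx.
apply: (nbhsS B) => p; rewrite -ball_normE /= => h.
by rewrite -cB; apply: le_trans (cN _) (ltW h).
Qed.

Lemma qre_cont : continuous (@qre R).
Proof. by apply: real_functional_cont => // q; have [] := qcomp_norm q. Qed.
Lemma qi_cont : continuous (@qi R).
Proof. by apply: real_functional_cont => // q; have [] := qcomp_norm q. Qed.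
Lemma qj_cont : continuous (@qj R).
Proof. by apply: real_functional_cont => // q; have [] := qcomp_norm q. Qed.
Lemma qk_cont : continuous (@qk R).
Proof. by apply: real_functional_cont => // q; have [] := qcomp_norm q. Qed.

Lemma slice_pt_cont I : continuous (fun z : C => slice_pt I z.1 z.2 : H).
Proof.
move=> z; apply: cvgD; apply: cvgZr_tmp; [exact: cvg_fst|exact: cvg_snd].
Qed.

End QuatTopology.

Lemma cvg_succ (T : topologicalType) (f : nat -> T) (l : T) :
  (fun n => f n.+1) @ \oo --> l -> f @ \oo --> l.
Proof. by move=> h A /h [N _ HN]; exists N.+1 => // -[|n] //= ; exact: HN. Qed.

(** * Star-products, star-powers and the exponential series *)

Section StarProduct.
Context {R : realType}.
Local Notation H := (quat R).
Local Notation C := (cplx R).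
Local Notation C3 := (C * C * C)%type.
Local Notation Bq := (C * C3)%type.
Implicit Types (I J : H) (z : C).
Variable Omega : set H.
Hypothesis circ_Omega : circular Omega.

Definition ptI I (z : C) : H := slice_pt I z.1 z.2.
Definition inducedB (F : C -> Bq) (f : H -> H) : Prop :=
  forall I z, imag_units I -> Omega (ptI I z) -> f (ptI I z) = ev I (F z).

Lemma qre_ptI I z : imag_units I -> qre (ptI I z) = z.1.
Proof. by move=> /imag_unitsP [h _]; rewrite /= h; ring. Qed.

Lemma qim_ptI I z : imag_units I -> qim (ptI I z) = z.2 *: I.
Proof. by move=> /imag_unitsP [h _]; apply: quatP => /=; rewrite ?h; ring. Qed.

Lemma norm_imag_unit I : imag_units I -> `|I| = 1.
Proof.
move=> /imag_unitsP [h0 h1]; rewrite [`|I|]/(qnorm I) /qnorm /qnormsq h0 expr0n /=.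
by rewrite add0r h1 sqrtr1.
Qed.

(** Spheres record only the absolute value of [z.2]; a negative ordinate is reached through
    [- J]. *)
Lemma circular_swap I J z : imag_units I -> imag_units J ->
  Omega (ptI I z) -> Omega (ptI J z).
Proof.
move=> hI hJ Oz; have sub := circ_Omega Oz.
rewrite /qsphere qre_ptI // qim_ptI // normrZ norm_imag_unit // mulr1 in sub.
case: (leP 0 z.2) => z2.
  by apply: sub; exists J => //; rewrite ger0_norm.
apply: sub; exists (- J); first exact: imag_unitsN.
by rewrite slice_ptN ltr0_norm // opprK.
Qed.

(** Conjugation by the value of [f] moves the point to the slice of another unit on the same sphere.
    Where [f] vanishes, both sides are 0, in accordance with the separate clause in the definition
    of [star_mul]. *)
Lemma star_mul_induced F G f g : inducedB F f -> inducedB G g ->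
  inducedB (fun z => bqmul (F z) (G z)) (star_mul f g).
Proof.
move=> hf hg I z hI Oz; rewrite /star_mul ev_bqmul // (hf I z) //.
case: eqP => [->|/eqP p0]; first by rewrite mulr0 !mul0r addr0.
rewrite /ptI qconjugate_slice // -/(ptI _ z).
set p := ev I (F z) in p0 *; have hJ := qconjugate_unit p0 hI.
rewrite (hg _ _ hJ); last exact: circular_swap Oz.
by rewrite /ev mulrDr !mulrA divrr ?mul1r //; exact: p0.
Qed.

Lemma ev_bqone I : ev I bqone = 1.
Proof. by apply: quatP => /=; ring. Qed.

Lemma star_pow_induced F f n : inducedB F f ->
  inducedB (fun z => bqpow (F z) n) (star_pow f n).
Proof.
move=> hf; elim: n => [|n IH].
  by move=> I z hI Oz; rewrite ev_bqone.
exact: star_mul_induced.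
Qed.

Definition lin2 (v : C3) (a b : C) : Bq :=
  (ofR (1 / 2) * (a + b), scale3 (- (iC * ofR (1 / 2)) * (a - b)) v).

(** The two shapes whose exponential has a closed form: a combination of two complementary
    idempotents, or a scalar plus an element of square zero. *)
Definition biexp (F G : Bq) : Prop :=
  (exists A B v, [/\ dot3 v v = 1, F = lin2 v A B & G = lin2 v (cexp A) (cexp B)]) \/
  (exists A n, [/\ dot3 n n = 0, F = (A, n) & G = (cexp A, scale3 (cexp A) n)]).

Lemma bq_eq (a b : Bq) : a.1 = b.1 -> a.2 = b.2 -> a = b.
Proof. by case: a b => [? ?] [? ?] /= -> ->. Qed.

Lemma half_sum : ofR (1 / 2) + ofR (1 / 2) = 1 :> C.
Proof. by rewrite -ofRD; apply: (congr1 (@ofR R)); field. Qed.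

(* [lin2 v a b] is [a e + b e'], where [e] and [e'] are the complementary
   idempotents [(1 - i v) / 2] and [(1 + i v) / 2]. *)
Lemma lin2_mul v a b c d : dot3 v v = 1 ->
  bqmul (lin2 v a b) (lin2 v c d) = lin2 v (a * c) (b * d).
Proof.
move=> v1; have hh := half_sum; set h := ofR (1 / 2) in hh *.
have ii := @iC_sqr R.
have h2 x : h * h * x + h * h * x = h * x.
  by rewrite -mulrDl -mulrDr hh mulr1.
apply: bq_eq; rewrite /lin2 -/h.
  have -> : (bqmul (h * (a + b), scale3 (- (iC * h) * (a - b)) v)
     (h * (c + d), scale3 (- (iC * h) * (c - d)) v)).1 =
     h * h * ((a + b) * (c + d)) - (iC * iC) * (h * h * ((a - b) * (c - d))) * dot3 v v.
    by rewrite /bqmul /dot3 /=; ring.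
  by rewrite v1 ii mulr1 mulN1r opprK /= -(h2 (a * c + b * d)); ring.
have -> : (bqmul (h * (a + b), scale3 (- (iC * h) * (a - b)) v)
     (h * (c + d), scale3 (- (iC * h) * (c - d)) v)).2 =
  scale3 (- iC * (h * h * ((a + b) * (c - d)) + h * h * ((c + d) * (a - b)))) v.
  by apply: triple_eq; rewrite /bqmul /=; ring.
rewrite /=; apply: (congr1 (scale3^~ v)).
transitivity (- iC * (h * (a * c - b * d))); last by ring.
by rewrite -(h2 (a * c - b * d)); ring.
Qed.

Lemma bqpow_lin2 v A B n : dot3 v v = 1 -> bqpow (lin2 v A B) n = lin2 v (A ^+ n) (B ^+ n).
Proof.
move=> v1; elim: n => [|n IH].
  rewrite !expr0 /lin2 subrr mulr0; apply: bq_eq.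
    by rewrite -[RHS]/(ofR (1 / 2) * (1 + 1)) [RHS]mulrDr mulr1 half_sum.
  by apply: triple_eq; rewrite /= mul0r.
by rewrite /bqpow iterS -/(bqpow _ n) IH lin2_mul // !exprS.
Qed.

(** An isotropic vector has square zero, so the binomial expansion stops at the linear term. *)
Lemma bqpow_nil A (m : C3) n : dot3 m m = 0 ->
  bqpow (A, m) n = (A ^+ n, scale3 (n%:R * A ^+ n.-1) m).
Proof.
move=> m0; elim: n => [|n IH].
  by apply: bq_eq => //=; apply: triple_eq; rewrite /= !mul0r.
rewrite /bqpow iterS -/(bqpow _ n) IH /bqmul /=; apply: bq_eq => /=.
  have -> : dot3 m (scale3 (n%:R * A ^+ n.-1) m) = n%:R * A ^+ n.-1 * dot3 m m.
    by rewrite /dot3 /=; ring.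
  by rewrite m0 mulr0 subr0 exprS.
have -> : n.+1%:R * A ^+ n = A * (n%:R * A ^+ n.-1) + A ^+ n.
  case: n {IH} => [|n] /=; first by rewrite !mul0r mulr0 add0r mul1r.
  by rewrite exprS -[n.+2]addn1 natrD; ring.
by apply: triple_eq => /=; ring.
Qed.

Lemma evD I (a b : Bq) (r : R) :
  ev I (a.1 + ofR r * b.1, add3 a.2 (scale3 (ofR r) b.2)) = ev I a + r *: ev I b.
Proof. by apply: quatP => /=; ring. Qed.

Lemma ev_cvg I T (F : set_system T) {FF : Filter F} (f0 f1 f2 f3 : T -> C) (l0 l1 l2 l3 : C) :
  f0 @ F --> l0 -> f1 @ F --> l1 -> f2 @ F --> l2 -> f3 @ F --> l3 ->
  ev I (f0 x, (f1 x, f2 x, f3 x)) @[x --> F] --> ev I (l0, (l1, l2, l3)).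
Proof.
move=> h0 h1 h2 h3.
have [a0 b0] : (fst \o f0) @ F --> l0.1 /\ (snd \o f0) @ F --> l0.2.
  by split; [exact: cvg_re|exact: cvg_im].
have [a1 b1] : (fst \o f1) @ F --> l1.1 /\ (snd \o f1) @ F --> l1.2.
  by split; [exact: cvg_re|exact: cvg_im].
have [a2 b2] : (fst \o f2) @ F --> l2.1 /\ (snd \o f2) @ F --> l2.2.
  by split; [exact: cvg_re|exact: cvg_im].
have [a3 b3] : (fst \o f3) @ F --> l3.1 /\ (snd \o f3) @ F --> l3.2.
  by split; [exact: cvg_re|exact: cvg_im].
have c (k : R) (g : T -> R) l : g @ F --> l -> (fun x => k * g x) @ F --> k * l.
  by move=> h; apply: cvgM => //; exact: cvg_cst.
by apply: cvg_quat => /=; apply: cvgD => //;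
  repeat (first [apply: cvgB|apply: cvgD]); apply: c.
Qed.

Lemma star_exp_cvg I (F G : Bq) : biexp F G ->
  (fun n => \sum_(0 <= k < n) k`!%:R^-1 *: ev I (bqpow F k)) @ \oo --> ev I G.
Proof.
case=> [[A [B [v [v1 -> ->]]]]|[A [m [m0 -> ->]]]].
  have E n : \sum_(0 <= k < n) k`!%:R^-1 *: ev I (bqpow (lin2 v A B) k) =
      ev I (lin2 v (exp_sum n A) (exp_sum n B)).
    elim: n => [|n IH].
      by rewrite big_nil /exp_sum !big_ord0; apply: quatP => /=; ring.
    rewrite big_nat_recr //= IH bqpow_lin2 // -evD !exp_sumS.
    by congr (ev I _); apply: bq_eq; [|apply: triple_eq]; rewrite /=; ring.
  under eq_fun do rewrite E.
  have cA := @exp_sum_cvg R A; have cB := @exp_sum_cvg R B.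
  have cs : (fun n => - (iC * ofR (1 / 2)) * (exp_sum n A - exp_sum n B)) @ \oo -->
      - (iC * ofR (1 / 2)) * (cexp A - cexp B).
    by apply: ccvgM; [exact: cvg_cst|exact: cvgB].
  apply: ev_cvg.
  - by apply: ccvgM; [exact: cvg_cst|exact: cvgD].
  - by apply: ccvgM => //; exact: cvg_cst.
  - by apply: ccvgM => //; exact: cvg_cst.
  - by apply: ccvgM => //; exact: cvg_cst.
(* The vector part carries the formal derivative of the scalar partial sum, so it lags by one term;
   the formula starts at [n.+1], whence [cvg_succ]. *)
have E n : \sum_(0 <= k < n.+1) k`!%:R^-1 *: ev I (bqpow (A, m) k) =
    ev I (exp_sum n.+1 A, scale3 (exp_sum n A) m).
  elim: n => [|n IH].
    rewrite big_nat1 exp_sumS /exp_sum !big_ord0 /bqpow /= invr1 scale1r expr0.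
    by congr (ev I _); apply: bq_eq; [|apply: triple_eq];
      rewrite /= ?mul0r // add0r mulr1.
  rewrite big_nat_recr // IH bqpow_nil // [LHS]/= -evD.
  have nR k : (k%:R : C) = ofR k%:R.
    by elim: k => [//|k IH']; rewrite -!natr1 ofRD IH'.
  have F1 : ofR (n.+1`!%:R^-1) * (n.+1%:R * A ^+ n) = ofR (n`!%:R^-1) * A ^+ n.
    rewrite mulrA nR -ofRM; congr (ofR _ * _).
    have n0 : (n.+1%:R : R) != 0 by rewrite pnatr_eq0.
    by rewrite factS natrM invfM [X in X * _]mulrC -mulrA mulVf // mulr1.
  congr (ev I _); apply: bq_eq; first by rewrite /= [RHS]exp_sumS.
  by apply: triple_eq; rewrite /= exp_sumS -F1; ring.
apply: cvg_succ; under eq_fun do rewrite E.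
have cA := @exp_sum_cvg R A.
have cA1 : (fun n => exp_sum n.+1 A) @ \oo --> cexp A.
  by rewrite (cvg_shiftS (fun n => exp_sum n A) (nbhs (cexp A))).
by apply: ev_cvg => //; apply: ccvgM => //; exact: cvg_cst.
Qed.

Lemma star_exp_induced (F G : C -> Bq) f g : inducedB F f -> inducedB G g ->
  (forall q, Omega q -> exists I z, imag_units I /\ q = ptI I z) ->
  (forall z, stem_dom Omega z -> biexp (F z) (G z)) -> is_star_exp Omega f g.
Proof.
move=> hf hg ex he q Oq; have [I [z [hI e]]] := ex q Oq.
rewrite e in Oq *; rewrite (hg I z) //.
have Dz : stem_dom Omega z by exists I.
have L := @star_exp_cvg I _ _ (he z Dz).
suff -> : series (fun n => (n`!%:R : R)^-1 *: star_pow f n (ptI I z)) =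
    (fun n => \sum_(0 <= k < n) k`!%:R^-1 *: ev I (bqpow (F z) k)) by exact: L.
apply/funext => n; rewrite /series /=; apply: eq_bigr => k _.
by rewrite (@star_pow_induced F f k hf I z).
Qed.

End StarProduct.

(** * Stem functions and slice regular functions *)

Section Stems.
Context {R : realType}.
Local Notation H := (quat R).
Local Notation C := (cplx R).
Local Notation C3 := (C * C * C)%type.
Local Notation Bq := (C * C3)%type.
Implicit Types (I J : H) (z : C).

Definition bq_hol (B : C -> Bq) z : Prop :=
  hol (fun w => (B w).1) z /\ hol3 (fun w => (B w).2) z.

Definition derivB (B : C -> Bq) z : Bq :=
  (cderiv (fun w => (B w).1) z,
   (cderiv (fun w => (B w).2.1.1) z, cderiv (fun w => (B w).2.1.2) z,
    cderiv (fun w => (B w).2.2) z)).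

Definition scaleB (a : C) (b : Bq) : Bq := (a * b.1, scale3 a b.2).

Lemma sdiff_quot (F : C -> C) z d (v : C) : sdiff F z d ->
  (fun h : R => h^-1 *: (F (h *: v + z) - F z)) @ 0^' --> v * d.
Proof. by move=> h; apply: (sdiff_dir_cvg (is_derive_id _ _) _ h). Qed.

Lemma bq_hol_reB (B : C -> Bq) z (v : C) : bq_hol B z ->
  (fun h : R => h^-1 *: (reB (B (h *: v + z)) - reB (B z))) @ 0^' -->
  reB (scaleB v (derivB B z)).
Proof.
move=> [h0 [h1 h2 h3]].
have k (F : C -> C) : hol F z ->
   (fun h : R => h^-1 * ((F (h *: v + z)).1 - (F z).1)) @ 0^' --> (v * cderiv F z).1.
  by move=> hF; have s := @sdiff_quot F z _ v (hol_sdiff hF); exact: (@cvg_re R _ _ (dnbhs_filter 0) _ _ s).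
apply: cvg_quat; [exact: (k _ h0)|exact: (k _ h1)|exact: (k _ h2)|exact: (k _ h3)].
Qed.

Lemma bq_hol_imB (B : C -> Bq) z (v : C) : bq_hol B z ->
  (fun h : R => h^-1 *: (imB (B (h *: v + z)) - imB (B z))) @ 0^' -->
  imB (scaleB v (derivB B z)).
Proof.
move=> [h0 [h1 h2 h3]].
have k (F : C -> C) : hol F z ->
   (fun h : R => h^-1 * ((F (h *: v + z)).2 - (F z).2)) @ 0^' --> (v * cderiv F z).2.
  by move=> hF; have s := @sdiff_quot F z _ v (hol_sdiff hF); exact: (@cvg_im R _ _ (dnbhs_filter 0) _ _ s).
apply: cvg_quat; [exact: (k _ h0)|exact: (k _ h1)|exact: (k _ h2)|exact: (k _ h3)].
Qed.

Lemma cvg_derivable (F : R * R -> H) (z v : R * R) (l : H) :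
  (fun h : R => h^-1 *: (F (h *: v + z) - F z)) @ 0^' --> l ->
  derivable F z v /\ 'D_v F z = l.
Proof.
by move=> h; split; [apply/cvg_ex; exists l|exact: cvg_lim].
Qed.

Lemma cont_near_eq (f g : C -> H) z : (\forall w \near z, f w = g w) ->
  {for z, continuous f} -> {for z, continuous g}.
Proof.
move=> e c; rewrite /prop_for /continuous_at -(nbhs_singleton e).
by apply: cvg_trans c; apply: near_eq_cvg; apply: filterS e => w ->.
Qed.

Lemma derivB_cont (B : C -> Bq) z : bq_hol B z ->
  [/\ {for z, continuous (fun w => (derivB B w).1)},
      {for z, continuous (fun w => (derivB B w).2.1.1)},
      {for z, continuous (fun w => (derivB B w).2.1.2)} &
      {for z, continuous (fun w => (derivB B w).2.2)}].
Proof. by move=> [h0 [h1 h2 h3]]; split; exact: cderiv_cont. Qed.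

Lemma reB_cont (D : C -> Bq) z (v : C) :
  {for z, continuous (fun w => (D w).1)} ->
  {for z, continuous (fun w => (D w).2.1.1)} ->
  {for z, continuous (fun w => (D w).2.1.2)} ->
  {for z, continuous (fun w => (D w).2.2)} ->
  {for z, continuous (fun w => reB (scaleB v (D w)))} /\
  {for z, continuous (fun w => imB (scaleB v (D w)))}.
Proof.
move=> h0 h1 h2 h3.
have k (f : C -> C) : {for z, continuous f} -> (fun w => v * f w) @ z --> v * f z.
  by move=> c; apply: ccvgM => //; exact: cvg_cst.
have c0 := k _ h0; have c1 := k _ h1; have c2 := k _ h2; have c3 := k _ h3.
split; apply: cvg_quat.
- exact: cvg_re c0.
- exact: cvg_re c1.
- exact: cvg_re c2.
- exact: cvg_re c3.
- exact: cvg_im c0.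
- exact: cvg_im c1.
- exact: cvg_im c2.
- exact: cvg_im c3.
Qed.

Lemma bq_hol_near (B : C -> Bq) z : bq_hol B z -> \forall w \near z, bq_hol B w.
Proof.
move=> [/hol_near a /hol3_near b]; by near=> w; split; near: w.
Unshelve. all: by end_near. Qed.

(** The two partial derivatives are 1 and [i] times the same biquaternion [derivB B z]; the
    Cauchy-Riemann equations compare their real and imaginary parts. *)
Lemma bq_hol_C1 (B : C -> Bq) z : bq_hol B z ->
  [/\ [/\ derivable (reB \o B) z (1, 0), derivable (reB \o B) z (0, 1),
        {for z, continuous (partial_re (reB \o B))} &
        {for z, continuous (partial_im (reB \o B))}],
      [/\ derivable (imB \o B) z (1, 0), derivable (imB \o B) z (0, 1),
        {for z, continuous (partial_re (imB \o B))} &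
        {for z, continuous (partial_im (imB \o B))}],
      partial_re (reB \o B) z = partial_im (imB \o B) z &
      partial_im (reB \o B) z = - partial_re (imB \o B) z].
Proof.
move=> hB; have hBn := bq_hol_near hB.
have R1 w v : bq_hol B w -> derivable (reB \o B) w v /\
    'D_v (reB \o B) w = reB (scaleB v (derivB B w)).
  by move=> h; apply: cvg_derivable; exact: bq_hol_reB.
have I1 w v : bq_hol B w -> derivable (imB \o B) w v /\
    'D_v (imB \o B) w = imB (scaleB v (derivB B w)).
  by move=> h; apply: cvg_derivable; exact: bq_hol_imB.
have [c0 c1 c2 c3] := derivB_cont hB.
have cR v : {for z, continuous (fun w => 'D_v (reB \o B) w)}.
  have [cr _] := reB_cont v c0 c1 c2 c3.
  by apply: cont_near_eq cr; apply: filterS hBn => w /(R1 _ v) [].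
have cI v : {for z, continuous (fun w => 'D_v (imB \o B) w)}.
  have [_ ci] := reB_cont v c0 c1 c2 c3.
  by apply: cont_near_eq ci; apply: filterS hBn => w /(I1 _ v) [].
split.
- by split; [have [] := R1 z (1, 0) hB|have [] := R1 z (0, 1) hB|exact: cR|exact: cR].
- by split; [have [] := I1 z (1, 0) hB|have [] := I1 z (0, 1) hB|exact: cI|exact: cI].
- rewrite /partial_re /partial_im; have [_ ->] := R1 z (1, 0) hB.
  have [_ ->] := I1 z (0, 1) hB.
  by apply: quatP; rewrite /= ?cmulE /=; ring.
- rewrite /partial_re /partial_im; have [_ ->] := R1 z (0, 1) hB.
  have [_ ->] := I1 z (1, 0) hB.
  by apply: quatP; rewrite /= ?cmulE /=; ring.
Qed.

Section Domain.
Variable Omega : set H.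
Hypothesis oOmega : open Omega.
Hypothesis circ_Omega : circular Omega.

Local Notation D := (stem_dom Omega : set C).

Lemma stem_domP I z : imag_units I -> D z <-> Omega (ptI I z).
Proof.
move=> hI; split; last by move=> Oz; exists I.
by move=> [J hJ Oz]; exact: (circular_swap circ_Omega hJ hI Oz).
Qed.

Lemma stem_dom_open : open D.
Proof.
have -> : D = (fun z : C => slice_pt quatI z.1 z.2) @^-1` Omega.
  by apply/seteqP; split=> z; have [h1 h2] := stem_domP z quatI_unit; [exact: h1|exact: h2].
by apply: open_comp => // z _; exact: slice_pt_cont.
Qed.

Lemma stem_dom_conj z : D z -> D (conjC z).
Proof.
move=> /(stem_domP z quatI_unit) h; exists (- quatI).
  by apply: imag_unitsN; exact: quatI_unit.
by rewrite slice_ptN opprK.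
Qed.

Definition symB (B : C -> Bq) := forall z, D z -> B (conjC z) = conjB (B z).

(** Every quaternion is read with a nonnegative ordinate. At a real point the unit is undetermined
    and [quatI] is chosen; symmetry of [B] makes the choice harmless. *)
Definition from_stem (B : C -> Bq) : H -> H := fun q =>
  ev (if `|qim q| == 0 then quatI else `|qim q|^-1 *: qim q) (B (qre q, `|qim q|)).

Lemma from_stem_induced B : symB B -> inducedB Omega B (from_stem B).
Proof.
move=> sB I z hI Oz; have Dz : D z by exists I.
rewrite /from_stem qre_ptI // qim_ptI // normrZ norm_imag_unit // mulr1.
rewrite normr_eq0; case: (ltrgt0P z.2) => z2.
- by rewrite scalerA mulVf ?gt_eqF // scale1r -surjective_pairing.
(* For a negative ordinate the point is read at [- I] and [conjC z]; the two changes cancel by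
   symmetry of [B]. *)
- rewrite scalerA invrN mulNr mulVf ?lt_eqF // scaleNr scale1r evN.
  have -> : (z.1, - z.2) = conjC z by [].
  rewrite sB //; congr ev; apply: bq_eq; [|apply: triple_eq]; exact: conjCK.
-
  (* At a real point symmetry forces [imB (B z) = 0], so the unit does not matter. *)
  have e : z = conjC z by apply: cplxP; rewrite //= z2 oppr0.
  have ez : (z.1, 0) = z by apply: cplxP; rewrite //= z2.
  rewrite ez; have := sB z Dz; rewrite -e => E.
  suff i0 : imB (B z) = 0 by rewrite /ev i0 !mulr0.
  have k (x : C) : x = conjC x -> x.2 = 0.
    by move=> /(congr1 snd) /=; lra.
  have E1 := congr1 fst E; have E2 := congr1 snd E.
  have E3 := congr1 (fun x : C3 => x.1.1) E2.
  have E4 := congr1 (fun x : C3 => x.1.2) E2.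
  have E5 := congr1 (fun x : C3 => x.2) E2.
  by apply: quatP => /=; apply: k.
Qed.

Lemma slice_regular_of_stem B f : (forall z, D z -> bq_hol B z) -> symB B ->
  inducedB Omega B f ->
  holomorphic_stem Omega (reB \o B) (imB \o B) /\
  induced_by Omega (reB \o B) (imB \o B) f.
Proof.
move=> hB sB fB; split; last by move=> I a b hI Oz; exact: (fB I (a, b)).
split.
- by move=> z Dz; have [] := bq_hol_C1 (hB z Dz).
- by move=> z Dz; have [] := bq_hol_C1 (hB z Dz).
- move=> a b Dz; have e : (a, - b) = conjC (a, b) by [].
  by rewrite /= e sB //; split => //; apply: quatP => /=; rewrite ?oppr0.
- by move=> z Dz; have [] := bq_hol_C1 (hB z Dz).
Qed.

End Domain.

End Stems.

(** * From slice regular functions to holomorphic stems *)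

Section StemsOfRegular.
Context {R : realType}.
Local Notation H := (quat R).
Local Notation C := (cplx R).
Local Notation C3 := (C * C * C)%type.
Local Notation Bq := (C * C3)%type.
Implicit Types (I J : H) (z : C).

Lemma derivable_comp (c : H -> R) (F : R * R -> H) (z v : R * R) (g : R -> R) t :
  (forall p q, c (p - q) = c p - c q) -> (forall a p, c (a *: p) = a * c p) ->
  (forall q, `|c q| <= `|q|) -> derivable F z v ->
  (forall h, g (h *: (1 : R) + t) = c (F (h *: v + z))) -> g t = c (F z) ->
  is_derive t (1 : R) g (c ('D_v F z)).
Proof.
move=> cB cZ cN dF gh gt.
have lim : (fun h : R => h^-1 *: (g (h *: (1 : R) + t) - g t)) @ 0^' --> c ('D_v F z).
  have k : (fun h : R => h^-1 *: (F (h *: v + z) - F z)) @ 0^' --> 'D_v F z by exact: dF.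
  have cc : {for 'D_v F z, continuous c} by exact: real_functional_cont.
  suff -> : (fun h : R => h^-1 *: (g (h *: (1 : R) + t) - g t)) =
      (fun h : R => c (h^-1 *: (F (h *: v + z) - F z))) by exact: cont_cvg cc k.
  by apply/funext => h; rewrite gh gt cZ cB.
by split; [apply/cvg_ex; exists (c ('D_v F z))|exact: cvg_lim].
Qed.

Section Domain.
Variable Omega : set H.
Hypothesis oOmega : open Omega.
Hypothesis circ_Omega : circular Omega.
Local Notation D := (stem_dom Omega : set C).

Lemma near_stem_dom z : D z -> \forall w \near z, D w.
Proof. by move=> Dz; apply: open_nbhs_nbhs; split => //; exact: stem_dom_open. Qed.

(** A real coordinate [c] of the quaternionic pair [F0], [F1], taken as real and imaginary parts,
    satisfies the usual Cauchy-Riemann equations. *)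
Lemma hol_stem (c : H -> R) (F0 F1 : R * R -> H) z :
  (forall p q, c (p - q) = c p - c q) -> (forall a p, c (a *: p) = a * c p) ->
  (forall q, `|c q| <= `|q|) -> holomorphic_stem Omega F0 F1 -> D z ->
  hol (fun w : C => ((c (F0 w), c (F1 w)) : C)) z.
Proof.
move=> cB cZ cN [h0 h1 _ cr] Dz.
have cNeg p : c (- p) = - c p by rewrite -scaleN1r cZ mulN1r.
have sd w : D w -> exists d, sdiff (fun w : C => ((c (F0 w), c (F1 w)) : C)) w d.
  move=> Dw; have nD := near_stem_dom Dw; eexists.
  apply: (@C1_sdiff R _ (fun y => c (partial_re F0 y)) (fun y => c (partial_re F1 y))).
  - apply: filterS nD => y Dy; have [a1 a2 _ _] := h0 y Dy; have [b1 b2 _ _] := h1 y Dy.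
    have [e1 e2] := cr y Dy; case: y Dy a1 a2 b1 b2 e1 e2 => y1 y2 Dy a1 a2 b1 b2 e1 e2.
    have s1 (h : R) : (h *: ((1, 0) : R * R) + (y1, y2)) = (h *: (1 : R) + y1, y2).
      by apply: cplxP => /=; rewrite ?scaler0 ?add0r.
    have s2 (h : R) : (h *: ((0, 1) : R * R) + (y1, y2)) = (y1, h *: (1 : R) + y2).
      by apply: cplxP => /=; rewrite ?scaler0 ?add0r.
    split => /=.
    + by apply: (derivable_comp cB cZ cN a1) => // h; rewrite s1.
    + rewrite -cNeg -e2; apply: (derivable_comp cB cZ cN a2) => // h.
      by rewrite s2.
    + by apply: (derivable_comp cB cZ cN b1) => // h; rewrite s1.
    + rewrite e1; apply: (derivable_comp cB cZ cN b2) => // h.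
      by rewrite s2.
  - have [_ _ c1 _] := h0 w Dw; have cc : {for partial_re F0 w, continuous c} by exact: real_functional_cont.
    exact: (cont_cvg cc c1).
  - have [_ _ c1 _] := h1 w Dw; have cc : {for partial_re F1 w, continuous c} by exact: real_functional_cont.
    exact: (cont_cvg cc c1).
by apply: filterS (near_stem_dom Dz) => w; exact: sd.
Qed.

Definition bq_of (p q : H) : Bq :=
  ((qre p, qre q), ((qi p, qi q), (qj p, qj q), (qk p, qk q))).

Lemma ev_bq_of I p q : ev I (bq_of p q) = p + I * q.
Proof. by case: p q => [? ? ? ?] [? ? ? ?]. Qed.

Lemma slice_regular_stem f : slice_regular Omega f ->
  exists B, [/\ forall z, D z -> bq_hol B z, symB Omega B & inducedB Omega B f].
Proof.
move=> [F0 [F1 [st ind]]]; exists (fun w => bq_of (F0 w) (F1 w)); split.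
- move=> z Dz; have N q := @qcomp_norm R q.
  split; [|split].
  + by apply: (hol_stem (c := @qre R)) st Dz => // q; have [] := N q.
  + by apply: (hol_stem (c := @qi R)) st Dz => // q; have [] := N q.
  + by apply: (hol_stem (c := @qj R)) st Dz => // q; have [] := N q.
  + by apply: (hol_stem (c := @qk R)) st Dz => // q; have [] := N q.
- move=> [a b] Dz; have [_ _ sym _] := st; have [/= e1 e2] := sym a b Dz.
  by rewrite /conjC /= e1 e2.
- by move=> I [a b] hI Oz; rewrite ev_bq_of; exact: ind.
Qed.

Lemma stem_slice_regular B f : (forall z, D z -> bq_hol B z) -> symB Omega B ->
  inducedB Omega B f -> slice_regular Omega f.
Proof.
move=> hB sB fB; exists (reB \o B), (imB \o B).
exact: slice_regular_of_stem.
Qed.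

Lemma slice_preserving_stem f : slice_preserving Omega f ->
  exists c : C -> C, [/\ forall z, D z -> hol c z,
    forall z, D z -> c (conjC z) = conjC (c z) &
    inducedB Omega (fun z => (c z, (0, 0, 0))) f].
Proof.
move=> [reg pres]; have [B [hB sB fB]] := slice_regular_stem reg.
(* The units [quatI] and [- quatI] force both real quaternions of the stem into the slice of
   [quatI]; [quatJ] and [- quatJ] force them into that of [quatJ]. Only real numbers are left. *)
have real z : D z -> (B z).2 = (0, 0, 0).
  move=> Dz; have mem I : imag_units I -> slice I (ev I (B z)).
    move=> hI; have Oz := (stem_domP circ_Omega z hI).1 Dz.
    rewrite -(fB I z hI Oz); apply: pres => //; exists (ptI I z) => //; split => //.
    by exists z.1 => //; exists z.2.
  have [x1 _ [y1 _ e1]] := mem _ (@quatI_unit R).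
  have [x2 _ [y2 _ e2]] := mem _ (imag_unitsN (@quatI_unit R)).
  have [x3 _ [y3 _ e3]] := mem _ (@quatJ_unit R).
  have [x4 _ [y4 _ e4]] := mem _ (imag_unitsN (@quatJ_unit R)).
  have f1 := congr1 (@qi R) e1; have f2 := congr1 (@qj R) e1.
  have f3 := congr1 (@qk R) e1; have g1 := congr1 (@qi R) e2.
  have g2 := congr1 (@qj R) e2; have g3 := congr1 (@qk R) e2.
  have f1' := congr1 (@qi R) e3; have f2' := congr1 (@qj R) e3.
  have f3' := congr1 (@qk R) e3; have g1' := congr1 (@qi R) e4.
  have g2' := congr1 (@qj R) e4; have g3' := congr1 (@qk R) e4.
  move: f1 f2 f3 g1 g2 g3 f1' f2' f3' g1' g2' g3'.
  rewrite /= !(oppr0, mulr0, mul0r, mulr1, mul1r, addr0, add0r, subr0, sub0r, mulN1r, opprK).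
  move=> f1 f2 f3 g1 g2 g3 f1' f2' f3' g1' g2' g3'.
  by apply: triple_eq; apply: cplxP => /=; lra.
exists (fun z => (B z).1); split.
- by move=> z /hB [].
- by move=> z Dz; rewrite sB.
- move=> I z hI Oz; have Dz : D z by exists I.
  by rewrite fB // [B z]surjective_pairing real.
Qed.

End Domain.
End StemsOfRegular.

(** * Local directions of the vector part *)

Section VectorPart.
Context {R : realType}.
Local Notation H := (quat R).
Local Notation C := (cplx R).
Local Notation C3 := (C * C * C)%type.
Local Notation Bq := (C * C3)%type.
Implicit Types (I J : H) (z : C).

(* The unit [I] is forced: [I = - p / q] when the biquaternion is [p + i q]. *)
Lemma ev_eq0 (b : Bq) : b.1 ^+ 2 + dot3 b.2 b.2 = 0 ->
  exists2 I, imag_units I & ev I b = 0.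
Proof.
rewrite expr2 /dot3 => N0; set p := reB b; set q := imB b.
have h1 := congr1 fst N0; have h2 := congr1 snd N0.
(* Real and imaginary parts of the equation say that [p] and [q] have equal norms and are
   orthogonal; this is what makes [I] purely imaginary of norm 1. *)
have n1 : qnormsq p = qnormsq q.
  by move: h1; rewrite /p /q /qnormsq /= !expr2; lra.
have n2 : qre p * qre q + qi p * qi q + qj p * qj q + qk p * qk q = 0.
  by move: h2; rewrite /p /q /=; lra.
case: (eqVneq q 0) => [q0|q0].
  exists quatI; first exact: quatI_unit.
  rewrite /ev -/q q0 mulr0 addr0; apply/eqP; rewrite -qnormsq_eq0 -/p n1 q0.
  by rewrite qnormsq_eq0.
have nq : qnormsq q != 0 by rewrite qnormsq_eq0.
pose I : H := (- (qnormsq q)^-1) *: (p * qconj q).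
have Iq : I * q = - p.
  rewrite /I -scalerAl -mulrA qconj_mul [`|q|]/(qnorm q) qnorm_sqr -scalerAr mulr1.
  by rewrite scalerA mulNr mulVf // scaleN1r.
exists I; last by rewrite /ev -/p -/q Iq subrr.
apply/imag_unitsP; split.
  have -> : qre I = - (qnormsq q)^-1 *
     (qre p * qre q + qi p * qi q + qj p * qj q + qk p * qk q) by rewrite /=; ring.
  by rewrite n2 mulr0.
have -> : qi I ^+ 2 + qj I ^+ 2 + qk I ^+ 2 = (qnormsq q)^-1 ^+ 2 *
    (qnormsq p * qnormsq q -
     (qre p * qre q + qi p * qi q + qj p * qj q + qk p * qk q) ^+ 2).
  by rewrite /qnormsq /=; ring.
by rewrite n1 n2 expr0n /= subr0 expr2; field.
Qed.

(** A complex scalar evaluates in the plane of [I], so it commutes with [I], and [ev I] is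
    multiplicative on it. *)
Lemma ev_scaleB I (d : C) (b : Bq) : imag_units I ->
  ev I (scaleB d b) = ev I (d, (0, 0, 0)) * ev I b.
Proof.
move=> hI.
have -> : scaleB d b = bqmul (d, (0, 0, 0)) b.
  by apply: bq_eq; [|apply: triple_eq]; rewrite /bqmul /dot3 /=; ring.
rewrite ev_bqmul //.
have cI : I * ev I (d, (0, 0, 0)) = ev I (d, (0, 0, 0)) * I.
  have e : ev I (d, (0, 0, 0)) = d.1 *: 1 + d.2 *: I.
    by apply: quatP => /=; ring.
  by rewrite e mulrDr mulrDl -!scalerAr -!scalerAl mulr1 mul1r.
by rewrite cI -mulrA -mulrDr.
Qed.

Lemma ev_scale_pow I (d : C) (b : Bq) m : imag_units I ->
  ev I (scaleB (d ^+ m) b) = ev I (d, (0, 0, 0)) ^+ m * ev I b.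
Proof.
move=> hI; elim: m => [|m IH].
  rewrite !expr0 mul1r; congr ev; apply: bq_eq; [|apply: triple_eq];
    by rewrite /= mul1r.
rewrite [in RHS]exprS -mulrA -IH -ev_scaleB //; congr ev.
by apply: bq_eq; [|apply: triple_eq]; rewrite /= mulrA -exprS.
Qed.

Definition delta z0 z : C := (z - z0) * (z - conjC z0).

Lemma norm_ptI J z : imag_units J -> `|ptI J z| ^+ 2 = nsq z.
Proof.
move=> hJ; have [J0 J1] := (imag_unitsP J).1 hJ.
rewrite [`|_|]/(qnorm _) qnorm_sqr /qnormsq /= J0 /nsq.
rewrite !(mulr0, addr0, add0r, mulr1) !exprMn -addrA -addrA -!mulrDr addrA J1.
by rewrite mulr1.
Qed.

Lemma Delta_ev I J z0 z : imag_units I -> imag_units J ->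
  Delta (ptI J z0) (ptI I z) = ev I (delta z0 z, (0, 0, 0)).
Proof.
move=> hI hJ; have e (K : H) x : ev K (x, (0, 0, 0)) = x.1 *: 1 + x.2 *: K.
  by apply: quatP => /=; ring.
have II : I * I = -1 by rewrite -expr2; exact: hI.
have nJ := norm_ptI z0 hJ.
have n2 : (2 : H) = 2 *: 1 by rewrite scaler_nat.
rewrite e /Delta nJ qre_ptI // /ptI /slice_pt expr2 mulrDl !mulrDr -!scalerAl -!scalerAr.
rewrite II !mul1r !mulr1 !scalerN !scalerA.
rewrite /delta /nsq; case: I {hI II} => a b c d.
by apply: quatP => /=; ring.
Qed.

(** If [n] exceeded [k], cancelling [(w - z0) ^ k] would give [U z0 = 0]. This is what bounds the
    powers that can be divided out of [c]. *)
Lemma order_bound (S U V : C -> C) z0 k n :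
  (\forall w \near z0, S w = (w - z0) ^+ k * U w) ->
  (\forall w \near z0, S w = (w - z0) ^+ n * V w) ->
  {for z0, continuous U} -> {for z0, continuous V} -> U z0 != 0 -> (n <= k)%N.
Proof.
move=> hU hV cU cV; apply: contraNT; rewrite -ltnNge => kn; apply/eqP.
pose f (w : C) : C := U w - (w - z0) ^+ (n - k) * V w.
have cf : {for z0, continuous f}.
  have c1 : {for z0, continuous (fun w => (w - z0) ^+ (n - k))}.
    by apply: hol_cont; apply: holX; apply: holB; [exact: hol_id|exact: hol_cst].
  by apply: cvgB; [exact: cU|apply: ccvgM; [exact: c1|exact: cV]].
have : f z0 = 0.
  apply: (punctured_eq0 cf).
  near=> w => wz.
  have a : S w = (w - z0) ^+ k * U w by near: w.
  have b : S w = (w - z0) ^+ n * V w by near: w.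
  have n0 : (w - z0) ^+ k != 0 by rewrite expf_neq0 // subr_eq0.
  apply: (mulfI n0); rewrite mulr0 /f mulrBr -a b mulrA -exprD subnKC ?subrr //.
  exact: ltnW.
by rewrite /f subrr expr0n subn_eq0 leqNgt kn /= mul0r subr0.
Unshelve. all: by end_near. Qed.

End VectorPart.

(** * Isolated zeros, the identity principle and directions at real points *)

Section Zeros.
Context {R : realType}.
Local Notation C := (cplx R).
Local Notation C3 := (C * C * C)%type.

Lemma hol_punctured (S : C -> C) z : hol S z -> ~ (\forall w \near z, S w = 0) ->
  \forall w \near z, w != z -> S w != 0.
Proof.
move=> hS n0; case: (hol_order hS) => [//|[m [U [hU U0 E]]]].
have nU : \forall w \near z, U w != 0 by apply: (cvgr_neq0 _ (hol_cont hU)).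
near=> w => wz; have -> : S w = (w - z) ^+ m * U w by near: w.
rewrite mulf_neq0 ?expf_neq0 ?subr_eq0 //.
by near: w.
Unshelve. all: by end_near. Qed.

Lemma hol_real_line (S : C -> C) z : hol S z ->
  (\forall s \near (0 : R), S (z + ofR s) = 0) -> \forall w \near z, S w = 0.
Proof.
move=> hS n0; apply: contrapT => ne; have n := hol_punctured hS ne.
have k1 : \forall s \near (0 : R)^', z + ofR s != z -> S (z + ofR s) != 0 :=
  @cvg_real_line R z _ n.
have k2 : \forall s \near (0 : R)^', S (z + ofR s) = 0 by exact: (@nbhs_dnbhs R 0).
have k5 : \forall s \near (0 : R)^', s != 0 by exact: nbhs_dnbhs_neq.
near (0 : R)^' => s.
have s0 : s != 0 by near: s.
have a : z + ofR s != z -> S (z + ofR s) != 0 by near: s.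
have b : S (z + ofR s) = 0 by near: s.
have /a : z + ofR s != z by rewrite -subr_eq0 addrC addKr ofR_eq0.
by rewrite b eqxx.
Unshelve. all: by end_near. Qed.

(** Along a path, the parameters near whose image [S] vanishes form an open set, also closed because
    zeros are isolated elsewhere. *)
Lemma identity_principle (E : set C) (S : C -> C) z1 :
  path_connected (R := R) E -> (forall z, E z -> hol S z) -> E z1 ->
  (\forall w \near z1, S w = 0) -> forall z, E z -> \forall w \near z, S w = 0.
Proof.
move=> pc hS Ez1 S1 z Ez; have [c [[/cont_onP cc Ec] c0 c1]] := pc z1 z Ez1 Ez.
pose B := [set t : R | `[0, 1]%classic t /\ \forall w \near c t, S w = 0].
suff EB : B = `[0, 1]%classic.
  by have [_] : B 1 by [rewrite EB /= in_itv /= ler01 lexx]; rewrite c1.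
have cI := @segment_connected R 0 1; apply: cI.
- by exists 0; split; [rewrite /= in_itv /= lexx ler01|rewrite c0].
- exists (interior [set t | `[0, 1]%classic t -> \forall w \near c t, S w = 0]).
    exact: open_interior.
  apply/seteqP; split=> [t [It n]|t [It /interior_subset /(_ It)]] //; split=> //.
  have nn := within_near (cc t It _ (near_join n)).
  exact: nn.
- exists (~` interior [set t | `[0, 1]%classic t -> ~ \forall w \near c t, S w = 0]).
    by apply: open_closedC; exact: open_interior.
  apply/seteqP; split=> [t [It n]|t [It h]]; split=> //.
    by move=> /interior_subset /(_ It).
  apply: contrapT => ne; apply: h.
  have np := hol_punctured (hS _ (Ec t It)) ne.
  have nn := within_near (cc t It _ np).
  apply: (nbhsS (B := [set t | `[0, 1]%classic t ->
    ~ \forall w \near c t, S w = 0]) nn) => s hs Is n0.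
  (* The path may return to [c t], about which a punctured neighbourhood says nothing. *)
  case: (eqVneq (c s) (c t)) => [e|e]; first by apply: ne; rewrite -e.
  by have := hs Is e; rewrite (nbhs_singleton n0) eqxx.
Qed.

Lemma hol_div1 (F : C -> C) z : hol F z -> F z = 0 ->
  exists2 u, hol u z & \forall w \near z, F w = (w - z) * u w.
Proof.
move=> hF F0; case: (hol_order hF) => [n|[[|m] [U [hU U0 E]]]].
- exists (fun=> 0); first exact: hol_cst.
  by apply: filterS n => w ->; rewrite mulr0.
- by move: U0; have := nbhs_singleton E; rewrite F0 expr0 mul1r => <-; rewrite eqxx.
- exists (fun w => (w - z) ^+ m * U w).
    by apply: holM => //; apply: holX; apply: holB; [exact: hol_id|exact: hol_cst].
  by apply: filterS E => w ->; rewrite exprS mulrA.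
Qed.

(** Divisibility by [(w - z) ^ m], not exact order: the largest such [m] is selected in
    [real_direction]. *)
Definition vanishing_order (c : C -> C3) (z : C) (m : nat) : Prop :=
  exists2 t : C -> C3, hol3 t z & \forall w \near z, c w = scale3 ((w - z) ^+ m) (t w).

(* After division by the largest power of [w - z], the value [t z] is real and
   nonzero, hence not isotropic. *)
Lemma real_direction (c : C -> C3) (z : C) : z.2 = 0 -> hol3 c z ->
  (\forall w \near z, c (conjC w) = conj3 (c w)) ->
  ~ (\forall w \near z, dot3 (c w) (c w) = 0) ->
  exists t : C -> C3, [/\ hol3 t z, dot3 (t z) (t z) != 0 &
    \forall w \near z, par3 (t w) (c w)].
Proof.
move=> z0 hc sc n0; have cz : conjC z = z by apply: cplxP; rewrite //= z0 oppr0.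
have [//|[k [U [hU U0 EU]]]] := hol_order (hol3_dot hc hc).
(* Dividing [c] by the power [m] divides [c . c] by the power [2 m], which cannot exceed its order
   [k]. *)
have bound m : `[< vanishing_order c z m >] -> (m <= k)%N.
  move=> /asboolP [t ht et].
  have : (m * 2 <= k)%N.
    apply: (@order_bound R (fun w => dot3 (c w) (c w)) U (fun w => dot3 (t w) (t w)) z) => //.
    - by apply: filterS et => w ->; rewrite exprM /dot3 /=; ring.
    - exact: hol_cont.
    - exact/hol_cont/hol3_dot.
  by apply: leq_trans; rewrite leq_pmulr.
have ex0 : exists m, `[< vanishing_order c z m >].
  exists 0%N; apply/asboolP; exists c => //.
  by apply: near_all => w; apply: triple_eq; rewrite /= expr0 mul1r.
case: (ex_maxnP ex0 bound) => m /asboolP [t ht et] mmax.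
exists t; split => //; last first.
  apply: filterS et => w ->; split => /=; ring.
have conj_t (f : C -> C) : hol f z -> {for z, continuous (@conjC R \o f \o @conjC R)}.
  by move=> /hol_conj; rewrite cz => /hol_cont.
have kc : conjC w @[w --> z] --> z by rewrite -[X in _ --> X]cz; exact: conjC_continuous.
have et' : \forall w \near z, c (conjC w) = scale3 ((conjC w - z) ^+ m) (t (conjC w)) :=
  kc _ et.
(* As [z] is real, [(w - z) ^ m] is symmetric under conjugation, so the symmetry of [c] passes to
   [t] off [z], and then to [z] by continuity. *)
have tt : \forall w \near z, w != z -> t w = conj3 (t (conjC w)).
  near=> w => wz.
  have a : c w = scale3 ((w - z) ^+ m) (t w) by near: w.
  have b : c (conjC w) = scale3 ((conjC w - z) ^+ m) (t (conjC w)) by near: w.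
  have d : c (conjC w) = conj3 (c w) by near: w.
  have nz : (w - z) ^+ m != 0 by rewrite expf_neq0 // subr_eq0.
  have e : scale3 ((w - z) ^+ m) (t w) = scale3 ((w - z) ^+ m) (conj3 (t (conjC w))).
    rewrite -a; have -> : c w = conj3 (c (conjC w)).
      by rewrite d; apply: triple_eq; rewrite /= conjCK.
    rewrite b; apply: triple_eq; rewrite /= conjCM conjCX conjCD conjCN conjCK cz //.
  apply: triple_eq; apply: (mulfI nz).
  - exact: (congr1 (fun x : C3 => x.1.1) e).
  - exact: (congr1 (fun x : C3 => x.1.2) e).
  - exact: (congr1 (fun x : C3 => x.2) e).
have real (f : C -> C) : hol f z ->
    (\forall w \near z, w != z -> f w = conjC (f (conjC w))) -> (f z).2 = 0.
  move=> hf nf; have : f z - conjC (f (conjC z)) = 0.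
    apply: (@punctured_eq0 R (fun w => f w - conjC (f (conjC w)))).
      by apply: cvgB; [exact: hol_cont|exact: conj_t].
    by apply: filterS nf => w h wz; rewrite -(h wz) subrr.
  by rewrite cz => /(congr1 snd) /=; lra.
have [h1 h2 h3] := ht.
have r1 : (t z).1.1.2 = 0 by apply: (real _ h1); apply: filterS tt => w h /h {1}->.
have r2 : (t z).1.2.2 = 0 by apply: (real _ h2); apply: filterS tt => w h /h {1}->.
have r3 : (t z).2.2 = 0 by apply: (real _ h3); apply: filterS tt => w h /h {1}->.
(* A real isotropic vector is zero, so each coordinate of [t] would be divisible by [w - z],
   contradicting the maximality of [m]. *)
apply/eqP => /(congr1 fst); rewrite /dot3 /= r1 r2 r3 !mulr0 !subr0 -!expr2 => E.
have s1 := sqr_ge0 (t z).1.1.1; have s2 := sqr_ge0 (t z).1.2.1.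
have s3 := sqr_ge0 (t z).2.1.
have q1 : (t z).1.1.1 = 0 by apply/eqP; rewrite -sqrf_eq0; apply/eqP; lra.
have q2 : (t z).1.2.1 = 0 by apply/eqP; rewrite -sqrf_eq0; apply/eqP; lra.
have q3 : (t z).2.1 = 0 by apply/eqP; rewrite -sqrf_eq0; apply/eqP; lra.
have [u1 hu1 e1] := hol_div1 h1 (@cplxP R _ 0 q1 r1).
have [u2 hu2 e2] := hol_div1 h2 (@cplxP R _ 0 q2 r2).
have [u3 hu3 e3] := hol_div1 h3 (@cplxP R _ 0 q3 r3).
have /mmax : `[< vanishing_order c z m.+1 >].
  apply/asboolP; exists (fun w => (u1 w, u2 w, u3 w)) => //.
  near=> w; have -> : c w = scale3 ((w - z) ^+ m) (t w) by near: w.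
  have a1 : (t w).1.1 = (w - z) * u1 w by near: w.
  have a2 : (t w).1.2 = (w - z) * u2 w by near: w.
  have a3 : (t w).2 = (w - z) * u3 w by near: w.
  by apply: triple_eq; rewrite /= ?a1 ?a2 ?a3 exprSr mulrA.
by rewrite ltnn.
Unshelve. all: by end_near. Qed.

End Zeros.

Section VectorStem.
Context {R : realType}.
Local Notation H := (quat R).
Local Notation C := (cplx R).
Local Notation C3 := (C * C * C)%type.
Local Notation Bq := (C * C3)%type.
Implicit Types (I J : H) (z : C).
Variable Omega : set H.
Hypothesis oOmega : open Omega.
Hypothesis circ_Omega : circular Omega.
Local Notation D := (stem_dom Omega : set C).

Lemma vector_part_stem g gv : vector_part Omega g gv ->
  exists (c0 : C -> C) (c : C -> C3),
  [/\ forall z, D z -> bq_hol (fun w => (c0 w, c w)) z,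
      symB Omega (fun w => (c0 w, c w)),
      inducedB Omega (fun w => (c0 w, c w)) g &
      inducedB Omega (fun w => (0, c w)) gv].
Proof.
move=> [f0 [f1 [f2 [f3 [p0 p1 p2 p3 E]]]]].
have [c0 [h0 s0 i0]] := slice_preserving_stem oOmega circ_Omega p0.
have [c1 [h1 s1 i1]] := slice_preserving_stem oOmega circ_Omega p1.
have [c2 [h2 s2 i2]] := slice_preserving_stem oOmega circ_Omega p2.
have [c3 [h3 s3 i3]] := slice_preserving_stem oOmega circ_Omega p3.
exists c0, (fun w => (c1 w, c2 w, c3 w)).
have ig : inducedB Omega (fun w => (c0 w, (c1 w, c2 w, c3 w))) g.
  move=> I z hI Oz; have [-> _] := E _ Oz.
  rewrite (i0 I z hI Oz) (i1 I z hI Oz) (i2 I z hI Oz) (i3 I z hI Oz).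
  by apply: quatP => /=; ring.
split => //.
- by move=> z Dz; split; [exact: h0|split; [exact: h1|exact: h2|exact: h3]].
- by move=> z Dz; rewrite s0 // s1 // s2 // s3.
- move=> I z hI Oz; have [_ ->] := E _ Oz; rewrite (ig I z hI Oz) (i0 I z hI Oz).
  by apply: quatP => /=; ring.
Qed.

Lemma never_vanishing_stem (B : C -> Bq) g : inducedB Omega B g ->
  (forall q, Omega q -> g q != 0) ->
  forall z, D z -> (B z).1 ^+ 2 + dot3 (B z).2 (B z).2 != 0.
Proof.
move=> ig g0 z Dz; apply/eqP => /ev_eq0 [I hI e].
have Oz := (stem_domP circ_Omega z hI).1 Dz.
by have := g0 _ Oz; rewrite (ig I z hI Oz) e eqxx.
Qed.

Lemma ptI_nonreal J z : imag_units J -> z.2 != 0 -> ~ realq (ptI J z).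
Proof.
move=> hJ z2 [a _ e]; have := qim_ptI z hJ; rewrite -e => /esym h.
have : qim (a%:A : H) = 0 by apply: quatP => /=; ring.
rewrite -h => /eqP; rewrite scaler_eq0 (negbTE z2) /= => /eqP J0.
by have := norm_imag_unit hJ; rewrite J0 normr0 => /eqP; rewrite eq_sym oner_eq0.
Qed.

Variables (c : C -> C3) (gv : H -> H).
Hypothesis hol_c : forall z, D z -> hol3 c z.
Hypothesis sym_c : forall z, D z -> c (conjC z) = conj3 (c z).
Hypothesis ind_c : inducedB Omega (fun w => (0, c w)) gv.

Lemma bq_hol_c z : D z -> bq_hol (fun w => (0, c w)) z.
Proof. by move=> Dz; split; [exact: hol_cst|exact: hol_c]. Qed.

Lemma symB_c : symB Omega (fun w => (0, c w)).
Proof.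
by move=> z Dz; rewrite sym_c //; apply: bq_eq => //; rewrite /= conjC0.
Qed.

(** The slice conjugate of a vector part has stem [- c], so the symmetrization is induced by the
    scalar [c . c]. *)
Lemma symmetrization_stem z1 : D z1 -> dot3 (c z1) (c z1) != 0 ->
  symmetrization_neq0 Omega gv.
Proof.
move=> Dz1 n0; pose B' z : Bq := (0, opp3 (c z)).
have sB' : symB Omega B'.
  move=> z Dz; rewrite /B' sym_c //.
  by apply: bq_eq; [|apply: triple_eq]; rewrite /= ?conjC0 // conjCN.
have iB' := from_stem_induced sB'.
exists (from_stem B').
  have [st ind] := slice_regular_of_stem bq_hol_c symB_c ind_c.
  exists (reB \o (fun w => (0, c w))), (imB \o (fun w => (0, c w))); split => //.
  move=> I a b hI Oz; rewrite (iB' I (a, b) hI Oz) /B'.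
  by apply: quatP => /=; ring.
have hI := @quatI_unit R; have Oz := (stem_domP circ_Omega z1 hI).1 Dz1.
exists (ptI quatI z1) => //.
rewrite (star_mul_induced circ_Omega ind_c iB' hI Oz) /B'.
apply: contra n0 => /eqP E; apply/eqP.
have E1 := congr1 (@qre R) E; have E2 := congr1 (@qi R) E.
move: E1 E2; rewrite /= /dot3 => E1 E2.
apply: cplxP => /=; move: E1 E2; lra.
Qed.

Lemma Delta_factor_stem J z0 m ft : imag_units J -> Delta_factor Omega gv (ptI J z0) m ft ->
  exists t : C -> Bq, [/\ forall z, D z -> bq_hol t z, inducedB Omega t ft &
    forall z, D z -> (0, c z) = scaleB (delta z0 z ^+ m) (t z)].
Proof.
move=> hJ [reg E]; have [t [ht _ it]] := slice_regular_stem oOmega circ_Omega reg.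
exists t; split => // z Dz; apply: ev_inj => I hI.
have Oz := (stem_domP circ_Omega z hI).1 Dz.
by rewrite -(ind_c hI Oz) E // (it _ _ hI Oz) Delta_ev // ev_scale_pow.
Qed.

Lemma delta_near z0 : z0.2 != 0 -> \forall w \near z0, w != z0 -> delta z0 w != 0.
Proof.
move=> z02; have nc : z0 - conjC z0 != 0.
  rewrite subr_eq0; apply/eqP => /(congr1 snd) /= h.
  by case/eqP: z02; lra.
have k : {for z0, continuous (fun w => w - conjC z0)}.
  by apply: hol_cont; apply: holB; [exact: hol_id|exact: hol_cst].
have n : \forall w \near z0, w - conjC z0 != 0 by apply: (cvgr_neq0 _ k).
by apply: filterS n => w h wz; rewrite mulf_neq0 // subr_eq0.
Qed.

(** The quotient of [c] by the largest power of [Delta] gives the direction. Were it isotropic at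
    [z0], [ev_eq0] would produce a unit [J] with the quotient zero at [ptI J z0], a non-real
    isolated zero. *)
Lemma nonreal_direction z0 : D z0 -> z0.2 != 0 ->
  symmetrization_neq0 Omega gv ->
  (forall q, ~ nonreal_isolated_zero Omega gv q) ->
  ~ (\forall w \near z0, dot3 (c w) (c w) = 0) ->
  exists t : C -> C3, [/\ hol3 t z0, dot3 (t z0) (t z0) != 0 &
    \forall w \near z0, par3 (t w) (c w)].
Proof.
move=> Dz0 z02 sym iso n0; have nD := near_stem_dom oOmega circ_Omega Dz0.
have hI := @quatI_unit R.
have [//|[k [U [hU U0 EU]]]] := hol_order (hol3_dot (hol_c Dz0) (hol_c Dz0)).
pose P m := `[< exists ft, Delta_factor Omega gv (ptI quatI z0) m ft >].
have bound m : P m -> (m <= k)%N.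
  move=> /asboolP [ft /(Delta_factor_stem hI) [t [ht it et]]].
  have hs : hol (fun w => (w - conjC z0) ^+ (m * 2) * dot3 (t w).2 (t w).2) z0.
    apply: holM; last by have [_ h] := ht _ Dz0; exact: hol3_dot.
    by apply: holX; apply: holB; [exact: hol_id|exact: hol_cst].
  have : (m * 2 <= k)%N.
    apply: (order_bound EU _ (hol_cont hU) (hol_cont hs) U0).
    apply: filterS nD => w Dw; have /(congr1 snd) /= -> := et w Dw.
    by rewrite !exprM mulrA -exprMn -exprMn -/(delta z0 w) /dot3 /=; ring.
  by apply: leq_trans; rewrite leq_pmulr.
have P0 : exists m, P m.
  exists 0%N; apply/asboolP; exists gv; split.
    by apply: (@stem_slice_regular _ _ _ gv bq_hol_c symB_c ind_c).
  by move=> q _; rewrite expr0 mul1r.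
case: (ex_maxnP P0 bound) => m /asboolP [ft dft] mmax.
have [t [ht it et]] := Delta_factor_stem hI dft.
have [ht1 ht2] := ht _ Dz0.
exists (fun w => (t w).2); split => //; last first.
  near=> w; have Dw : D w by near: w.
  have /(congr1 snd) /= -> := et w Dw.
  by split => /=; ring.
(* [Delta] depends only on the sphere, so the power maximal at the point of [quatI] is maximal at
   the point of [J] too. *)
have DeltaE J : imag_units J -> Delta (ptI J z0) = Delta (ptI quatI z0).
  move=> hJ; apply/funext => q; rewrite /Delta !norm_ptI //.
  by rewrite !qre_ptI.
(* The scalar part of the quotient vanishes off [z0], where [delta] is invertible, and at [z0] by
   continuity. *)
have t10 : (t z0).1 = 0.
  apply: (@punctured_eq0 R (fun w => (t w).1)); first exact: hol_cont.
  have nd := delta_near z02.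
  near=> w => wz; have Dw : D w by near: w.
  have dw : w != z0 -> delta z0 w != 0 by near: w.
  have /(congr1 fst) /= /esym/eqP := et w Dw.
  by rewrite mulf_eq0 expf_eq0 (negbTE (dw wz)) andbF /= => /eqP.
apply/eqP => N0; have /ev_eq0 [J hJ eJ] : (t z0).1 ^+ 2 + dot3 (t z0).2 (t z0).2 = 0.
  by rewrite t10 N0 expr0n addr0.
have OJ := (stem_domP circ_Omega z0 hJ).1 Dz0.
apply: (iso (ptI J z0)); split => //; first exact: ptI_nonreal.
exists m, ft; split.
- by case: dft => r E; split => // q Oq; rewrite DeltaE // E.
- move=> m' ft' [r' E']; apply: mmax; apply/asboolP; exists ft'.
  by split => // q Oq; rewrite -(DeltaE J hJ) E'.
- by rewrite (it _ _ hJ OJ).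
Unshelve. all: by end_near. Qed.

End VectorStem.

(** * Global logarithms *)

(** Paths and homotopies are pushed into [A] by [p] and pulled back by [r]. Only [r (p z) = z] is
    required, so [p] need not be shown to be a homeomorphism. *)
Lemma retract_simply_connected (R : realType) (T U : topologicalType) (p : T -> U)
    (r : U -> T) (E : set T) (A : set U) :
  continuous p -> continuous r -> (forall z, E z -> A (p z)) ->
  (forall q, A q -> E (r q)) -> (forall z, E z -> r (p z) = z) ->
  simply_connected (R := R) A -> simply_connected (R := R) E.
Proof.
move=> cp cr pE rA rp [pc sc].
have comp (P : topologicalType) (K : set P) (X Y : topologicalType) (f : P -> X)
    (g : X -> Y) : continuous g -> {within K, continuous f} ->
    {within K, continuous (g \o f)}.
  move=> cg /cont_onP cf; apply/cont_onP => k Kk.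
  exact: (cont_cvg (cg _) (cf k Kk)).
split.
  move=> x y Ex Ey; have [c [[cc Ac] c0 c1]] := pc (p x) (p y) (pE _ Ex) (pE _ Ey).
  exists (r \o c); split; rewrite /= ?c0 ?c1 ?rp //.
  by split; [exact: comp|move=> t /Ac /rA].
move=> c [cc Ec] c01; have pin : path_in A (p \o c).
  by split; [exact: comp|move=> t /Ec /pE].
have e01 : (p \o c) 0 = (p \o c) 1 by rewrite /= c01.
have [h [ch Ah h0 h1 hs]] := sc _ pin e01.
have I0 : `[0 : R, 1 : R]%classic 0 by rewrite /= in_itv /= lexx ler01.
exists (r \o h); split.
- exact: comp.
- by move=> s t Is It; apply/rA/Ah.
- by move=> t It; rewrite /= h0 // /= rp //; exact: Ec.
- by move=> t It; rewrite /= h1 // /= rp //; exact: Ec.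
- by move=> s Is; have [a b] := hs s Is; rewrite /= a b /= rp //; exact: Ec.
Qed.

Section SlicePlane.
Context {R : realType}.
Local Notation H := (quat R).
Local Notation C := (cplx R).
Implicit Types (I : H) (z : C).

(** Real part and Euclidean inner product with [I]: a left inverse of [ptI I], defined on all
    quaternions. *)
Definition slice_coord I (q : H) : C :=
  (qre q, qi I * qi q + qj I * qj q + qk I * qk q).

Lemma slice_coord_cont I : continuous (slice_coord I).
Proof.
have k (g : H -> R) q : continuous g -> g x @[x --> q] --> g q by move=> cg; exact: cg.
move=> q; have FF : Filter (nbhs q) := nbhs_filter q.
apply: cvg_cplx => /=; first exact: (k _ _ qre_cont).
have c (a : R) (g : H -> R) : continuous g -> (fun x => a * g x) @ q --> a * g q.
  by move=> cg; apply: cvgM; [exact: cvg_cst|exact: k].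
by apply: cvgD; [apply: cvgD|]; apply: c; [exact: qi_cont|exact: qj_cont|exact: qk_cont].
Qed.

Lemma slice_coordK I z : imag_units I -> slice_coord I (ptI I z) = z.
Proof.
move=> /imag_unitsP [h0 h1]; apply: cplxP => /=; first by rewrite h0; ring.
transitivity (z.2 * (qi I ^+ 2 + qj I ^+ 2 + qk I ^+ 2)); first by ring.
by rewrite h1 mulr1.
Qed.

Lemma quat_slice (q : H) : exists I z, imag_units I /\ q = ptI I z.
Proof.
have nim : `|qim q| ^+ 2 = qi q ^+ 2 + qj q ^+ 2 + qk q ^+ 2.
  by rewrite [`|_|]/(qnorm _) qnorm_sqr /qnormsq /= expr0n /= add0r.
case: (eqVneq (qim q) 0) => [e|ne].
  exists quatI, (qre q, 0); split; first exact: quatI_unit.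
  have e1 := congr1 (@qi R) e; have e2 := congr1 (@qj R) e; have e3 := congr1 (@qk R) e.
  rewrite /= in e1 e2 e3.
  by apply: quatP; rewrite /= ?e1 ?e2 ?e3; ring.
have n0 : `|qim q| != 0 by rewrite normr_eq0.
exists (`|qim q|^-1 *: qim q), (qre q, `|qim q|); split.
  apply/imag_unitsP; split; first by rewrite /= mulr0.
  rewrite /= !exprMn -!mulrDr -nim -exprMn mulVf ?expr1n //.
have e : `|qim q| *: (`|qim q|^-1 *: qim q) = qim q.
  by rewrite scalerA divff // scale1r.
by rewrite /ptI /slice_pt /= e; apply: quatP => /=; ring.
Qed.

End SlicePlane.

Section BiquaternionLog.
Context {R : realType}.
Local Notation C := (cplx R).
Local Notation C3 := (C * C * C)%type.
Local Notation Bq := (C * C3)%type.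

(** Conjugation changes the sign of [i] and so exchanges the two idempotents, whence the swapped
    coordinates. *)
Lemma conjB_lin2 (v : C3) (a b : C) :
  conjB (lin2 v a b) = lin2 (conj3 v) (conjC b) (conjC a).
Proof.
have ch : conjC (ofR (1 / 2)) = ofR (1 / 2) :> C by apply: cplxP; rewrite //= oppr0.
have ci := @conjC_iC R.
apply: bq_eq; first by rewrite /= conjCM ch conjCD; ring.
by apply: triple_eq; rewrite /= !(conjCM, conjCN, conjCD) ch ci; ring.
Qed.

Lemma dot3_conj (u v : C3) : dot3 (conj3 u) (conj3 v) = conjC (dot3 u v).
Proof. by rewrite /dot3 /= !(conjCD, conjCM). Qed.

Lemma biexp_conj (F G : Bq) : biexp F G -> biexp (conjB F) (conjB G).
Proof.
case=> [[A [B [v [v1 -> ->]]]]|[A [n [n0 -> ->]]]].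
  left; exists (conjC B), (conjC A), (conj3 v); split.
  - by rewrite dot3_conj v1 conjC1.
  - exact: conjB_lin2.
  - by rewrite conjB_lin2 !cexp_conj.
right; exists (conjC A), (conj3 n); split => //.
- by rewrite dot3_conj n0 conjC0.
- rewrite cexp_conj; apply: bq_eq => //.
  by apply: triple_eq; rewrite /= conjCM.
Qed.

Lemma lin2_cexp (A B c0 T : C) (v : C3) :
  cexp A = c0 + iC * T -> cexp B = c0 - iC * T ->
  lin2 v (cexp A) (cexp B) = (c0, scale3 T v).
Proof.
move=> -> ->; have hh := @half_sum R; have ii := @iC_sqr R.
have two x : ofR (1 / 2) * (x + x) = x :> C by rewrite mulrDr -mulrDl hh mul1r.
apply: bq_eq; first by rewrite /= -[RHS]two; apply: (congr1 (fun x => ofR (1 / 2) * x)); ring.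
apply: (congr1 (scale3^~ v)); rewrite /=.
transitivity (- (iC * iC) * (ofR (1 / 2) * (T + T))); first by ring.
by rewrite ii opprK mul1r two.
Qed.

Lemma bq_hol_lin2 (v : C -> C3) (A B : C -> C) z : hol3 v z -> hol A z -> hol B z ->
  bq_hol (fun w => lin2 (v w) (A w) (B w)) z.
Proof.
move=> hv hA hB; split.
  by apply: holM; [exact: hol_cst|exact: holD].
apply: hol3_scale => //; apply: holM; first exact: hol_cst.
exact: holB.
Qed.

Lemma direction_scale (c v : C3) : dot3 v v = 1 -> par3 v c -> c = scale3 (dot3 c v) v.
Proof.
move=> v1 /par3C /par3_dot; rewrite v1 => <-.
by apply: triple_eq; rewrite /= mul1r.
Qed.

Lemma dot3_direction (c v : C3) : dot3 v v = 1 -> c = scale3 (dot3 c v) v ->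
  dot3 c c = dot3 c v ^+ 2.
Proof.
move=> v1 e; rewrite {1 2}e; set a := dot3 c v.
have -> : dot3 (scale3 a v) (scale3 a v) = a ^+ 2 * dot3 v v by rewrite /dot3 /=; ring.
by rewrite v1 mulr1.
Qed.

Lemma norm_factor (c0 T : C) : c0 ^+ 2 + T ^+ 2 = (c0 + iC * T) * (c0 - iC * T).
Proof.
transitivity (c0 ^+ 2 - (iC * iC) * T ^+ 2); last by ring.
by rewrite iC_sqr mulN1r opprK.
Qed.

Section OnSimplyConnected.
Variables (E : set C) (c0 : C -> C) (c : C -> C3).
Hypothesis oE : open E.
Hypothesis scE : simply_connected (R := R) E.
Hypothesis E0 : E !=set0.
Hypothesis hc0 : forall z, E z -> hol c0 z.
Hypothesis hc : forall z, E z -> hol3 c z.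
Hypothesis nz : forall z, E z -> c0 z ^+ 2 + dot3 (c z) (c z) != 0.

Lemma flat_log : (forall z, E z -> dot3 (c z) (c z) = 0) ->
  exists F : C -> Bq, forall z, E z -> bq_hol F z /\ biexp (F z) (c0 z, c z).
Proof.
move=> S0; have c00 z : E z -> c0 z != 0.
  by move=> Ez; have := nz Ez; rewrite S0 // addr0 expf_eq0.
have [A hA] := hol_log oE hc0 c00 scE E0.
exists (fun z => (A z, scale3 (c0 z)^-1 (c z))) => z Ez; have [h e] := hA z Ez; split.
  split => //; apply: hol3_scale; last exact: hc.
  by apply: holV; [exact: c00|exact: hc0].
right; exists (A z), (scale3 (c0 z)^-1 (c z)); split => //.
  have -> : dot3 (scale3 (c0 z)^-1 (c z)) (scale3 (c0 z)^-1 (c z)) =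
     (c0 z)^-1 ^+ 2 * dot3 (c z) (c z) by rewrite /dot3 /=; ring.
  by rewrite S0 // mulr0.
rewrite e; apply: bq_eq => //; apply: triple_eq; rewrite /= mulrA divff ?mul1r //;
  exact: c00.
Qed.

Lemma direction_log (v : C -> C3) :
  (forall z, E z -> [/\ hol3 v z, dot3 (v z) (v z) = 1 &
     c z = scale3 (dot3 (c z) (v z)) (v z)]) ->
  exists A B : C -> C, forall z, E z -> [/\ hol A z, hol B z,
    cexp (A z) = c0 z + iC * dot3 (c z) (v z) &
    cexp (B z) = c0 z - iC * dot3 (c z) (v z)].
Proof.
move=> hv; pose T z := dot3 (c z) (v z).
have hT z : E z -> hol T z by move=> Ez; have [h _ _] := hv z Ez; apply: hol3_dot => //; exact: hc.
have hiT z : E z -> hol (fun w => iC * T w) z.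
  by move=> Ez; apply: holM; [exact: hol_cst|exact: hT].
have n z : E z -> (c0 z + iC * T z) * (c0 z - iC * T z) != 0.
  move=> Ez; have [_ v1 e] := hv z Ez; rewrite -norm_factor -(dot3_direction v1 e).
  exact: nz.
have hp z : E z -> hol (fun w => c0 w + iC * T w) z.
  by move=> Ez; apply: holD; [exact: hc0|exact: hiT].
have hm z : E z -> hol (fun w => c0 w - iC * T w) z.
  by move=> Ez; apply: holB; [exact: hc0|exact: hiT].
have np z : E z -> c0 z + iC * T z != 0.
  by move=> /n; rewrite mulf_eq0 negb_or => /andP[].
have nm z : E z -> c0 z - iC * T z != 0.
  by move=> /n; rewrite mulf_eq0 negb_or => /andP[].
have [A hA] := hol_log oE hp np scE E0.
have [B hB] := hol_log oE hm nm scE E0.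
by exists A, B => z Ez; have [a b] := hA z Ez; have [d e] := hB z Ez.
Qed.

Lemma nonflat_isolated : (forall z, E z -> ~ \forall w \near z, dot3 (c w) (c w) = 0) ->
  forall z, E z -> \forall w \near z, w != z -> dot3 (c w) (c w) != 0.
Proof.
move=> nf z Ez; apply: (@hol_punctured R (fun w => dot3 (c w) (c w))).
  by apply: hol3_dot; exact: hc.
exact: nf.
Qed.

Lemma global_direction :
  (forall z, E z -> ~ \forall w \near z, dot3 (c w) (c w) = 0) ->
  (forall z, E z -> exists t : C -> C3, [/\ hol3 t z, dot3 (t z) (t z) != 0 &
    \forall w \near z, par3 (t w) (c w)]) ->
  exists v : C -> C3, forall z, E z -> direction_germ E c z v.
Proof.
move=> nf ld; apply: (hol_direction oE (nonflat_isolated nf)) => //.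
move=> z Ez; have [t [ht n p]] := ld z Ez.
by have [w [hw _ ew]] := normalize_direction ht n p; exists w.
Qed.

Lemma direction_germ_log (v : C -> C3) : (forall z, E z -> direction_germ E c z v) ->
  forall z, E z -> [/\ hol3 v z, dot3 (v z) (v z) = 1 &
     c z = scale3 (dot3 (c z) (v z)) (v z)].
Proof.
move=> hv z Ez; have [_ h /nbhs_singleton [v1 p]] := hv z Ez; split => //.
exact: direction_scale.
Qed.

Lemma nonflat_log :
  (forall z, E z -> ~ \forall w \near z, dot3 (c w) (c w) = 0) ->
  (forall z, E z -> exists t : C -> C3, [/\ hol3 t z, dot3 (t z) (t z) != 0 &
    \forall w \near z, par3 (t w) (c w)]) ->
  exists F : C -> Bq, forall z, E z -> bq_hol F z /\ biexp (F z) (c0 z, c z).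
Proof.
move=> nf ld; have [v hv] := global_direction nf ld.
have dv := direction_germ_log hv; have [A [B hAB]] := direction_log dv.
exists (fun z => lin2 (v z) (A z) (B z)) => z Ez.
have [hA hB eA eB] := hAB z Ez; have [h v1 e] := dv z Ez.
split; first exact: bq_hol_lin2.
left; exists (A z), (B z), (v z); split => //.
by rewrite (lin2_cexp _ eA eB) -e.
Qed.

End OnSimplyConnected.

End BiquaternionLog.

(** * Logarithms symmetric under conjugation *)

Section StemLogarithm.
Context {R : realType}.
Local Notation H := (quat R).
Local Notation C := (cplx R).
Local Notation C3 := (C * C * C)%type.
Local Notation Bq := (C * C3)%type.
Implicit Types (I J : H) (z : C).
Variable Omega : set H.
Hypothesis oOmega : open Omega.
Hypothesis circ_Omega : circular Omega.
Local Notation D := (stem_dom Omega : set C).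
Variables (c0 : C -> C) (c : C -> C3) (gv : H -> H).
Hypothesis hol_c0 : forall z, D z -> hol c0 z.
Hypothesis hol_c : forall z, D z -> hol3 c z.
Hypothesis sym_c0 : forall z, D z -> c0 (conjC z) = conjC (c0 z).
Hypothesis sym_c : forall z, D z -> c (conjC z) = conj3 (c z).
Hypothesis nz : forall z, D z -> c0 z ^+ 2 + dot3 (c z) (c z) != 0.
Hypothesis ind_c : inducedB Omega (fun w => (0, c w)) gv.
Hypothesis no_zero : forall q, ~ nonreal_isolated_zero Omega gv q.

Definition flat z := \forall w \near z, dot3 (c w) (c w) = 0.

Definition stem_log (F : C -> Bq) : Prop :=
  [/\ forall z, D z -> bq_hol F z, symB Omega F &
      forall z, D z -> biexp (F z) (c0 z, c z)].

Lemma flat_spread (E : set C) z1 : path_connected (R := R) E -> E `<=` D ->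
  E z1 -> flat z1 -> forall z, E z -> flat z.
Proof.
move=> pc ED Ez1 f1 z Ez.
apply: (identity_principle (S := fun w => dot3 (c w) (c w)) pc _ Ez1 f1 Ez).
by move=> w /ED Dw; apply: hol3_dot; exact: hol_c.
Qed.

Lemma local_direction z : D z -> ~ flat z ->
  exists t : C -> C3, [/\ hol3 t z, dot3 (t z) (t z) != 0 &
    \forall w \near z, par3 (t w) (c w)].
Proof.
move=> Dz nf; have nD := near_stem_dom oOmega circ_Omega Dz.
case: (eqVneq z.2 0) => z2.
  apply: real_direction => //; first exact: hol_c.
  by apply: filterS nD => w; exact: sym_c.
apply: (nonreal_direction oOmega circ_Omega hol_c sym_c ind_c) => //.
(* If the symmetrization vanished identically, so would [c . c], against the assumption that [z] is
   not flat. *)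
apply: contrapT => ns; apply: nf; apply: filterS nD => w Dw.
apply/eqP/negPn/negP => n0; apply: ns.
exact: (symmetrization_stem circ_Omega hol_c sym_c ind_c Dw).
Qed.

(** The second logarithm is the reflection of [A], not one chosen independently: the symmetry of
    [c0] and [c . v] makes it a logarithm of [c0 - i (c . v)]. As conjugation swaps the coordinates
    of [lin2], symmetry holds with no multiple of [2 pi i] to adjust. *)
Lemma symmetric_log (v : C -> C3) : simply_connected (R := R) D -> D !=set0 ->
  (forall z, D z -> [/\ hol3 v z, dot3 (v z) (v z) = 1 &
     c z = scale3 (dot3 (c z) (v z)) (v z)]) ->
  (forall z, D z -> v (conjC z) = conj3 (v z)) ->
  exists F, stem_log F.
Proof.
move=> scD D0 dv sv; have oD := stem_dom_open oOmega circ_Omega.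
have [A [B hAB]] := direction_log oD scD D0 hol_c0 hol_c nz dv.
have Dc := stem_dom_conj circ_Omega.
exists (fun z => lin2 (v z) (A z) (conjC (A (conjC z)))); split => z Dz.
- have [hv _ _] := dv z Dz; have [hA _ _ _] := hAB z Dz.
  apply: bq_hol_lin2 => //; have [hA' _ _ _] := hAB _ (Dc _ Dz).
  by have := hol_conj hA'; rewrite conjCK.
- by rewrite conjB_lin2 !conjCK sv.
- have [_ v1 e] := dv z Dz; have [_ _ eA _] := hAB z Dz.
  have [_ _ eA' _] := hAB _ (Dc _ Dz).
  left; exists (A z), (conjC (A (conjC z))), (v z); split => //.
  rewrite (@lin2_cexp R _ _ (c0 z) (dot3 (c z) (v z))) -?e //.
  rewrite cexp_conj eA' sv // sym_c // sym_c0 // dot3_conj.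
  by rewrite conjCD conjCM !conjCK conjC_iC mulNr.
Qed.

Lemma conj_direction (v : C -> C3) : (forall z, D z -> direction_germ D c z v) ->
  forall z, D z -> direction_germ D c z (fun w => conj3 (v (conjC w))).
Proof.
move=> hv z Dz; have Dc := stem_dom_conj circ_Omega.
have nD := near_stem_dom oOmega circ_Omega Dz.
have k (f : C -> C) : hol f (conjC z) -> hol (conjC \o f \o conjC) z.
  by move=> /hol_conj; rewrite conjCK.
have [_ [h1 h2 h3] _] := hv _ (Dc _ Dz); split => //.
  by split; [exact: (k _ h1)|exact: (k _ h2)|exact: (k _ h3)].
apply: filterS nD => w Dw; have [_ _ /nbhs_singleton [v1 [p1 p2 p3]]] := hv _ (Dc _ Dw).
rewrite dot3_conj v1 conjC1; split => //.
have ec : c w = conj3 (c (conjC w)).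
  by rewrite sym_c //; apply: triple_eq; rewrite /= conjCK.
by rewrite ec; split; rewrite /= -!conjCM ?p1 ?p2 ?p3.
Qed.

(** Otherwise [v x0] would be purely imaginary and its square nonpositive. *)
Lemma conj_direction_neq_opp (v : C -> C3) x0 : x0.2 = 0 -> dot3 (v x0) (v x0) = 1 ->
  conj3 (v (conjC x0)) <> opp3 (v x0).
Proof.
move=> x2; have -> : conjC x0 = x0 by apply: cplxP; rewrite //= x2 oppr0.
case: (v x0) => [[[a a'] [b b']] [d d']] v1 e.
have E1 := congr1 (fun x : C3 => x.1.1.1) e.
have E2 := congr1 (fun x : C3 => x.1.2.1) e.
have E3 := congr1 (fun x : C3 => x.2.1) e.
have := congr1 fst v1; rewrite /dot3 /=; rewrite /= in E1 E2 E3.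
have s1 := sqr_ge0 a'; have s2 := sqr_ge0 b'; have s3 := sqr_ge0 d'.
have -> : a = 0 by lra.
have -> : b = 0 by lra.
have -> : d = 0 by lra.
by rewrite !mulr0; lra.
Qed.

(** On the real axis [c] is real, so [c . c = 0] forces [c = 0] there, and the identity principle
    spreads it to [D]. *)
Lemma flat_real_slice x0 : path_connected (R := R) D -> D x0 -> x0.2 = 0 ->
  flat x0 -> forall z, D z -> c z = 0.
Proof.
move=> pc Dx0 x2 fx.
have k : ofR s @[s --> (0 : R)] --> (0 : C).
  exact: (@ofR_cvg R).
have kx : (fun s : R => x0 + ofR s) @ (0 : R) --> x0.
  rewrite -[X in _ --> X](addr0 x0); apply: cvgD; [exact: cvg_cst|exact: k].
have nf : \forall s \near (0 : R), dot3 (c (x0 + ofR s)) (c (x0 + ofR s)) = 0 := kx _ fx.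
have nD : \forall s \near (0 : R), D (x0 + ofR s) := kx _ (near_stem_dom oOmega circ_Omega Dx0).
have c00 : \forall s \near (0 : R), c (x0 + ofR s) = 0.
  near=> s; have f : dot3 (c (x0 + ofR s)) (c (x0 + ofR s)) = 0 by near: s.
  have Dw : D (x0 + ofR s) by near: s.
  have := sym_c Dw; set w := x0 + ofR s in f Dw *.
  have -> : conjC w = w by apply: cplxP; rewrite //= x2 addr0 oppr0.
  move: f; case: (c w) => [[[a a'] [b b']] [d d']] f e.
  have E1 := congr1 (fun x : C3 => x.1.1.2) e.
  have E2 := congr1 (fun x : C3 => x.1.2.2) e.
  have E3 := congr1 (fun x : C3 => x.2.2) e.
  have := congr1 fst f; rewrite /dot3 /=; rewrite /= in E1 E2 E3.
  have z1 : a' = 0 by lra.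
  have z2 : b' = 0 by lra.
  have z3 : d' = 0 by lra.
  rewrite z1 z2 z3 !mulr0 !subr0 -!expr2 => F.
  have s1 := sqr_ge0 a; have s2 := sqr_ge0 b; have s3 := sqr_ge0 d.
  have -> : a = 0 by apply/eqP; rewrite -sqrf_eq0; apply/eqP; lra.
  have -> : b = 0 by apply/eqP; rewrite -sqrf_eq0; apply/eqP; lra.
  have -> : d = 0 by apply/eqP; rewrite -sqrf_eq0; apply/eqP; lra.
  by [].
have zero (f : C3 -> C) : (forall z, D z -> hol (f \o c) z) -> f 0 = 0 ->
    forall z, D z -> f (c z) = 0.
  move=> hf f0 z Dz.
  have n0 : \forall w \near x0, (f \o c) w = 0.
    apply: hol_real_line; first exact: hf.
    by apply: filterS c00 => s /= ->.
  have := identity_principle pc hf Dx0 n0 Dz.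
  exact: nbhs_singleton.
move=> z Dz; apply: triple_eq.
- by apply: (zero (fun x => x.1.1)) => // w Dw; have [] := hol_c Dw.
- by apply: (zero (fun x => x.1.2)) => // w Dw; have [] := hol_c Dw.
- by apply: (zero (fun x => x.2)) => // w Dw; have [] := hol_c Dw.
Unshelve. all: by end_near. Qed.

Lemma slice_log x0 : simply_connected (R := R) D -> D x0 -> x0.2 = 0 ->
  exists F, stem_log F.
Proof.
move=> scD Dx0 x2; have [pc _] := scD; have oD := stem_dom_open oOmega circ_Omega.
have D0 : D !=set0 by exists x0.
have [f0|nf0] := pselect (flat x0).
  have c00 := flat_real_slice pc Dx0 x2 f0.
  (* As [c] vanishes identically, any constant real unit vector serves as direction. *)
  apply: (@symmetric_log (fun=> (1, 0, 0))) => // z Dz.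
  - split.
    + by split; exact: hol_cst.
    + by rewrite /dot3 /= mulr1 !mulr0 !addr0.
    + by rewrite c00 //; apply: triple_eq; rewrite /dot3 /= ?mul0r ?addr0 ?mul0r.
  - by apply: triple_eq; rewrite /= ?conjC1 ?conjC0.
have nf z : D z -> ~ flat z.
  by move=> Dz fz; apply: nf0; exact: (flat_spread pc _ Dz fz Dx0).
have [v hv] := global_direction oD scD D0 hol_c nf (fun z Dz => local_direction Dz (nf z Dz)).
have dv := direction_germ_log hv.
apply: (symmetric_log scD D0 dv).
have iso := nonflat_isolated hol_c nf.
have cov : covering D (direction_germ D c).
  by apply: direction_covering => // z Dz; exists v; exact: hv.
have hv' := conj_direction hv.
(* The reflected direction agrees with [v] up to sign; the real point fixes the sign, and uniqueness
   of sections extends the equality to [D]. *)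
have e0 : conj3 (v (conjC x0)) = v x0.
  case: (direction_germ_pm iso (hv' x0 Dx0) (hv x0 Dx0)) => // e.
  by have [_ v1 _] := dv x0 Dx0; case: (conj_direction_neq_opp x2 v1 e).
move=> z Dz; have := section_unique cov pc hv' hv Dx0 e0.
by move=> /(_ _ Dz) <-; apply: triple_eq; rewrite /= conjCK.
Qed.

Lemma product_log : (forall z, D z -> z.2 != 0) -> D !=set0 ->
  simply_connected (R := R) (D `&` [set z : C | 0 < z.2]) -> exists F, stem_log F.
Proof.
set E := D `&` _ => noreal [z0 Dz0] scE; have [pc _] := scE.
have Dc := stem_dom_conj circ_Omega.
have oE : open E.
  apply: openI; first exact: (stem_dom_open oOmega circ_Omega).
  have -> : [set z : C | 0 < z.2] = snd @^-1` [set x : R | 0 < x] by [].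
  apply: open_comp; last exact: open_gt.
  by move=> z _; exact: cvg_snd.
have lower z : D z -> ~~ (0 < z.2) -> E (conjC z).
  move=> Dz z2; split; first exact: Dc.
  by rewrite /= oppr_gt0 lt_neqAle noreal // leNgt.
have E0 : E !=set0.
  by case: (boolP (0 < z0.2)) => h; [exists z0|exists (conjC z0); exact: lower].
have ED : E `<=` D by move=> z [].
have hc0 z : E z -> hol c0 z by move=> /ED; exact: hol_c0.
have hc z : E z -> hol3 c z by move=> /ED; exact: hol_c.
have nzE z : E z -> c0 z ^+ 2 + dot3 (c z) (c z) != 0 by move=> /ED; exact: nz.
have [F hF] : exists F : C -> Bq, forall z, E z -> bq_hol F z /\ biexp (F z) (c0 z, c z).
  have [[z1 [Ez1 f1]]|nf] := pselect (exists z1, E z1 /\ flat z1).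
    apply: flat_log => // z Ez; have := flat_spread pc ED Ez1 f1 Ez.
    exact: nbhs_singleton.
  have nfz z : E z -> ~ flat z by move=> Ez fz; apply: nf; exists z.
  apply: nonflat_log => // z Ez; apply: local_direction; [exact: ED|exact: nfz].
(* The domain misses the real axis, so its two halves are open and the reflected values need no
   matching. *)
pose G z := if 0 < z.2 then F z else conjB (F (conjC z)).
have up (z : C) : 0 < z.2 -> \forall w \near z, 0 < w.2.
  move=> z2; have cs : (w.2 @[w --> z] --> z.2) by exact: cvg_snd.
  exact: (cvgr_gt _ cs).
have down (z : C) : z.2 < 0 -> \forall w \near z, w.2 < 0.
  move=> z2; have cs : (w.2 @[w --> z] --> z.2) by exact: cvg_snd.
  exact: (cvgr_lt _ cs).
exists G; split => z Dz.
- case: (boolP (0 < z.2)) => z2.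
    have [[h0 [h1 h2 h3]] _] : bq_hol F z /\ biexp (F z) (c0 z, c z) by exact: hF.
    have e : \forall w \near z, F w = G w by apply: filterS (up z z2) => w; rewrite /G => ->.
    split; first by apply: hol_eq h0; apply: filterS e => w ->.
    by split; [apply: hol_eq h1|apply: hol_eq h2|apply: hol_eq h3]; apply: filterS e => w ->.
  have [[h0 [h1 h2 h3]] _] := hF _ (lower z Dz z2).
  have z2' : z.2 < 0 by rewrite lt_neqAle noreal // leNgt.
  have e : \forall w \near z, conjB (F (conjC w)) = G w.
    by apply: filterS (down z z2') => w w2; rewrite /G ltNge ltW.
  have k (f : C -> C) : hol f (conjC z) -> hol (conjC \o f \o conjC) z.
    by move=> /hol_conj; rewrite conjCK.
  split; first by apply: hol_eq (k _ h0); apply: filterS e => w <-.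
  by split; [apply: hol_eq (k _ h1)|apply: hol_eq (k _ h2)|apply: hol_eq (k _ h3)];
    apply: filterS e => w <-.
- rewrite /G /= oppr_gt0 conjCK; case: (ltrgt0P z.2) (noreal z Dz) => //= _ _.
  by apply: bq_eq; [|apply: triple_eq]; rewrite /= conjCK.
- rewrite /G; case: ifPn => z2; first by have [] := hF z (conj Dz z2).
  have [_ /biexp_conj] := hF _ (lower z Dz z2).
  rewrite /conjB /= sym_c0 // sym_c // conjCK.
  by have -> : conj3 (conj3 (c z)) = c z by apply: triple_eq; rewrite /= conjCK.
Qed.

End StemLogarithm.

(** * Transfer of the topological hypotheses to the stem plane *)

Section Assembly.
Context {R : realType}.
Local Notation H := (quat R).
Local Notation C := (cplx R).
Variable Omega : set H.
Hypothesis circ_Omega : circular Omega.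
Local Notation D := (stem_dom Omega : set C).

Lemma stem_dom_slice_sc I : imag_units I ->
  simply_connected (R := R) (Omega `&` slice I) -> simply_connected (R := R) D.
Proof.
move=> hI; apply: (retract_simply_connected (p := @ptI R I) (r := slice_coord I)).
- exact: slice_pt_cont.
- exact: slice_coord_cont.
- move=> z /(stem_domP circ_Omega z hI) Oz; split => //.
  by exists z.1 => //; exists z.2.
- move=> q [Oq [a _ [b _ e]]]; rewrite -e -[slice_pt I a b]/(ptI I (a, b)) slice_coordK //.
  by exists I; rewrite //= e.
- by move=> z _; exact: slice_coordK.
Qed.

Lemma stem_dom_half_sc I : imag_units I -> product_domain Omega ->
  simply_connected (R := R) (Omega `&` half_slice I) ->
  simply_connected (R := R) (D `&` [set z : C | 0 < z.2]).
Proof.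
move=> hI noreal.
apply: (retract_simply_connected (p := @ptI R I) (r := slice_coord I)).
- exact: slice_pt_cont.
- exact: slice_coord_cont.
- move=> z [/(stem_domP circ_Omega z hI) Oz z2]; split => //.
  by exists z.1 => //; exists z.2 => //; exact: ltW.
- move=> q [Oq [a _ [b b0 e]]]; rewrite -e -[slice_pt I a b]/(ptI I (a, b)) slice_coordK //.
  split; first by exists I; rewrite //= e.
  (* The closed half-slice meets a product domain only at positive ordinates, since ordinate 0 would
     give a real point. *)
  rewrite /= lt_neqAle eq_sym b0 andbT; apply/eqP => bz.
  suff : (Omega `&` realq) q by rewrite noreal.
  by split => //; exists a => //; rewrite -e bz /slice_pt scale0r addr0.
- by move=> z _; exact: slice_coordK.
Qed.

Lemma stem_dom_neq0 : Omega !=set0 -> D !=set0.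
Proof.
move=> [q Oq]; have [I [z [hI e]]] := quat_slice q.
by exists z; exists I => //; move: Oq; rewrite e.
Qed.

Lemma slice_domain_real : slice_domain Omega -> exists2 x0, D x0 & x0.2 = 0.
Proof.
move=> [q [Oq [a _ e]]]; exists (a, 0) => //; exists quatI; first exact: quatI_unit.
by rewrite /= /slice_pt scale0r addr0 e.
Qed.

Lemma product_domain_real : product_domain Omega -> forall z, D z -> z.2 != 0.
Proof.
move=> noreal z Dz; apply/eqP => z2.
have Oz := (stem_domP circ_Omega z (@quatI_unit R)).1 Dz.
suff : (Omega `&` realq) (ptI quatI z) by rewrite noreal.
by split => //; exists z.1 => //; rewrite /ptI z2 /slice_pt scale0r addr0.
Qed.

End Assembly.

Theorem theorem1p4 (R : realType) (Omega : set (quat R)) :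
  domain Omega -> circular Omega -> slice_contractible Omega ->
  forall g gv : quat R -> quat R,
    slice_regular Omega g ->
    (forall q, Omega q -> g q != 0) ->
    vector_part Omega g gv ->
    (forall q, ~ nonreal_isolated_zero Omega gv q) ->
    exists f : quat R -> quat R, slice_regular Omega f /\ is_star_exp Omega f g.
Proof.
case=> Omega0 oO _ circ [scS scP] g gv _ g0 hv iso.
have [c0 [c [hB sB ig igv]]] := vector_part_stem oO circ hv.
have nz := never_vanishing_stem circ ig g0.
have hc0 z : stem_dom Omega z -> hol c0 z by move=> /hB [].
have hc z : stem_dom Omega z -> hol3 c z by move=> /hB [].
have sc0 z : stem_dom Omega z -> c0 (conjC z) = conjC (c0 z).
  by move=> /sB /(congr1 fst).
have sc z : stem_dom Omega z -> c (conjC z) = conj3 (c z).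
  by move=> /sB /(congr1 snd).
have [F [hF sF eF]] : exists F, stem_log Omega c0 c F.
  have [sl|nsl] := pselect (slice_domain Omega).
    have [I hI [_ /(stem_dom_slice_sc circ hI) scD]] := scS sl.
    have [x0 Dx0 x2] := slice_domain_real sl.
    exact: (slice_log oO circ hc0 hc sc0 sc nz igv iso scD Dx0 x2).
  have pr : product_domain Omega.
    by apply/seteqP; split => // q h; apply: nsl; exists q.
  have [I hI [_ /(stem_dom_half_sc circ hI pr) scE]] := scP pr.
  have D0 := stem_dom_neq0 Omega0.
  exact: (product_log oO circ hc0 hc sc0 sc nz igv iso (product_domain_real circ pr) D0 scE).
have iF := from_stem_induced sF.
exists (from_stem F); split; first exact: (stem_slice_regular hF sF iF).
apply: (star_exp_induced circ iF ig) => // q _; exact: quat_slice.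
Qed.
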